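(* Let $E \subset \mathbb{R}^2$ be a bounded rectifiable set with $\mathcal{H}^1(E)<\infty$, with a tangent field and corresponding normal lines $\nu_x$. Let $\varepsilon > 0$, let $\alpha\in\mathbb{R}$, and let $\rho=\rho_\alpha(w,\phi)$, $(w,\phi)\in(\mathbb{R}^2\times\mathbb{R})\setminus\{0\}$, be a similarity transformation with parameter $\alpha$. Let $\ell\subset\mathbb{P}^2$ be a projective line through the projective center of $\rho$. Then there are finitely many points $x_1,\dots,x_n\in\mathbb{R}^3\setminus\{0\}$, giving intrinsic similarity transformations $\rho_i=\rho_\alpha(x_i)$ with projective centers $z_i \in B(\ell, \varepsilon) \subset \mathbb{P}^2$, such that the corresponding polygonal path $P=\bigcup_{i=1}^n L_i \subset \mathrm{Sim}^+(\mathbb{R}^2)$ connects the identity and $\rho$, and for each $i$ there exists a $u_i \in \ell$ such that $$\Big|\bigcup_{i=1}^n\ \bigcup_{p\in L_i}p\big(\{x\in E:\ (\nu_x)_\alpha \cap \ell \cap B(u_i, \varepsilon) = \emptyset\}\big)\Big|< \varepsilon .$$ Furthermore, if $\alpha \equiv \pi/2 \pmod{\pi}$, then we can take $z_i \in \ell$.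
   Context: Identify $\mathbb{R}^2$ with $\mathbb{C}$ and $\mathbb{R}^3$ with $\mathbb{R}^2\times\mathbb{R}$. $\mathcal{H}^1$ is 1-dimensional Hausdorff measure, $|\cdot|$ is Lebesgue measure on $\mathbb{R}^2$, and $\mathrm{Sim}^+(\mathbb{R}^2)$ is the space of orientation-preserving similarity transformations of $\mathbb{R}^2$. Projective plane. $\mathbb{P}^1\simeq\mathbb{R}/\pi\mathbb{Z}$ is the set of directions in $\mathbb{R}^2$, and $\mathbb{P}^2=\mathbb{R}^2\cup\mathbb{P}^1$ is the quotient of $\mathbb{R}^3\setminus\{0\}$ by nonzero scalars; $z\in\mathbb{R}^2$ corresponds to the class of $(z,1)$ and $\theta\in\mathbb{P}^1$ to the class of $(e^{i\theta},0)$. $\mathbb{P}^2$ carries the metric induced from the arc-length metric of $S^2$ via $S^2\to\mathbb{P}^2$. $B(u,r)$ is the open ball and $B(S,r)$ the open $r$-neighborhood of a set $S$ in this metric. Rectifiability. $E$ is rectifiable if $\mathcal{H}^1$-a.e. point of $E$ can be covered by countably many $C^1$ curves. A tangent field is a map $x\mapsto\theta_x\in\mathbb{P}^1$ on $E$ such that for any $C^1$ curve $\Gamma$ the tangent direction of $\Gamma$ at $x$ equals $\theta_x$ for $\mathcal{H}^1$-a.e. $x\in\Gamma\cap E$ (unique up to $\mathcal{H}^1$-null sets; any pointwise choice is allowed). $\nu_x\subset\mathbb{P}^2$ is the projective line through $x$ with direction orthogonal to $\theta_x$. $(\nu_x)_\alpha$ denotes the line $\nu_x$ rotated around $x$ by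 angle $\alpha$, with the orientation such that $(\nu_x)_\alpha$ is the line through $x$ in the direction $ie^{-i\alpha}e^{i\theta_x}$. Similarities. For $\alpha,\phi\in\mathbb{R}$ put $\phi_\alpha=e^{i\alpha}\phi$. For $w\in\mathbb{R}^2=\mathbb{C}$ and $\phi\ne0$, $\rho_\alpha(w,\phi)$ is the map $u\mapsto e^{i\phi_\alpha}(u-z)+z$ with $z=w/\phi_\alpha$; $\rho_\alpha(w,0)$ is the translation by $-iw$. For $(w,\phi)\neq(0,0)$ the projective center of $\rho_\alpha(w,\phi)$ is the image of $(e^{-i\alpha}w,\phi)$ in $\mathbb{P}^2$. Intrinsic transformations and polygonal paths. For a finite sequence $\rho_i=\rho_\alpha(x_i)$, $i=1,\dots,n$, regarded as intrinsic transformations (performed one after another, each specified in the moving coordinate system), the corresponding polygonal path is $P=\bigcup_{i=1}^nL_i$ with $L_i=\{\rho_1\circ\cdots\circ\rho_{i-1}\circ\rho_\alpha(tx_i):\ t\in[0,1]\}$, where $\rho_\alpha(0)=\mathrm{id}$. It connects the identity to $\rho_1\circ\cdots\circ\rho_n$. *)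

(* Defs.v *)
From HB Require Import structures.
From mathcomp Require Import all_boot all_order all_algebra generic_quotient.
From mathcomp Require Import all_classical all_reals all_analysis.
From mathcomp Require Import complex.

Set Implicit Arguments.
Unset Strict Implicit.
Unset Printing Implicit Defensive.

Import Order.TTheory GRing.Theory Num.Theory.
Import numFieldNormedType.Exports.
Import ComplexField.Normc.

Local Open Scope classical_set_scope.
Local Open Scope ring_scope.
Local Open Scope complex_scope.
Local Open Scope quotient_scope.

(* The plane is R[i], and R^3 = R^2 x R is R[i] * R. *)

Definition expi (R : realType) (t : R) : R[i] := cos t +i* sin t.

Definition expC (R : realType) (z : R[i]) : R[i] :=
  (expR (complex.Re z))%:C * expi (complex.Im z).

Definition vec3 (R : realType) : Type := (R[i] * R)%type.

Definition scale3 (R : realType) (c : R) (v : vec3 R) : vec3 R :=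
  (c%:C * v.1, c * v.2).

Definition dot3 (R : realType) (u v : vec3 R) : R :=
  complex.Re u.1 * complex.Re v.1 + complex.Im u.1 * complex.Im v.1
  + u.2 * v.2.

Definition nzvec3 (R : realType) : Type := {v : R[i] * R | v != 0}.

Definition proportional (R : realType) (u v : nzvec3 R) : bool :=
  `[< exists2 c : R, c != 0 & val u = scale3 c (val v) >].

Lemma proportional_refl (R : realType) : reflexive (@proportional R).
Proof.
move=> [[z t] h]; apply/asboolP; exists 1; first exact: oner_neq0.
by rewrite /scale3 /= !mul1r.
Qed.

Lemma proportional_sym (R : realType) : symmetric (@proportional R).
Proof.
suff H u v : @proportional R u v -> proportional v u.
  by move=> u v; apply/idP/idP; exact: H.
move=> /asboolP[c c0 e]; apply/asboolP; exists c^-1; first by rewrite invr_eq0.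
rewrite e; case: (val v) => z t.
by rewrite /scale3 /= !mulrA -rmorphM /= mulVf// !mul1r.
Qed.

Lemma proportional_trans (R : realType) : transitive (@proportional R).
Proof.
move=> v u w /asboolP[c c0 e] /asboolP[d d0 f].
apply/asboolP; exists (c * d); first by rewrite mulf_neq0.
by rewrite e f; case: (val w) => z t; rewrite /scale3 /= rmorphM /= !mulrA.
Qed.

Canonical proportional_equiv (R : realType) :=
  EquivRel (@proportional R) (@proportional_refl R) (@proportional_sym R)
    (@proportional_trans R).

Definition P2 (R : realType) : Type := {eq_quot @proportional R}.

Lemma e3_neq0 (R : realType) : (0, 1) != 0 :> R[i] * R.
Proof. by apply/negP => /eqP[] /eqP; rewrite oner_eq0. Qed.

(* The class of v in P^2; the value at v = 0 is junk. *)
Definition to_P2 (R : realType) (v : vec3 R) : P2 R :=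
  \pi_(P2 R) (insubd (exist (fun u : R[i] * R => u != 0) (0, 1) (e3_neq0 R)) v).

(* The quotient of the arc-length metric of S^2. *)
Definition dist_P2 (R : realType) (p q : P2 R) : R :=
  inf [set a | exists u v : vec3 R,
    [/\ dot3 u u = 1, dot3 v v = 1, to_P2 u = p, to_P2 v = q
      & a = acos (dot3 u v)]].

Definition ball_P2 (R : realType) (u : P2 R) (r : R) : set (P2 R) :=
  [set p | dist_P2 u p < r].

Definition nbhd_P2 (R : realType) (S : set (P2 R)) (r : R) : set (P2 R) :=
  [set p | exists2 q, S q & dist_P2 q p < r].

Definition is_line (R : realType) (l : set (P2 R)) : Prop :=
  exists2 n : vec3 R, n <> 0
    & l = [set to_P2 v | v in [set v : vec3 R | v <> 0 /\ dot3 n v = 0]].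

(* The projective line through the point x of the plane with direction d <> 0,
   including its point at infinity. *)
Definition line_through (R : realType) (x d : R[i]) : set (P2 R) :=
  [set to_P2 (x + t%:C * d, 1) | t in [set: R]] `|` [set to_P2 (d, 0)].

(* (nu_x)_alpha, where the angle theta represents the tangent direction at x
   modulo pi; alpha = 0 gives nu_x. *)
Definition rotated_normal (R : realType) (alpha : R) (x : R[i]) (theta : R) :
    set (P2 R) :=
  line_through x ('i%C * expi (- alpha) * expi theta).

(* 1-dimensional Hausdorff (outer) measure. The maximum with 0 makes the
   diameter of the empty set 0, as ereal_sup set0 = -oo. *)
Definition diam (R : realType) (U : set R[i]) : \bar R :=
  maxe 0%E (ereal_sup [set a : \bar R |
    exists x y, [/\ U x, U y & a = (normc (x - y))%:E]]).

Definition hausdorff1_delta (R : realType) (delta : R) (A : set R[i]) :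
    \bar R :=
  ereal_inf [set s | exists U : nat -> set R[i],
    [/\ A `<=` \bigcup_k U k, forall k, (diam (U k) <= delta%:E)%E
      & s = (\sum_(0 <= k <oo) diam (U k))%E]].

Definition hausdorff1 (R : realType) (A : set R[i]) : \bar R :=
  ereal_sup [set hausdorff1_delta delta A | delta in [set d : R | 0 < d]].

(* Lebesgue outer measure of the plane. It coincides with Lebesgue measure on
   measurable sets; images of non-measurable sets need not be measurable. *)
Definition lebesgue2 (R : realType) (A : set R[i]) : \bar R :=
  mu_ext (@lebesgue_measure R \x @lebesgue_measure R)%E
    [set q : R * R | A (q.1 +i* q.2)].

Definition velocity (R : realType) (g : R -> R[i]) (t : R) : R[i] :=
  derive1 (fun s => complex.Re (g s)) t
  +i* derive1 (fun s => complex.Im (g s)) t.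

(* Regular C^1 parametrizations. The curve itself is the image of [0, 1];
   every regular C^1 arc parametrized by [0, 1] extends in this way to the
   whole real line. *)
Definition C1_curve (R : realType) (g : R -> R[i]) : Prop :=
  [/\ forall t, derivable (fun s => complex.Re (g s)) t 1
        /\ derivable (fun s => complex.Im (g s)) t 1,
      continuous (derive1 (fun s => complex.Re (g s))),
      continuous (derive1 (fun s => complex.Im (g s)))
    & forall t, velocity g t <> 0].

Definition curve_image (R : realType) (g : R -> R[i]) : set R[i] :=
  [set g t | t in `[0, 1]].

Definition rectifiable (R : realType) (E : set R[i]) : Prop :=
  exists2 g : nat -> R -> R[i], forall k, C1_curve (g k)
    & hausdorff1 (E `\` \bigcup_k curve_image (g k)) = 0%E.

(* theta x is an angle representing the direction theta_x in R / pi Z. A curve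
   may pass several times through the same point; apart from countably many
   points its tangent directions there coincide. *)
Definition tangent_field (R : realType) (E : set R[i]) (theta : R[i] -> R) :
    Prop :=
  forall g : R -> R[i], C1_curve g ->
    hausdorff1 [set x | E x /\ exists t : R, [/\ 0 <= t <= 1, g t = x
      & ~ exists r : R, velocity g t = r%:C * expi (theta x)]] = 0%E.

Definition bounded_plane (R : realType) (E : set R[i]) : Prop :=
  exists M : R, forall x, E x -> normc x <= M.

(* For phi = 0 the map is the translation by - i w; in particular
   similarity alpha 0 is the identity. *)
Definition similarity (R : realType) (alpha : R) (x : vec3 R) :
    R[i] -> R[i] :=
  let phia := expi alpha * (x.2)%:C in
  let z := x.1 / phia in
  fun u => if x.2 == 0 then u - 'i%C * x.1 else expC ('i%C * phia) * (u - z) + z.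

Definition proj_center (R : realType) (alpha : R) (x : vec3 R) : P2 R :=
  to_P2 (expi (- alpha) * x.1, x.2).

(* With 0-based indices: the composition rho_0 \o ... \o rho_(i-1). *)
Fixpoint partial_comp (R : realType) (alpha : R) (x : nat -> vec3 R)
    (i : nat) : R[i] -> R[i] :=
  if i is j.+1 then partial_comp alpha x j \o similarity alpha (x j)
  else id.

Definition path_piece (R : realType) (alpha : R) (x : nat -> vec3 R)
    (i : nat) : set (R[i] -> R[i]) :=
  [set partial_comp alpha x i \o similarity alpha (scale3 t (x i))
    | t in `[0, 1]].

(* Main.v *)
Require Import Defs.
From HB Require Import structures.
From mathcomp Require Import all_boot all_order all_algebra.
From mathcomp Require Import all_classical all_reals all_analysis.
From mathcomp Require Import complex.
From mathcomp Require Import ring lra.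

Import Order.TTheory GRing.Theory Num.Theory.
Import numFieldNormedType.Exports.

Local Open Scope classical_set_scope.
Local Open Scope ring_scope.
Local Open Scope complex_scope.

(** The motions with a fixed projective center form a one-parameter group, and
   their velocity at a point y of a curve is tangent to the curve exactly when
   the center lies on the rotated normal at y. A curve moved along itself sweeps
   no area. So, for u on the line l, a motion with center u sweeps little area
   with the short arcs whose rotated normals pass near u, while the arcs whose
   rotated normals meet l near u need not be accounted for at all: these are the
   arcs killed by u. Centers on l form a plane in R^3, and each short arc
   defines a linear form on this plane, the normal component of its velocity;
   the arc is killed by u if its form nearly vanishes at u.

   The given motion is replaced by zigzags. Call a motion replaceable at cost a
   if for all short times h it can be replaced by a path with centers near l
   such that the area swept by the arcs, except where they are killed, plus tau
   times the length of the path is at most about a h (replaceable). Costs add up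
   (replaceable_add): the motion along x + y is the limit of fine zigzags along
   x and y. The error caused by the noncommutativity of similarities is of
   second order and is absorbed in the second factor, whose center thereby
   leaves l slightly, unless the similarities are homotheties and translations
   (flow_split); this is the case of alpha congruent to pi / 2 modulo pi. An arc
   may be swept once by the direct motion instead, at a cost proportional to its
   length and to the value of its form (replaceable_cross, arc_crossing);
   afterwards the zigzags, which stay close to the direct motion, may do with it
   whatever they like.

   The directions of the plane of centers are divided into short pieces, and
   each arc is assigned to a piece on which its form changes sign. If all
   remaining arcs belong to pieces near one direction, they are killed by it,
   and the direct motion costs only tau times its length
   (bounded_cost_terminal). Otherwise there are two transversal pieces. To move
   in the direction p of the first, pass in many small steps from p to the other
   end f of the piece, and sweep each of its arcs when its form changes sign,
   where this costs almost nothing. There remain a motion along f, for which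
   there are fewer arcs to care about, and motions of total length |p - f|, a
   small part of the original one (replaceable_turn). With this for both pieces
   every motion becomes cheap up to half of any previous cost
   (bounded_cost_halve), hence by iteration (bounded_cost_limit) up to nothing.
   By induction on the number of pieces, all motions cost at most tau times a
   constant that depends on eps only (bounded_cost_all).

   In particular the length of the path is bounded independently of tau and of
   the arcs. So tau is chosen first, then finitely many curves that cover E up
   to a set of measure less than tau (hausdorff1_tail, exceptional_set), and
   then the path for these curves (curves_bounded_cost). The rest of E is
   covered by small sets, and what they sweep has an area of at most a constant
   times the length of the path times tau (lebesgue2_sweep_hausdorff). *)

Set Implicit Arguments.
Unset Strict Implicit.
Unset Printing Implicit Defensive.
Import ComplexField.Normc.

(** * The plane as the field of complex numbers *)

Section ComplexNorm.
Variable R : realType.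
Implicit Types (x y z : R[i]) (a b r : R).

Lemma normc_ge0 z : 0 <= normc z.
Proof. by case: z => a b; rewrite sqrtr_ge0. Qed.

Lemma ler_normcD x y : normc (x + y) <= normc x + normc y.
Proof.
rewrite -lecR rmorphD /=.
by have := ler_normD x y; rewrite !normc_def; case: x => ? ?; case: y => ? ?.
Qed.

Lemma normcN z : normc (- z) = normc z.
Proof. by case: z => a b /=; rewrite !sqrrN. Qed.

Lemma normcBC x y : normc (x - y) = normc (y - x).
Proof. by rewrite -normcN opprB. Qed.

Lemma ler_normcB x y : normc (x - y) <= normc x + normc y.
Proof. by rewrite -(normcN y); exact: ler_normcD. Qed.

Lemma ler_normc_dist x y z : normc (x - z) <= normc (x - y) + normc (y - z).
Proof. by have := ler_normcD (x - y) (y - z); rewrite addrA subrK. Qed.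

Lemma normc_real r : normc r%:C = `|r|.
Proof. by rewrite /= expr0n /= addr0 sqrtr_sqr. Qed.

Lemma normc_scale r z : normc (r%:C * z) = `|r| * normc z.
Proof. by rewrite normcM normc_real. Qed.

Lemma normc_eq0 z : (normc z == 0) = (z == 0).
Proof. by apply/eqP/eqP => [/eq0_normc//|->]; rewrite normc0. Qed.

Lemma normc_gt0 z : (0 < normc z) = (z != 0).
Proof. by rewrite lt_def normc_ge0 andbT normc_eq0. Qed.

Lemma sqr_normcE z : normc z ^+ 2 = complex.Re z ^+ 2 + complex.Im z ^+ 2.
Proof. by case: z => a b /=; rewrite sqr_sqrtr// addr_ge0// sqr_ge0. Qed.

Lemma ler_Re_normc z : `|complex.Re z| <= normc z.
Proof.
rewrite -(@ler_pXn2r _ 2)// ?nnegrE ?normc_ge0//.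
by rewrite sqr_normcE real_normK ?num_real// lerDl sqr_ge0.
Qed.

Lemma ler_Im_normc z : `|complex.Im z| <= normc z.
Proof.
rewrite -(@ler_pXn2r _ 2)// ?nnegrE ?normc_ge0//.
by rewrite sqr_normcE real_normK ?num_real// lerDr sqr_ge0.
Qed.

Lemma ler_normc_ReIm z : normc z <= `|complex.Re z| + `|complex.Im z|.
Proof.
rewrite -(@ler_pXn2r _ 2)// ?nnegrE ?normc_ge0 ?addr_ge0//.
rewrite sqr_normcE -(real_normK (num_real (complex.Re z))).
rewrite -(real_normK (num_real (complex.Im z))).
have := normr_ge0 (complex.Re z); have := normr_ge0 (complex.Im z); nra.
Qed.

Lemma normc_expi a : normc (expi a) = 1.
Proof. by rewrite /= cos2Dsin2 sqrtr1. Qed.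

Lemma expiD a b : expi (a + b) = expi a * expi b.
Proof.
rewrite /expi cosD sinD; apply/eqP.
by rewrite eq_complex/= [_ * sin b + _]addrC eqxx/=; apply/eqP; ring.
Qed.

Lemma expi0 : expi 0 = 1 :> R[i].
Proof. by rewrite /expi cos0 sin0. Qed.

Lemma expiNK a : expi (- a) * expi a = 1.
Proof. by rewrite -expiD addNr expi0. Qed.

Lemma expi_neq0 a : expi a != 0.
Proof. by rewrite -normc_eq0 normc_expi oner_eq0. Qed.

Lemma expCD x y : expC (x + y) = expC x * expC y.
Proof.
case: x y => [a b] [c d]; rewrite /expC /= expRD expiD rmorphM /=; ring.
Qed.

Lemma expC0 : expC 0 = 1 :> R[i].
Proof. by rewrite /expC /= expR0 expi0 mulr1. Qed.

Lemma normc_expC z : normc (expC z) = expR (complex.Re z).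
Proof. by rewrite /expC normcM normc_expi normc_real mulr1 ger0_norm// expR_ge0. Qed.

Lemma expC_neq0 z : expC z != 0.
Proof. by rewrite -normc_eq0 normc_expC gt_eqF// expR_gt0. Qed.

End ComplexNorm.

(** * First-order estimates for the complex exponential *)

Section RealEstimates.
Variable R : realType.
Implicit Types (a b x s t : R).

Lemma mvt_affine_bound (f df : R -> R) (d sg a b : R) :
  (forall x, is_derive x 1 f (df x)) ->
  (forall x, a <= x <= b -> `|df x - d| <= sg) -> a <= b ->
  `|f b - f a - d * (b - a)| <= sg * (b - a).
Proof.
move=> fd dfd ab.
have [] := @MVT_segment R f df a b ab (fun x _ => fd x).
  apply: continuous_subspaceT => x.
  by apply: differentiable_continuous; apply/derivable1_diffP; have [] := fd x.
move=> c; rewrite in_itv/= => cab ->.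
rewrite -mulrBl normrM (ger0_norm (_ : 0 <= b - a)) ?subr_ge0//.
by rewrite ler_wpM2r ?subr_ge0// dfd.
Qed.

Lemma mvt_affine_bound_abs (f df : R -> R) (d sg a b : R) :
  (forall x, is_derive x 1 f (df x)) ->
  (forall x, `|x - a| <= `|b - a| -> `|df x - d| <= sg) ->
  `|f b - f a - d * (b - a)| <= sg * `|b - a|.
Proof.
move=> fd dfd; have [ab|/ltW ba] := leP a b.
  rewrite (ger0_norm (_ : 0 <= b - a)) ?subr_ge0//.
  apply: (mvt_affine_bound fd) => // x /andP[ax xb].
  by apply: dfd; rewrite !ger0_norm ?subr_ge0// lerD2r.
rewrite distrC (distrC b a) (ger0_norm (_ : 0 <= a - b)) ?subr_ge0//.
rewrite (_ : _ - _ = f a - f b - d * (a - b)); last by ring.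
apply: (mvt_affine_bound fd) => // x /andP[bx xa].
apply: dfd; rewrite distrC (distrC b) !ger0_norm ?subr_ge0//.
by rewrite lerD2l lerN2.
Qed.

Lemma ler_norm_sin x : `|sin x| <= `|x|.
Proof.
have := @mvt_affine_bound_abs sin cos 0 1 0 x (fun y => is_derive_sin y) _.
rewrite sin0 !subr0 mul0r subr0 mul1r; apply => y _.
by rewrite subr0 cos_max.
Qed.

Lemma ler_cosB1 x : `|cos x - 1| <= x ^+ 2 / 2.
Proof.
have -> : cos x - 1 = - (2 * sin (x / 2) ^+ 2).
  have -> : cos x = cos ((x / 2) *+ 2) by congr cos; lra.
  by rewrite cos_mulr2n cos2sin2; lra.
rewrite normrN normrM normrX.
have := ler_norm_sin (x / 2); have := normr_ge0 (sin (x / 2)).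
rewrite normrM (ger0_norm (_ : 0 <= 2))// (ger0_norm (_ : 0 <= 2^-1))//.
have := real_normK (num_real x); have := normr_ge0 x; nra.
Qed.

Lemma ler_sinBid x : `|x| <= 1 -> `|sin x - x| <= x ^+ 2.
Proof.
move=> x1.
have := @mvt_affine_bound_abs sin cos 1 `|x| 0 x (fun y => is_derive_sin y) _.
rewrite sin0 !subr0 mul1r -normrM -expr2 (ger0_norm (sqr_ge0 x)); apply => y.
rewrite !subr0 => yx; apply: le_trans (ler_cosB1 y) _.
have := real_normK (num_real y); have := normr_ge0 y; nra.
Qed.

Lemma ler_expRB1Dx x : `|x| <= 1 / 2 -> `|expR x - 1 - x| <= 2 * x ^+ 2.
Proof.
rewrite ler_norml => /andP[x1 x2].
have e1 := expR_ge1Dx x; have := expR_ge1Dx (- x); rewrite expRN => e2.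
have e0 := expR_gt0 x.
have : expR x * (1 - x) <= 1.
  by rewrite -ler_pdivlMl// mulr1.
by rewrite ler_norml; move=> H; apply/andP; split; nra.
Qed.

End RealEstimates.

Section ComplexExponential.
Variable R : realType.

Lemma ler_expCB1Dz (z : R[i]) : normc z <= 1 / 2 ->
  normc (expC z - 1 - z) <= 3 * normc z ^+ 2.
Proof.
move=> z1; have zr := le_trans (ler_Re_normc z) z1.
have zi := le_trans (ler_Im_normc z) z1.
rewrite sqr_normcE; apply: le_trans (ler_normc_ReIm _) _.
case: z {z1} zr zi => a b /= ha hb; rewrite /expC /expi /=.
rewrite !mul0r subr0 addr0 subr0.
have Ha := ler_expRB1Dx ha; have Hb := ler_cosB1 b.
have Hs : `|sin b - b| <= b ^+ 2 by apply: ler_sinBid; lra.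
have Hs' := ler_norm_sin b.
have e2 : expR a <= 2.
  move: Ha ha; rewrite !ler_norml => /andP[_ ?] /andP[? ?]; nra.
have e0 := expR_gt0 a.
have -> : expR a * cos b - 1 - a = (expR a - 1 - a) + expR a * (cos b - 1) by ring.
have -> : expR a * sin b - b = (expR a - 1) * sin b + (sin b - b) by ring.
apply: le_trans (lerD (ler_normD _ _) (ler_normD _ _)) _.
rewrite !normrM (ger0_norm (ltW e0)).
have He1 : `|expR a - 1| <= 2 * `|a|.
  have -> : expR a - 1 = (expR a - 1 - a) + a by ring.
  apply: le_trans (ler_normD _ _) _.
  have := real_normK (num_real a); have := normr_ge0 a; nra.
have : expR a * `|cos b - 1| <= 2 * (b ^+ 2 / 2) by apply: ler_pM => //; exact: ltW.
have : `|expR a - 1| * `|sin b| <= 2 * `|a| * `|b| by apply: ler_pM.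
have := real_normK (num_real a); have := real_normK (num_real b).
have := normr_ge0 a; have := normr_ge0 b.
have := sqr_ge0 (`|a| - `|b|); nra.
Qed.

End ComplexExponential.

(** * One-parameter groups of similarities *)

Section Flow.
Variable R : realType.
Variable kap : R[i].
Hypothesis kap1 : normc kap = 1.
Implicit Types (u y z c : R[i]) (v x : vec3 R) (f g s t h r : R).

Definition lin f : R[i] := expC (kap * f%:C).

(** (exp (kap f) - 1) / (kap f), the mean of the linear parts over the time from
   0 to 1; the value 1 at f = 0 is the continuous extension. *)
Definition flowE f : R[i] := if f == 0 then 1 else (lin f - 1) / (kap * f%:C).

(** The time-one map of the vector field u |-> kap * (v.2 * u - v.1). For
   kap = i e^(i alpha) it is the intrinsic transformation with parameter alpha
   whose projective center is the class of v, so that transformations with the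
   same center form a one-parameter group. *)
Definition flow v u : R[i] := lin v.2 * u - kap * v.1 * flowE v.2.

Definition nv v : R := normc v.1 + `|v.2|.

Lemma kap_neq0 : kap != 0.
Proof. by rewrite -normc_eq0 kap1 oner_eq0. Qed.

Lemma nv_ge0 v : 0 <= nv v.
Proof. by rewrite addr_ge0 ?normc_ge0. Qed.

Lemma nvD v x : nv (v + x) <= nv v + nv x.
Proof.
rewrite /nv /=; have := ler_normcD v.1 x.1; have := ler_normD v.2 x.2; lra.
Qed.

Lemma nvN v : nv (- v) = nv v.
Proof. by rewrite /nv /= normcN normrN. Qed.

Lemma nv_scale t v : nv (scale3 t v) = `|t| * nv v.
Proof. by rewrite /nv /= normc_scale normrM mulrDr. Qed.

Lemma nv_eq0 v : (nv v == 0) = (v == 0).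
Proof.
rewrite /nv paddr_eq0 ?normc_ge0// normc_eq0 normr_eq0.
by case: v.
Qed.

Lemma nv_gt0 v : (0 < nv v) = (v != 0).
Proof. by rewrite lt_def nv_ge0 andbT nv_eq0. Qed.

Lemma nv0 : nv 0 = 0.
Proof. by apply/eqP; rewrite nv_eq0. Qed.

Lemma scale3A s t v : scale3 s (scale3 t v) = scale3 (s * t) v.
Proof. by rewrite /scale3 /= rmorphM /= !mulrA. Qed.

Lemma scale3Dr s v x : scale3 s (v + x) = scale3 s v + scale3 s x.
Proof. by rewrite /scale3 /= !mulrDr. Qed.

Lemma scale3Dl s t v : scale3 (s + t) v = scale3 s v + scale3 t v.
Proof. by rewrite /scale3 rmorphD /= !mulrDl. Qed.

Lemma scale3N s v : scale3 s (- v) = - scale3 s v.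
Proof. by rewrite /scale3 /= !mulrN. Qed.

Lemma scale3_1 v : scale3 1 v = v.
Proof. by case: v => a b; rewrite /scale3 /= !mul1r. Qed.

Lemma scale3_0 v : scale3 0 v = 0.
Proof. by case: v => a b; rewrite /scale3 /= !mul0r. Qed.

Lemma scale3_eq0 t v : (scale3 t v == 0) = (t == 0) || (v == 0).
Proof. by rewrite -!nv_eq0 nv_scale mulf_eq0 normr_eq0. Qed.

Lemma linD f g : lin (f + g) = lin f * lin g.
Proof. by rewrite /lin rmorphD /= mulrDr expCD. Qed.

Lemma lin0 : lin 0 = 1.
Proof. by rewrite /lin mulr0 expC0. Qed.

Lemma lin_neq0 f : lin f != 0. Proof. exact: expC_neq0. Qed.

Lemma normc_kapM f : normc (kap * f%:C) = `|f|.
Proof. by rewrite normcM kap1 normc_real mul1r. Qed.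

Lemma normc_lin_le f : normc (lin f) <= expR `|f|.
Proof.
rewrite normc_expC ler_expR -(normc_kapM f).
exact: le_trans (ler_norm _) (ler_Re_normc _).
Qed.

Lemma flowE_spec f : kap * f%:C * flowE f = lin f - 1.
Proof.
rewrite /flowE; have [->|f0] := eqVneq f 0; first by rewrite lin0 mulr0 mul0r subrr.
by rewrite mulrC divfK// mulf_neq0 ?kap_neq0//; apply: contra f0 => /eqP[->].
Qed.

Lemma flow_sub v u z : flow v u - flow v z = lin v.2 * (u - z).
Proof. by rewrite /flow; ring. Qed.

Lemma flow0 u : flow 0 u = u.
Proof. by rewrite /flow /= lin0 mul1r mulr0 mul0r subr0. Qed.

Lemma flow_scaleD s t v u :
  flow (scale3 s v) (flow (scale3 t v) u) = flow (scale3 (s + t) v) u.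
Proof.
case: v => c f; rewrite /flow /scale3 /= mulrDl linD.
have key : t%:C * lin (s * f) * flowE (t * f) + s%:C * flowE (s * f)
    = (s + t)%:C * flowE (s * f + t * f).
  have [->|f0] := eqVneq f 0.
    rewrite /flowE !mulr0 addr0 eqxx lin0 !mulr1 rmorphD /= addrC //.
  have kf0 : kap * f%:C != 0.
    by rewrite mulf_neq0 ?kap_neq0//; apply: contra f0 => /eqP[->].
  apply: (mulfI kf0).
  have E r : kap * f%:C * (r%:C * flowE (r * f)) = lin (r * f) - 1.
    by rewrite -flowE_spec rmorphM /=; ring.
  transitivity (lin (s * f) * (kap * f%:C * (t%:C * flowE (t * f)))
     + kap * f%:C * (s%:C * flowE (s * f))); first by ring.
  by rewrite -mulrDl !E mulrDl linD; ring.
rewrite (_ : _ - kap * ((s + t)%:C * c) * _ =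
  lin (s * f) * lin (t * f) * u
  - kap * c * ((s + t)%:C * flowE (s * f + t * f))); last by ring.
by rewrite -key; ring.
Qed.

Section SmallTime.
Variable f : R.
Hypothesis f_small : `|f| <= 1 / 2.

Lemma lin_taylor : normc (lin f - 1 - kap * f%:C) <= 3 * f ^+ 2.
Proof.
have := @ler_expCB1Dz _ (kap * f%:C).
by rewrite normc_kapM real_normK ?num_real//; exact.
Qed.

Lemma lin_near1 : normc (lin f - 1) <= 3 * `|f|.
Proof.
have := ler_normcD (lin f - 1 - kap * f%:C) (kap * f%:C).
rewrite subrK normc_kapM => /le_trans; apply.
have := lin_taylor; rewrite -[f ^+ 2]real_normK ?num_real//.
have : `|f| * `|f| <= 1 / 2 * `|f| by rewrite ler_wpM2r.
by rewrite -expr2; have := normr_ge0 f; lra.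
Qed.

Lemma flowE_near1 : normc (flowE f - 1) <= 3 * `|f|.
Proof.
have [f0|f0] := eqVneq f 0.
  by rewrite /flowE f0 eqxx subrr normc0 normr0 mulr0.
have fp : 0 < `|f| by rewrite normr_gt0.
rewrite -(ler_pM2l fp) -{1}normc_kapM -normcM mulrBr mulr1 flowE_spec.
by apply: le_trans lin_taylor _; rewrite -[f ^+ 2]real_normK ?num_real//; lra.
Qed.

End SmallTime.

Lemma nv2_le v : `|v.2| <= nv v.
Proof. by rewrite lerDr normc_ge0. Qed.

Lemma nv1_le v : normc v.1 <= nv v.
Proof. by rewrite lerDl. Qed.

Lemma flow_taylor v u : nv v <= 1 / 2 ->
  normc (flow v u - u - kap * (v.2%:C * u - v.1))
    <= 3 * (1 + normc u) * nv v ^+ 2.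
Proof.
move=> v1; have f1 : `|v.2| <= 1 / 2 := le_trans (nv2_le v) v1.
have -> : flow v u - u - kap * (v.2%:C * u - v.1) =
   (lin v.2 - 1 - kap * v.2%:C) * u - kap * v.1 * (flowE v.2 - 1).
  by rewrite /flow; ring.
apply: le_trans (ler_normcB _ _) _; rewrite !normcM kap1 mul1r.
have H1 := lin_taylor f1; have H2 := flowE_near1 f1.
have : normc (lin v.2 - 1 - kap * v.2%:C) * normc u <= 3 * v.2 ^+ 2 * normc u.
  by rewrite ler_wpM2r ?normc_ge0.
have : normc v.1 * normc (flowE v.2 - 1) <= normc v.1 * (3 * `|v.2|).
  by rewrite ler_wpM2l ?normc_ge0.
have := normc_ge0 u; have := normc_ge0 v.1; have := normr_ge0 v.2.
rewrite -[v.2 ^+ 2]real_normK ?num_real// /nv.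
move: (normc u) (normc v.1) `|v.2| => p q r r0 q0 p0 A B.
apply: le_trans (lerD B A) _.
have H1' := mulr_ge0 p0 (mulr_ge0 q0 r0); have H2' := mulr_ge0 p0 (mulr_ge0 q0 q0).
have H3' := mulr_ge0 q0 r0; have H4' := mulr_ge0 q0 q0.
have H5' := mulr_ge0 r0 r0; rewrite !expr2; lra.
Qed.

Lemma flow_near_id v u : nv v <= 1 / 2 ->
  normc (flow v u - u) <= 3 * (1 + normc u) * nv v.
Proof.
move=> v1; have f1 : `|v.2| <= 1 / 2 := le_trans (nv2_le v) v1.
have -> : flow v u - u = (lin v.2 - 1) * u - kap * v.1 * (flowE v.2 - 1) - kap * v.1.
  by rewrite /flow; ring.
apply: le_trans (ler_normcB _ _) _.
apply: le_trans (lerD (ler_normcB _ _) (lexx _)) _; rewrite !normcM kap1 !mul1r.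
have H1 := lin_near1 f1; have H2 := flowE_near1 f1.
have : normc (lin v.2 - 1) * normc u <= 3 * `|v.2| * normc u.
  by rewrite ler_wpM2r ?normc_ge0.
have : normc v.1 * normc (flowE v.2 - 1) <= normc v.1 * (3 / 2).
  by rewrite ler_wpM2l ?normc_ge0//; lra.
have := normc_ge0 u; have := normc_ge0 v.1; have := normr_ge0 v.2; rewrite /nv.
move: (normc u) (normc v.1) `|v.2| => p q r r0 q0 p0 A B.
apply: le_trans (lerD (lerD B A) (lexx _)) _.
have := mulr_ge0 p0 q0; have := mulr_ge0 p0 r0; lra.
Qed.

(** Since similarities do not commute, splitting the vector v + x of a flow
   changes the second factor; the change is of second order, and there is none
   in the rotation component. *)
Lemma flow_split v x : nv v + nv x <= 1 / 12 ->
  exists2 c, (forall u, flow v (flow (c, x.2) u) = flow (v + x) u)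
   & normc (c - x.1) <= 30 * (nv v + nv x) ^+ 2
   /\ (forall n : vec3 R, complex.Im kap = 0 -> dot3 n v = 0 -> dot3 n x = 0 ->
         dot3 n (c, x.2) = 0).
Proof.
move=> s1; set s := nv v + nv x in s1 *.
have v0 := nv_ge0 v; have x0 := nv_ge0 x.
have fv : `|v.2| <= s by apply: le_trans (nv2_le v) _; rewrite lerDl.
have fx : `|x.2| <= s by apply: le_trans (nv2_le x) _; rewrite lerDr.
have fvx : `|v.2 + x.2| <= s.
  by apply: le_trans (ler_normD _ _) _; rewrite /s lerD ?nv2_le.
have s2 : s <= 1 / 2 by lra.
have Ev := flowE_near1 (le_trans fv s2); have Ex := flowE_near1 (le_trans fx s2).
have Evx := flowE_near1 (le_trans fvx s2).
have Lv := @lin_near1 (- v.2); rewrite normrN in Lv.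
have {}Lv := Lv (le_trans fv s2).
have Ex2 : 1 / 2 <= normc (flowE x.2).
  have := ler_normcD (flowE x.2) (1 - flowE x.2).
  rewrite addrC subrK normc1 normcBC; lra.
have Ex0 : flowE x.2 != 0 by rewrite -normc_gt0; lra.
pose A := (v.1 + x.1) * flowE (v.2 + x.2) - v.1 * flowE v.2.
have linvK : lin v.2 * lin (- v.2) = 1 by rewrite -linD subrr lin0.
(* The equation flow v (flow (c, x.2) u) = flow (v + x) u solved for c. *)
exists (lin (- v.2) * A / flowE x.2) => [u|].
  rewrite /flow /= linD.
  rewrite (_ : lin v.2 * _ = lin v.2 * lin x.2 * u
     - (lin v.2 * lin (- v.2)) * (kap * A) * (flowE x.2 / flowE x.2)); last by ring.
  by rewrite linvK divff// /A; ring.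
split; last first.
  move=> n kr nv0 nx0.
  have [kr' kapE] : exists k : R, kap = k%:C.
    by exists (complex.Re kap); case: (kap) kr => a b /= ->.
  have linr f : exists r : R, lin f = r%:C.
    by rewrite /lin kapE -rmorphM /expC /= expi0 mulr1; eexists.
  have Er f : exists r : R, flowE f = r%:C.
    rewrite /flowE; case: eqP => _; first by exists 1.
    have [r ->] := linr f; rewrite kapE.
    exists ((r - 1) / (kr' * f)).
    by rewrite -(rmorph1 (real_complex R)) -rmorphM /= -rmorphB /= -fmorphV /= -rmorphM.
  have [lv lvE] := linr (- v.2); have [e1 e1E] := Er (v.2 + x.2).
  have [e2 e2E] := Er v.2; have [e3 e3E] := Er x.2.
  have e30 : e3 != 0 by apply: contra Ex0; rewrite e3E => /eqP ->.
  have cE : lin (- v.2) * A / flowE x.2 =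
    (lv * e1 / e3)%:C * (v.1 + x.1) - (lv * e2 / e3)%:C * v.1.
    by rewrite /A lvE e1E e2E e3E !rmorphM /= !fmorphV /=; ring.
  have kr0 : kr' != 0 by have := kap_neq0; rewrite kapE; apply: contra => /eqP ->.
  have sc : lv * e1 / e3 * (v.2 + x.2) - lv * e2 / e3 * v.2 = x.2.
    suff : (kr' * (lv * e1 * (v.2 + x.2) - lv * e2 * v.2))%:C = (kr' * (x.2 * e3))%:C.
      move=> [/(mulfI kr0) H]; rewrite -[RHS](mulfK e30) -H; field.
      exact: e30.
    rewrite (_ : (kr' * (lv * e1 * (v.2 + x.2) - lv * e2 * v.2))%:C =
      lv%:C * (kap * (v.2 + x.2)%:C * e1%:C) - lv%:C * (kap * v.2%:C * e2%:C)); last first.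
      by rewrite kapE !(rmorphB, rmorphM, rmorphD) /=; ring.
    rewrite -lvE -e1E -e2E !flowE_spec linD.
    rewrite (_ : (kr' * (x.2 * e3))%:C = kap * x.2%:C * e3%:C); last first.
      by rewrite kapE !rmorphM /=; ring.
    rewrite -e3E flowE_spec.
    rewrite (_ : _ - _ = (lin v.2 * lin (- v.2)) * lin x.2 - lin v.2 * lin (- v.2)); last by ring.
    by rewrite linvK; ring.
  rewrite cE; move: sc nv0 nx0; rewrite /dot3 /=.
  move: (lv * e1 / e3) (lv * e2 / e3) => p q.
  case: (v.1) => a1 b1; case: (x.1) => a2 b2 /= sc H1 H2.
  rewrite -{1}sc.
  transitivity ((p - q) * (complex.Re n.1 * a1 + complex.Im n.1 * b1 + n.2 * v.2)
    + p * (complex.Re n.1 * a2 + complex.Im n.1 * b2 + n.2 * x.2)); first by ring.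
  by rewrite H1 H2; ring.
have s0 : 0 <= s by rewrite /s; lra.
have nA : normc (A - x.1) <= 6 * s ^+ 2.
  have -> : A - x.1 = (v.1 + x.1) * (flowE (v.2 + x.2) - 1) - v.1 * (flowE v.2 - 1).
    by rewrite /A; ring.
  apply: le_trans (ler_normcB _ _) _; rewrite !normcM.
  have h1 : normc (v.1 + x.1) <= s.
    by apply: le_trans (ler_normcD _ _) _; rewrite /s lerD ?nv1_le.
  have h2 : normc v.1 <= s by rewrite /s; have := nv1_le v; lra.
  have : normc (v.1 + x.1) * normc (flowE (v.2 + x.2) - 1) <= s * (3 * s).
    by apply: ler_pM; rewrite ?normc_ge0//; lra.
  have : normc v.1 * normc (flowE v.2 - 1) <= s * (3 * s).
    by apply: ler_pM; rewrite ?normc_ge0//; lra.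
  lra.
have nA2 : normc A <= 2 * s.
  have := ler_normcD (A - x.1) x.1; rewrite subrK.
  have xs : normc x.1 <= s by apply: le_trans (nv1_le x) _; rewrite lerDr.
  have := ler_wpM2l s0 s1; rewrite -expr2; lra.
set c := lin (- v.2) * A / flowE x.2.
have -> : c - x.1 = (c - A) + (A - x.1) by ring.
apply: le_trans (ler_normcD _ _) _.
suff : normc (c - A) <= 24 * s ^+ 2 by lra.
have -> : c - A = ((lin (- v.2) - 1) - (flowE x.2 - 1)) * A / flowE x.2.
  by rewrite /c; field.
rewrite !normcM normcV ler_pdivrMr; last by lra.
have h1 : normc (lin (- v.2) - 1 - (flowE x.2 - 1)) <= 6 * s.
  by apply: le_trans (ler_normcB _ _) _; lra.
have : normc (lin (- v.2) - 1 - (flowE x.2 - 1)) * normc A <= 6 * s * (2 * s).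
  by apply: ler_pM; rewrite ?normc_ge0.
nra.
Qed.

End Flow.

(** * Polygonal paths and the sets they sweep *)

Section Paths.
Variable R : realType.
Variable kap : R[i].
Hypothesis kap1 : normc kap = 1.
Local Notation flow := (flow kap).
Local Notation lin := (lin kap).

(** A step (v, u) is an intrinsic transformation v together with the point u
   near which intersections allow a tangent direction to be discarded. *)
Definition step := (vec3 R * vec3 R)%type.

Implicit Types (s : seq step) (K : vec3 R -> set R[i]) (S T : set R[i]).

Fixpoint comp s (y : R[i]) : R[i] :=
  if s is e :: s' then flow e.1 (comp s' y) else y.

Fixpoint sweep K s : set R[i] :=
  if s is e :: s' then
    [set z | exists t y, [/\ 0 <= t <= 1, K e.2 y & z = flow (scale3 t e.1) y]]
    `|` [set flow e.1 z | z in sweep K s']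
  else set0.

Definition slen s : R := \sum_(e <- s) nv e.1.

Fixpoint rep N s : seq step := if N is N'.+1 then rep N' s ++ s else [::].

(** A finite-cover version of planar outer measure, up to a constant factor.
   Unlike coverings by rectangles it transforms exactly under similarities. *)
Definition covered S (a : R) :=
  exists2 B : seq (R[i] * R),
    (forall z, S z -> exists2 b, b \in B & normc (z - b.1) <= b.2)
    & \sum_(b <- B) b.2 ^+ 2 <= a.

Lemma covered_ge0 S a : covered S a -> 0 <= a.
Proof. by move=> [B _]; apply: le_trans; apply: sumr_ge0 => b _; exact: sqr_ge0. Qed.

Lemma covered_le S T a b : S `<=` T -> a <= b -> covered T a -> covered S b.
Proof.
by move=> ST ab [B TB Ba]; exists B => [z /ST/TB//|]; exact: le_trans ab.
Qed.

Lemma covered0 : covered set0 0.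
Proof. by exists [::] => //; rewrite big_nil. Qed.

Lemma coveredU S T a b : covered S a -> covered T b -> covered (S `|` T) (a + b).
Proof.
move=> [B SB Ba] [C TC Cb]; exists (B ++ C) => [z [/SB|/TC] [p pB zp]|].
- by exists p => //; rewrite mem_cat pB.
- by exists p => //; rewrite mem_cat pB orbT.
- by rewrite big_cat /= lerD.
Qed.

Lemma covered_flow v S a : covered S a ->
  covered [set flow v z | z in S] (normc (lin v.2) ^+ 2 * a).
Proof.
move=> [B SB Ba]; exists [seq (flow v b.1, normc (lin v.2) * b.2) | b <- B].
  move=> _ [z /SB [b bB zb] <-]; exists (flow v b.1, normc (lin v.2) * b.2).
    by apply/mapP; exists b.
  by rewrite /= flow_sub normcM ler_wpM2l ?normc_ge0.
rewrite big_map /= -(ler_pM2l (_ : 0 < normc (lin v.2) ^+ 2)) in Ba *; last first.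
  by rewrite exprn_gt0// normc_gt0 lin_neq0.
apply: le_trans Ba; rewrite mulr_sumr; apply: ler_sum => b _.
by rewrite exprMn.
Qed.

Lemma comp_cat s1 s2 y : comp (s1 ++ s2) y = comp s1 (comp s2 y).
Proof. by elim: s1 => //= e s1 ->. Qed.

Lemma sweep_cat K s1 s2 :
  sweep K (s1 ++ s2) = sweep K s1 `|` [set comp s1 z | z in sweep K s2].
Proof.
elim: s1 => [|e s1 IH] /=; first by rewrite set0U image_id.
by rewrite IH image_setU setUA; congr (_ `|` _); rewrite image_comp.
Qed.

Lemma sweep_sub K K' s : (forall u, K u `<=` K' u) -> sweep K s `<=` sweep K' s.
Proof.
move=> KK; elim: s => //= e s IH z [[t [y [t01 Ky ->]]]|[z' /IH Hz' <-]].
  by left; exists t, y; split => //; exact: KK.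
by right; exists z'.
Qed.

Lemma sweepU K K' s :
  sweep (fun u => K u `|` K' u) s `<=` sweep K s `|` sweep K' s.
Proof.
elim: s => //= e s IH z [[t [y [t01 [Ky|Ky] ->]]]|[z' /IH [] Hz' <-]].
- by left; left; exists t, y.
- by right; left; exists t, y.
- by left; right; exists z'.
- by right; right; exists z'.
Qed.

Lemma sweep_set0 s : sweep (fun _ => set0) s = set0.
Proof.
rewrite -subset0; elim: s => //= e s IH z [[t [y [_ [] _]]]|[z' /IH []]].
Qed.

Lemma sweep_trace G s z : sweep (fun _ => G) s z ->
  exists2 y, G y & sweep (fun _ => [set y]) s z.
Proof.
elim: s z => //= e s IH z [[t [y [t01 Ky ->]]]|[z' /IH [y Gy Hz'] <-]].
  by exists y => //; left; exists t, y.
by exists y => //; right; exists z'.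
Qed.

Lemma slen_cat s1 s2 : slen (s1 ++ s2) = slen s1 + slen s2.
Proof. by rewrite /slen big_cat. Qed.

Lemma slen_ge0 s : 0 <= slen s.
Proof. by apply: sumr_ge0 => e _; exact: nv_ge0. Qed.

Lemma slen_ge s e : e \in s -> nv e.1 <= slen s.
Proof.
elim: s => // e' s IH; rewrite inE /slen big_cons => /orP[/eqP <-|/IH].
  by rewrite lerDl slen_ge0.
by move=> /le_trans; apply; rewrite lerDr nv_ge0.
Qed.

Lemma slen_rep N s : slen (rep N s) = N%:R * slen s.
Proof.
elim: N => [|N IH] /=; first by rewrite /slen big_nil mul0r.
by rewrite slen_cat IH -natr1 mulrDl mul1r.
Qed.

Lemma mem_rep N s e : e \in rep N s -> e \in s.
Proof. by elim: N => //= N IH; rewrite mem_cat => /orP[/IH|]. Qed.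

Lemma rep_nil N s : (0 < N)%N -> s != [::] -> rep N s != [::].
Proof. by case: N => //= N _; case: s => // e s _; case: (rep N _). Qed.

Section Repetition.
Variables (s : seq step) (X : vec3 R).
Hypothesis sX : forall y, comp s y = flow X y.

Lemma comp_rep N y : comp (rep N s) y = flow (scale3 N%:R X) y.
Proof.
elim: N y => [|N IH] y /=; first by rewrite scale3_0 flow0.
by rewrite comp_cat IH sX -{2}(scale3_1 X) flow_scaleD// natr1.
Qed.

Lemma sweep_rep K N z : sweep K (rep N s) z ->
  exists j z', [/\ (j < N)%N, sweep K s z' & z = flow (scale3 j%:R X) z'].
Proof.
elim: N => // N IH; rewrite [rep _ _]/= sweep_cat => -[/IH|].
  by move=> [j [z' [jN Hz' ->]]]; exists j, z'; split => //; exact: ltnW.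
by move=> [z' Hz' <-]; exists N, z'; rewrite comp_rep.
Qed.

Lemma covered_rep K N a F : covered (sweep K s) a -> N%:R * `|X.2| <= F ->
  covered (sweep K (rep N s)) (N%:R * (expR F ^+ 2 * a)).
Proof.
move=> sa; have a0 := covered_ge0 sa.
elim: N => [|N IH] NF /=; first by rewrite mul0r; exact: covered0.
have {}IH : covered (sweep K (rep N s)) (N%:R * (expR F ^+ 2 * a)).
  by apply: IH; apply: le_trans NF; rewrite ler_wpM2r// ler_nat.
rewrite sweep_cat -natr1 mulrDl mul1r; apply: coveredU => //.
rewrite (_ : [set _ | _ in _] = [set flow (scale3 N%:R X) z | z in sweep K s]).
  2: by apply: eq_imagel => z _; rewrite comp_rep.
apply: covered_le (covered_flow (scale3 N%:R X) sa) => //.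
rewrite ler_wpM2r// lerXn2r ?nnegrE ?normc_ge0 ?expR_ge0//.
apply: le_trans (normc_lin_le kap1 _) _; rewrite ler_expR /= normrM normr_nat.
by apply: le_trans NF; rewrite ler_wpM2r// ler_nat.
Qed.

End Repetition.

End Paths.

Lemma exists_nat_gt (R : realType) (x : R) : exists2 N, (0 < N)%N & x < N%:R.
Proof. by exists (Num.truncn x).+1 => //; exact: truncnS_gt. Qed.

(** * Replacing a motion by zigzags *)

Section Dot3.
Variable R : realType.
Implicit Types (u v x : vec3 R).

Lemma dot3Dr u v x : dot3 u (v + x) = dot3 u v + dot3 u x.
Proof. by case: u v x => [[? ?] ?] [[? ?] ?] [[? ?] ?]; rewrite /dot3 /=; ring. Qed.

Lemma dot3Nr u v : dot3 u (- v) = - dot3 u v.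
Proof. by case: u v => [[? ?] ?] [[? ?] ?]; rewrite /dot3 /=; ring. Qed.

Lemma dot3Zr u t v : dot3 u (scale3 t v) = t * dot3 u v.
Proof. by case: u v => [[? ?] ?] [[? ?] ?]; rewrite /dot3 /=; ring. Qed.

Lemma dot3C u v : dot3 u v = dot3 v u.
Proof. by rewrite /dot3; ring. Qed.

Lemma ler_dot3_nv u v : `|dot3 u v| <= 2 * (nv u * nv v).
Proof.
rewrite /dot3 /nv; case: u v => [a f] [b g] /=.
apply: le_trans (ler_normD _ _) _; apply: le_trans (lerD (ler_normD _ _) (lexx _)) _.
rewrite !normrM.
have H1 : `|complex.Re a| * `|complex.Re b| <= normc a * normc b.
  by rewrite ler_pM// ler_Re_normc.
have H2 : `|complex.Im a| * `|complex.Im b| <= normc a * normc b.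
  by rewrite ler_pM// ler_Im_normc.
have := mulr_ge0 (normr_ge0 f) (normc_ge0 b).
have := mulr_ge0 (normr_ge0 g) (normc_ge0 a).
have := mulr_ge0 (normr_ge0 f) (normr_ge0 g).
lra.
Qed.

End Dot3.

Section Replacement.
Variable R : realType.
Variable kap : R[i].
Hypothesis kap1 : normc kap = 1.
Local Notation flow := (flow kap).
Local Notation lin := (lin kap).
Local Notation comp := (comp kap).
Local Notation sweep := (sweep kap).

Variables (n : vec3 R) (special : Prop).
Hypothesis special_real : special -> complex.Im kap = 0.
Variables (e3 tau Rad : R).
Hypotheses (e3_gt0 : 0 < e3) (tau_gt0 : 0 < tau) (Rad_ge0 : 0 <= Rad).

Variables (Cell : finType) (Gam : Cell -> set R[i]).
Variable killed : Cell -> vec3 R -> Prop.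
Hypothesis Gam_bounded : forall q y, Gam q y -> normc y <= Rad.

Implicit Types (A : {set Cell}) (x v X : vec3 R) (a b c d h r t : R).

Definition plane v := v != 0 /\ dot3 n v = 0.

Definition near_plane v :=
  [/\ v != 0, `|dot3 n v| <= e3 * nv v & special -> dot3 n v = 0].

(** The points that a step with discarding point u has to account for: the cells
   in A are paid for separately, and those killed by u do not count. *)
Definition kept A u : set R[i] :=
  [set y | exists q, [/\ q \notin A, ~ killed q u & Gam q y]].

Definition follows (s : seq (step R)) X d :=
  forall y, normc y <= Rad -> forall z, sweep (fun _ => [set y]) s z ->
  exists2 t, 0 <= t <= 1 & normc (z - flow (scale3 t X) y) <= d.

(** For all small h, the motion with velocity vector h * x can be replaced by a
   path that stays as close to it as desired and whose cost, namely the covered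
   area swept by the cells outside A plus tau times the length of the path, is
   at most about a * h. Asking this for all x' close to x makes the notion
   stable under the second-order errors that come from noncommutativity, and
   asking it for all small h makes the cost additive in x. *)
Definition replaceable A x a :=
  forall d, 0 < d -> exists2 r, 0 < r &
  forall x', nv (x' - x) < r -> (special -> dot3 n x' = 0) ->
  forall h, 0 < h <= r -> forall d', 0 < d' ->
  exists s : seq (step R), [/\ s != [::],
    forall y, comp s y = flow (scale3 h x') y,
    forall e, e \in s -> near_plane e.1 /\ plane e.2,
    follows s (scale3 h x') d'
  & exists2 a1, covered (sweep (kept A) s) a1 & a1 + tau * slen s <= h * (a + d)].

Lemma replaceable_le A x a b : a <= b -> replaceable A x a -> replaceable A x b.
Proof.
move=> ab Ha d d0; have [r r0 H] := Ha d d0; exists r => // x' x'r x'n h hr d' d'0.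
have [s [s0 sc so sn [a1 sa as1]]] := H _ x'r x'n _ hr _ d'0.
exists s; split => //; exists a1 => //; apply: le_trans as1 _.
by case/andP: hr => h0 _; rewrite ler_pM2l// lerD2r.
Qed.

Lemma replaceable_sub (A A' : {set Cell}) x a :
  A \subset A' -> replaceable A x a -> replaceable A' x a.
Proof.
move=> /fintype.subsetP AA Ha d d0; have [r r0 H] := Ha d d0.
exists r => // x' x'r x'n h hr d' d'0.
have [s [s0 sc so sn [a1 sa as1]]] := H _ x'r x'n _ hr _ d'0.
exists s; split => //; exists a1 => //; apply: covered_le sa => //.
apply: sweep_sub => u y [q [qA qu qy]]; exists q; split => //.
by apply: contra qA; exact: AA.
Qed.

Lemma replaceable_scale A x a c :
  0 < c -> replaceable A x a -> replaceable A (scale3 c x) (c * a).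
Proof.
move=> c0 Ha d d0; have [|r r0 H] := Ha (d / c); first by rewrite divr_gt0.
exists (Num.min (c * r) (r / c)); first by rewrite lt_min mulr_gt0// divr_gt0.
move=> x' x'r x'n h /andP[h0]; rewrite le_min => /andP[_ hr] d' d'0.
have nz : c != 0 by rewrite gt_eqF.
have := H (scale3 c^-1 x').
have -> : scale3 c^-1 x' - x = scale3 c^-1 (x' - scale3 c x).
  by rewrite scale3Dr scale3N scale3A mulVf// scale3_1.
rewrite nv_scale gtr0_norm ?invr_gt0// mulrC ltr_pdivrMr//.
move: x'r; rewrite lt_min => /andP[x'r _].
rewrite mulrC in x'r; move=> /(_ x'r) {}H.
have [||s] := H _ (h * c) _ _ d'0.
- by move=> sp; rewrite dot3Zr x'n// mulr0.
- by rewrite mulr_gt0//= -ler_pdivlMr.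
rewrite scale3A mulfK// => [[s0 sc so sn [a1 sa as1]]].
exists s; split => //; exists a1 => //; apply: le_trans as1 _.
by rewrite -mulrA ler_pM2l// mulrDr mulrCA divff// mulr1.
Qed.

(** A single step is enough when one point u discards every cell outside A. *)
Lemma replaceable_terminal A x u : plane x -> plane u ->
  (forall q, q \notin A -> killed q u) -> replaceable A x (tau * nv x).
Proof.
move=> [x0 nx] pu kA d d0.
have X0 : 0 < nv x by rewrite nv_gt0.
have N0 := nv_ge0 n.
pose r := Num.min (nv x / 2) (Num.min (e3 * nv x / (4 * (nv n + 1))) (d / tau)).
have r0 : 0 < r by rewrite !lt_min !divr_gt0 ?mulr_gt0//; lra.
have r1 : r <= nv x / 2 by rewrite ge_min lexx.
have r2 : r * (4 * (nv n + 1)) <= e3 * nv x.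
  by rewrite -ler_pdivlMr ?mulr_gt0//; [rewrite !ge_min lexx orbT|lra].
have r3 : tau * r <= d by rewrite mulrC -ler_pdivlMr// !ge_min lexx !orbT.
exists r => // x' x'r x'n h /andP[h0 hr] d' d'0.
have xx' : nv x <= nv x' + r.
  have := nvD x' (- (x' - x)); rewrite nvN opprB addrC subrK => /le_trans; apply.
  by rewrite lerD2l ltW.
have x'x : nv x' <= nv x + r.
  by have := nvD (x' - x) x; rewrite subrK; lra.
have x'0 : 0 < nv x' by lra.
exists [:: (scale3 h x', u)]; split => //.
- move=> e; rewrite inE => /eqP -> /=; split => //; split.
  + by rewrite scale3_eq0 gt_eqF//= -nv_gt0.
  + rewrite dot3Zr normrM nv_scale mulrCA ler_pM2l ?normr_gt0 ?gt_eqF//.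
    have -> : dot3 n x' = dot3 n (x' - x) by rewrite dot3Dr dot3Nr nx oppr0 addr0.
    apply: le_trans (ler_dot3_nv _ _) _.
    have : nv n * nv (x' - x) <= nv n * r by rewrite ler_wpM2l// ltW.
    have : e3 * (nv x / 2) <= e3 * nv x' by rewrite ler_pM2l//; lra.
    lra.
  + by move=> sp; rewrite dot3Zr x'n// mulr0.
- move=> y _ z /= [[t [y' [t01 -> ->]]]|[] //].
  by exists t => //; rewrite subrr normc0 ltW.
- exists 0.
    apply: covered_le (lexx 0) (covered0 _).
    move=> z [[t [y [_ [q [qA qu _]] _]]]|[] //].
    by apply: qu; exact: kA.
  rewrite /slen big_cons big_nil addr0 add0r nv_scale gtr0_norm//= mulrCA.
  rewrite ler_pM2l//; have : tau * nv x' <= tau * (nv x + r) by rewrite ler_pM2l.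
  lra.
Qed.

(** At the price c per unit of time the cell q may be swept completely. The
   covered set contains a neighborhood of the direct motion, which leaves room
   for the zigzags that follow it. *)
Definition crossing q x c :=
  forall d, 0 < d -> exists2 r, 0 < r &
  forall x', nv (x' - x) < r -> forall h, 0 < h <= r ->
  exists2 d', 0 < d' &
  covered [set z | exists y t, [/\ Gam q y, 0 <= t <= 1 &
      normc (z - flow (scale3 t (scale3 h x')) y) <= d']] (h * (c + d)).

(** The direct motion sweeps a set covered by finitely many balls of positive
   radius, so a path that follows it closely enough does as well. *)
Lemma replaceable_cross A q x a c :
  crossing q x c -> replaceable (q |: A) x a -> replaceable A x (a + c).
Proof.
move=> Hc Ha d d0; have d2 : 0 < d / 2 by rewrite divr_gt0.
have [r1 r10 H1] := Hc _ d2; have [r2 r20 H2] := Ha _ d2.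
exists (Num.min r1 r2); first by rewrite lt_min r10.
move=> x'; rewrite lt_min => /andP[x'1 x'2] x'n h /andP[h0].
rewrite le_min => /andP[hr1 hr2] d' d'0.
have h01 : 0 < h <= r1 by rewrite h0.
have h02 : 0 < h <= r2 by rewrite h0.
have [d1 d10 cov] := H1 _ x'1 _ h01.
have [|s [s0 sc so sn [a1 sa as1]]] := H2 _ x'2 x'n _ h02 (Num.min d1 d').
  by rewrite lt_min d10.
exists s; split => //.
  move=> y yR z /(sn _ yR) [t t01 tz]; exists t => //; apply: le_trans tz _.
  by rewrite ge_min lexx orbT.
exists (a1 + h * (c + d / 2)); last first.
  by rewrite addrAC; move: as1; rewrite !mulrDr; lra.
apply: covered_le (lexx _) (coveredU sa cov).
have K u : kept A u `<=` kept (q |: A) u `|` Gam q.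
  move=> y [p [pA pu py]]; have [<-|pq] := eqVneq p q; first by right.
  by left; exists p; split => //; rewrite inE negb_or inE pq.
move=> z /(sweep_sub K) /sweepU [?|]; first by left.
move=> /sweep_trace[y qy /(sn _ (Gam_bounded qy)) [t t01 tz]]; right.
exists y, t; split => //; apply: le_trans tz _; by rewrite ge_min lexx.
Qed.

Lemma expR_le1D2x r : 0 <= r <= 1 / 2 -> expR r <= 1 + 2 * r.
Proof.
move=> /andP[r0 r1]; have /ler_expRB1Dx : `|r| <= 1 / 2 by rewrite ger0_norm.
by rewrite ler_norml => /andP[_]; nra.
Qed.

Lemma flow_split_scale g x y L : 0 < g -> nv x + nv y <= L -> g * L <= 1 / 12 ->
  exists y', [/\ forall u, flow (scale3 g x) (flow (scale3 g y') u) =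
                   flow (scale3 g (x + y)) u,
    nv (y' - y) <= 30 * g * L ^+ 2
  & special -> dot3 n x = 0 -> dot3 n y = 0 -> dot3 n y' = 0].
Proof.
move=> g0 xyL gL12.
have spl : nv (scale3 g x) + nv (scale3 g y) = g * (nv x + nv y).
  by rewrite !nv_scale gtr0_norm// -mulrDr.
have gxL : g * (nv x + nv y) <= g * L by rewrite ler_pM2l.
have [|c cE [cy cn]] := @flow_split _ _ kap1 (scale3 g x) (scale3 g y).
  by rewrite spl (le_trans gxL).
rewrite spl in cy.
have gy' : scale3 g (scale3 g^-1 (c, (scale3 g y).2)) = (c, (scale3 g y).2).
  by rewrite scale3A divff ?scale3_1// gt_eqF.
exists (scale3 g^-1 (c, (scale3 g y).2)); split.
- by move=> u; rewrite gy' cE scale3Dr.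
- rewrite -(ler_pM2l g0) -{1}(gtr0_norm g0) -nv_scale scale3Dr scale3N gy'.
  rewrite /nv /= subrr normr0 addr0; apply: le_trans cy _.
  have -> : g * (30 * g * L ^+ 2) = 30 * (g * L) ^+ 2 by ring.
  have gx0 : 0 <= g * (nv x + nv y) by exact: mulr_ge0 (ltW g0) (addr_ge0 (nv_ge0 _) (nv_ge0 _)).
  by rewrite ler_pM2l// lerXn2r// nnegrE// (le_trans gx0).
- move=> sp nx ny; rewrite dot3Zr cn ?mulr0 ?dot3Zr ?nx ?ny ?mulr0//.
  exact: special_real.
Qed.

Lemma follow_near_id y z X t g L : normc y <= Rad -> 0 <= t <= 1 ->
  nv X <= g * L -> g * L <= 1 / 2 -> normc (z - flow (scale3 t X) y) <= g ->
  normc (z - y) <= g * (1 + 3 * (1 + Rad) * L).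
Proof.
move=> yR /andP[t0 t1] XL L1 zg.
apply: le_trans (ler_normc_dist z (flow (scale3 t X) y) y) _.
have XL' : nv (scale3 t X) <= g * L.
  rewrite nv_scale ger0_norm//; apply: le_trans XL.
  by rewrite ler_piMl ?nv_ge0.
have := flow_near_id kap1 y (le_trans XL' L1).
have : (1 + normc y) * nv (scale3 t X) <= (1 + Rad) * (g * L).
  by apply: ler_pM => //; rewrite ?nv_ge0 ?addr_ge0 ?normc_ge0// lerD2l.
lra.
Qed.

Lemma zigzag_follows s1 s2 X Y Z g N F L d :
  (forall u, comp s1 u = flow X u) ->
  (forall u, comp (s1 ++ s2) u = flow Z u) ->
  0 < g -> (0 < N)%N -> 0 <= L -> g * L <= F -> N%:R * `|Z.2| <= F -> F <= 1 / 2 ->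
  nv X <= g * L -> nv Y <= g * L ->
  follows s1 X g -> follows s2 Y g ->
  6 * (g * (1 + 3 * (1 + Rad) * L)) <= d ->
  follows (rep N (s1 ++ s2)) (scale3 N%:R Z) d.
Proof.
move=> s1c s12 g0 N0 L0 gLF NF F12 XL YL s1n s2n gB u uR z.
have gL2 : g * L <= 1 / 2 := le_trans gLF F12.
have NR : (0 : R) < N%:R by rewrite ltr0n.
have F0 : 0 <= F by apply: le_trans gLF; rewrite mulr_ge0// ltW.
have eF2 : expR F <= 2.
  have /expR_le1D2x H : 0 <= F <= 1 / 2 by rewrite F0.
  by apply: le_trans H _; lra.
move=> /(sweep_rep kap1 s12)[j [z1 [jN Hz1 ->]]].
exists (j%:R / N%:R).
  by rewrite divr_ge0//= ler_pdivrMr// mul1r ler_nat ltnW.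
rewrite scale3A divfK ?gt_eqF// flow_sub normcM.
set B := 1 + _ in gB.
have z1u : normc (z1 - u) <= 3 * (g * B).
  have gB0 : 0 <= g * B.
    rewrite mulr_ge0 ?(ltW g0)// /B addr_ge0// !mulr_ge0// addr_ge0//.
  move: Hz1; rewrite sweep_cat => -[/(s1n _ uR)[t t01 zt]|].
    apply: le_trans (follow_near_id uR t01 XL gL2 zt) _; rewrite -/B; lra.
  move=> [z2 /(s2n _ uR)[t t01 zt] <-]; rewrite s1c.
  have zu := follow_near_id uR t01 YL gL2 zt; rewrite -/B in zu.
  apply: le_trans (ler_normc_dist _ (flow X u) _) _.
  rewrite flow_sub normcM.
  have H1 : normc (flow X u - u) <= g * B.
    apply: (@follow_near_id u _ X 1 g L) => //; first by rewrite ler01 lexx.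
    by rewrite scale3_1 subrr normc0 ltW.
  have H2 : normc (lin X.2) * normc (z2 - u) <= 2 * (g * B).
    apply: ler_pM; rewrite ?normc_ge0//; apply: le_trans eF2.
    apply: le_trans (normc_lin_le kap1 _) _; rewrite ler_expR.
    by apply: le_trans (nv2_le _) (le_trans XL gLF).
  apply: le_trans (lerD H2 H1) _; lra.
apply: le_trans gB; have -> : 6 * (g * B) = 2 * (3 * (g * B)) by ring.
apply: ler_pM; rewrite ?normc_ge0//; apply: le_trans eF2.
apply: le_trans (normc_lin_le kap1 _) _; rewrite ler_expR /= normrM normr_nat.
by apply: le_trans NF; rewrite ler_wpM2r// ler_nat ltnW.
Qed.

Lemma zigzag_cost A s1 s2 X Z N F a1 b1 :
  (forall u, comp s1 u = flow X u) ->
  (forall u, comp (s1 ++ s2) u = flow Z u) ->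
  `|X.2| <= F -> N%:R * `|Z.2| <= F -> 0 <= F ->
  covered (sweep (kept A) s1) a1 -> covered (sweep (kept A) s2) b1 ->
  exists2 c, covered (sweep (kept A) (rep N (s1 ++ s2))) c &
    c + tau * slen (rep N (s1 ++ s2)) <=
    N%:R * (expR (4 * F) * ((a1 + tau * slen s1) + (b1 + tau * slen s2))).
Proof.
move=> s1c s12 XF NF F0 s1a s2b.
have ca1 := covered_ge0 s1a; have cb1 := covered_ge0 s2b.
pose Q := expR F ^+ 2.
have Q1 : 1 <= Q by rewrite /Q exprn_ege1// -expR0 ler_expR.
have -> : expR (4 * F) = Q * Q by rewrite /Q -exprD -expRM_natl.
exists (N%:R * (Q * (a1 + Q * b1))).
  apply: (covered_rep kap1 s12 (F := F)) => //.
  rewrite sweep_cat; apply: coveredU => //.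
  rewrite (_ : [set _ | _ in _] = [set flow X z | z in sweep (kept A) s2]).
    2: by apply: eq_imagel => z _.
  apply: covered_le (covered_flow kap X s2b) => //.
  rewrite ler_wpM2r// lerXn2r ?nnegrE ?normc_ge0 ?expR_ge0//.
  by apply: le_trans (normc_lin_le kap1 _) _; rewrite ler_expR.
rewrite slen_rep slen_cat (mulrCA tau) -mulrDr ler_wpM2l//.
have l1 := mulr_ge0 (ltW tau_gt0) (slen_ge0 s1).
have l2 := mulr_ge0 (ltW tau_gt0) (slen_ge0 s2).
rewrite (mulrDr tau); move: (tau * slen s1) (tau * slen s2) l1 l2 => p q p0 q0.
have Q0 : 0 <= Q by apply: le_trans Q1.
have QQ : 1 <= Q * Q by rewrite (le_trans Q1)// ler_peMl.
have H1 : Q * a1 <= Q * Q * a1 by rewrite ler_wpM2r// ler_peMl.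
have H2 : p + q <= Q * Q * (p + q) by rewrite ler_peMl// addr_ge0.
have -> : Q * Q * (a1 + p + (b1 + q)) = Q * Q * a1 + Q * Q * b1 + Q * Q * (p + q).
  by ring.
by rewrite mulrDr mulrA; apply: lerD => //; rewrite lerD2r.
Qed.

(** The motion along x + y is cut into N equal parts, each of which is
   performed as a motion along x followed by one along y, up to the correction
   of flow_split. As N grows the zigzag converges to the direct motion, while
   the total cost does not depend on N. *)
Lemma replaceable_add A x y a b : 0 <= a -> 0 <= b -> dot3 n x = 0 ->
  replaceable A x a -> replaceable A y b -> replaceable A (x + y) (a + b).
Proof.
have ar1 (p q : R) : p * (12 * q) <= 1 -> p * q <= 1 / 12 by lra.
have ar2 (p q : R) : p * 3 <= q -> q <= 1 / 12 -> p <= 1 / 2 by lra.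
have ar3 (p q u : R) : p <= q + 1 / 2 -> u + p <= u + q + 3 by lra.
have ar4 (p q u v w : R) : p <= 30 * q * w -> 30 * q * w <= 30 * u * w ->
  u * (60 * w) <= v -> u <= v / 2 -> forall m, m < u -> p + m < v by move=> *; lra.
have ar5 (p q u w : R) : p <= 30 * q * w -> 30 * q * w <= 30 * u * w ->
  u * (60 * w) <= 1 -> forall k l m, m <= k + 1 / 2 -> 0 <= l ->
  p + m <= l + k + 3 by move=> *; lra.
have ar6 (q : R) : q <= 1 / 12 -> q <= 1 / 2 by lra.
have ar7 (q : R) : 0 <= q -> q <= 1 / 12 -> 0 <= 4 * q <= 1 / 2.
  by move=> q0 q1; apply/andP; split; lra.
have ar8 (p q u : R) : p * (8 * q) <= u -> 1 + 2 * (4 * (p * q)) <= 1 + u by lra.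
have ar9 (p q g d : R) : p <= g * (a + d / 4) -> q <= g * (b + d / 4) ->
  p + q <= g * (a + b + d / 2) by lra.
have ar10 (u d : R) : u * (2 * (a + b + d)) = d ->
  u * (a + b + d / 2) <= u * (a + b + d) ->
  (1 + u) * (a + b + d / 2) <= a + b + d by lra.
move=> a0 b0 nx Ha Hb d d0.
have d4 : 0 < d / 4 by rewrite divr_gt0.
have [r1 r10 H1] := Ha _ d4; have [r2 r20 H2] := Hb _ d4 => {Ha Hb}.
pose L := nv x + nv y + 3.
have x0 := nv_ge0 x; have yp := nv_ge0 y.
have L3 : 3 <= L by rewrite /L -lerBlDr subrr addr_ge0.
have L0 : 0 < L by apply: lt_le_trans L3.
(* 1 + eta bounds the factor by which the motions enlarge areas. *)
pose eta := d / (2 * (a + b + d)).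
have abd : 0 < a + b + d by rewrite ltr_wpDl// addr_ge0.
have abd2 : 0 < 2 * (a + b + d) by rewrite mulr_gt0.
have eta0 : 0 < eta by rewrite divr_gt0.
have eta1 : eta * (2 * (a + b + d)) = d by rewrite /eta divfK// gt_eqF.
have LL : 0 < 60 * L ^+ 2 by rewrite mulr_gt0// exprn_gt0.
have L12 : 0 < 12 * L by rewrite mulr_gt0.
have L8 : 0 < 8 * L by rewrite mulr_gt0.
have [r [r0 rr1 rr2 [rL1 rL2] [rL3 rL4]]] : exists r, [/\ 0 < r, r <= r1, r <= r2 / 2,
    r * (60 * L ^+ 2) <= r2 /\ r * (60 * L ^+ 2) <= 1
  & r * (12 * L) <= 1 /\ r * (8 * L) <= eta].
  exists (Num.min (Num.min (Num.min r1 (r2 / 2))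
    (Num.min (r2 / (60 * L ^+ 2)) (1 / (60 * L ^+ 2))))
    (Num.min (1 / (12 * L)) (eta / (8 * L)))).
  rewrite -!ler_pdivlMr// !ge_min !lexx ?orbT/=; split => //.
  by rewrite !lt_min r10 !divr_gt0.
have rL12 : r * L <= 1 / 12 := ar1 _ _ rL3.
have rL0 : 0 <= r * L by rewrite mulr_ge0// ltW.
exists r => // z' z'r z'n h /andP[h0 hr] d' d'0.
pose y0 := z' - x.
have y0y : nv (y0 - y) < r by rewrite /y0 -addrA -opprD.
have nvy0 : nv y0 <= nv y + 1 / 2.
  have := nvD (y0 - y) y; rewrite subrK => /le_trans; apply.
  rewrite addrC lerD2l; apply: le_trans (ltW y0y) _.
  by apply: ar2 rL12; rewrite ler_pM2l.
have xy0L : nv x + nv y0 <= L := ar3 _ _ _ nvy0.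
have xy0 : x + y0 = z' by rewrite /y0 addrC subrK.
have z'L : `|z'.2| <= L.
  by apply: le_trans (nv2_le z') _; rewrite -xy0; apply: le_trans (nvD _ _) _.
pose B := 1 + 3 * (1 + Rad) * L.
(* The zigzags of N parts, each of duration g = h / N, stay within d' of the
   direct motion. *)
have [N N0 hN] := exists_nat_gt (6 * h * B / d').
have NR : (0 : R) < N%:R by rewrite ltr0n.
pose g := h / N%:R.
have g0 : 0 < g by rewrite divr_gt0.
have gh : N%:R * g = h by rewrite mulrC /g divfK// gt_eqF.
have gr : g <= r.
  apply: le_trans hr; rewrite -gh ler_peMl ?(ltW g0)//.
  by rewrite (ler_nat R 1 N).
have gB : 6 * (g * B) <= d'.
  have {}hN : 6 * h * B < N%:R * d' by rewrite -ltr_pdivrMr.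
  rewrite -(ler_pM2l NR); apply: le_trans (ltW hN).
  by rewrite mulrCA (mulrA N%:R) gh mulrA.
have gL : g * L <= r * L by rewrite ler_wpM2r// ltW.
have [y1 [y1c y1y0 y1n]] := flow_split_scale g0 xy0L (le_trans gL rL12).
rewrite xy0 in y1c.
have {}y1n : special -> dot3 n y1 = 0.
  move=> sp; apply: y1n => //.
  by rewrite /y0 dot3Dr dot3Nr nx z'n// subr0.
have gLL : 30 * g * L ^+ 2 <= 30 * r * L ^+ 2.
  by rewrite ler_wpM2r ?sqr_ge0// ler_pM2l.
have y1y : nv (y1 - y) < r2.
  have -> : y1 - y = (y1 - y0) + (y0 - y) by rewrite addrA subrK.
  apply: le_lt_trans (nvD _ _) _; exact: ar4 y1y0 gLL rL1 rr2 _ y0y.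
have y1L : nv y1 <= L.
  have := nvD (y1 - y0) y0; rewrite subrK => /le_trans; apply.
  exact: ar5 y1y0 gLL rL2 _ _ _ nvy0 x0.
have gr1 : 0 < g <= r1 by rewrite g0 (le_trans gr).
have gr2 : 0 < g <= r2.
  by rewrite g0 (le_trans gr)// (le_trans rr2)// ler_pdivrMr// ler_peMr ?(ltW r20)// ler1n.
have xx : nv (x - x) < r1 by rewrite subrr nv0.
have [s1 [s10 s1c s1o s1n [a1 s1a as1]]] := H1 _ xx (fun _ => nx) _ gr1 _ g0.
have [s2 [s20 s2c s2o s2n [b1 s2b bs2]]] := H2 _ y1y y1n _ gr2 _ g0.
have s12 u : comp (s1 ++ s2) u = flow (scale3 g z') u.
  by rewrite comp_cat s1c s2c y1c.
have nvgx : nv (scale3 g x) <= g * L.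
  rewrite nv_scale gtr0_norm// ler_pM2l//; apply: le_trans xy0L.
  by rewrite lerDl nv_ge0.
have nvgy : nv (scale3 g y1) <= g * L by rewrite nv_scale gtr0_norm// ler_pM2l.
have NF : N%:R * `|(scale3 g z').2| <= r * L.
  rewrite /= normrM gtr0_norm// mulrA gh; apply: ler_pM => //; exact: ltW.
have zz : scale3 h z' = scale3 N%:R (scale3 g z') by rewrite scale3A gh.
exists (rep N (s1 ++ s2)); split.
- by rewrite rep_nil//; case: (s1) s10.
- by move=> u; rewrite (comp_rep kap1 s12) zz.
- by move=> e /mem_rep; rewrite mem_cat => /orP[/s1o|/s2o].
- rewrite zz; apply: (zigzag_follows s1c s12 g0 N0 (ltW L0) gL NF _ nvgx nvgy) => //.
  exact: ar6.
have XF : `|(scale3 g x).2| <= r * L.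
  exact: le_trans (nv2_le _) (le_trans nvgx gL).
have [c covc cle] := zigzag_cost s1c s12 XF NF rL0 s1a s2b.
exists c => //; apply: le_trans cle _.
rewrite -gh -mulrA ler_pM2l//.
have Q2 : expR (4 * (r * L)) <= 1 + eta.
  by apply: le_trans (expR_le1D2x (ar7 _ rL0 rL12)) _; exact: ar8.
have H' : (a1 + tau * slen s1) + (b1 + tau * slen s2) <= g * (a + b + d / 2).
  exact: ar9.
apply: (@le_trans _ _ ((1 + eta) * (g * (a + b + d / 2)))).
  apply: ler_pM => //.
  by rewrite !addr_ge0 ?mulr_ge0 ?slen_ge0 ?(covered_ge0 s1a) ?(covered_ge0 s2b)// ltW.
rewrite mulrCA ler_pM2l//.
apply: ar10 => //.
by rewrite ler_pM2l// lerD2l ler_pdivrMr// ler_peMr ?(ltW d0)// ler1n.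
Qed.

End Replacement.

(** * Eliminating the directions of a line *)

Section Pairs.
Variable R : realType.
Implicit Types (z p y : R * R) (N : R * R) (a b c : R).

Definition n1 z : R := `|z.1| + `|z.2|.
Definition app N z : R := N.1 * z.1 + N.2 * z.2.
Definition det2 p z : R := p.1 * z.2 - p.2 * z.1.
Definition pscale c z : R * R := (c * z.1, c * z.2).

Lemma n1_ge0 z : 0 <= n1 z. Proof. exact: addr_ge0. Qed.

Lemma n1_gt0 z : (0 < n1 z) = (z != 0).
Proof.
rewrite lt_def n1_ge0 andbT /n1 paddr_eq0// !normr_eq0.
by case: z.
Qed.

Lemma n1N z : n1 (- z) = n1 z. Proof. by rewrite /n1 /= !normrN. Qed.

Lemma n1D z p : n1 (z + p) <= n1 z + n1 p.
Proof.
rewrite /n1 /=; have := ler_normD z.1 p.1; have := ler_normD z.2 p.2; lra.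
Qed.

Lemma n1_scale c z : n1 (pscale c z) = `|c| * n1 z.
Proof. by rewrite /n1 /= !normrM mulrDr. Qed.

Lemma appD N z p : app N (z + p) = app N z + app N p.
Proof. by rewrite /app /=; ring. Qed.

Lemma appN N z : app N (- z) = - app N z.
Proof. by rewrite /app /=; ring. Qed.

Lemma ler_app N z : `|app N z| <= n1 N * n1 z.
Proof.
rewrite /app /n1; apply: le_trans (ler_normD _ _) _; rewrite !normrM.
have := mulr_ge0 (normr_ge0 N.1) (normr_ge0 z.2).
have := mulr_ge0 (normr_ge0 N.2) (normr_ge0 z.1); lra.
Qed.

(** If N vanishes approximately at p and y is almost proportional to p, then N
   is small at y, because N y |p|^2 = N p <y, p> + N p' det (p, y), where p' is
   p turned by a right angle. *)
Lemma app_near_zero N p y (d e : R) :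
  1 <= `|p.1| \/ 1 <= `|p.2| -> `|p.1| <= 1 -> `|p.2| <= 1 ->
  `|y.1| <= 1 -> `|y.2| <= 1 -> `|app N p| <= n1 N * d -> `|det2 p y| <= e ->
  `|app N y| <= n1 N * (2 * d + e).
Proof.
move=> p1 p1le p2le y1 y2 Np py.
have pp : 1 <= p.1 ^+ 2 + p.2 ^+ 2.
  have := sqr_ge0 p.1; have := sqr_ge0 p.2.
  rewrite -[p.1 ^+ 2]real_normK ?num_real// -[p.2 ^+ 2]real_normK ?num_real//.
  by case: p1 => H; nra.
have id : app N y * (p.1 ^+ 2 + p.2 ^+ 2) =
    app N p * (y.1 * p.1 + y.2 * p.2) + (N.2 * p.1 - N.1 * p.2) * det2 p y.
  by rewrite /app /det2; ring.
have pp0 : 0 <= p.1 ^+ 2 + p.2 ^+ 2 by apply: le_trans pp.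
have H0 : `|app N y| <= `|app N y * (p.1 ^+ 2 + p.2 ^+ 2)|.
  by rewrite normrM (ger0_norm pp0) ler_peMr.
apply: le_trans H0 _; rewrite id; apply: le_trans (ler_normD _ _) _; rewrite !normrM.
have H1 : `|y.1 * p.1 + y.2 * p.2| <= 2.
  apply: le_trans (ler_normD _ _) _; rewrite !normrM.
  have : `|y.1| * `|p.1| <= 1 by rewrite mulr_ile1.
  have : `|y.2| * `|p.2| <= 1 by rewrite mulr_ile1.
  lra.
have H2 : `|N.2 * p.1 - N.1 * p.2| <= n1 N.
  rewrite /n1 (addrC `|N.1|); apply: le_trans (ler_normB _ _) _; rewrite !normrM.
  by apply: lerD; rewrite ler_piMr.
have H3 : `|app N p| * `|y.1 * p.1 + y.2 * p.2| <= n1 N * d * 2 by rewrite ler_pM.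
have H4 : `|N.2 * p.1 - N.1 * p.2| * `|det2 p y| <= n1 N * e by rewrite ler_pM.
by apply: le_trans (lerD H3 H4) _; rewrite mulrDr; lra.
Qed.

Lemma discrete_ivt (f : nat -> R) J : (0 < J)%N -> f 0%N * f J <= 0 ->
  exists2 i, (i < J)%N & f i * f i.+1 <= 0.
Proof.
case: J => // J _; elim: J => [|J IH] H; first by exists 0%N.
have [f0|f0] := leP (f 0%N * f J.+1) 0.
  by have [i iJ fi] := IH f0; exists i => //; exact: ltnW.
exists J.+1 => //; have [f1|f1] := eqVneq (f J.+1) 0.
  by rewrite f1 mul0r.
have f2 : 0 < f J.+1 ^+ 2 by rewrite lt_def sqr_ge0 sqrf_eq0 f1.
have f00 : 0 < f 0%N ^+ 2.
  by rewrite lt_def sqr_ge0 sqrf_eq0 andbT; apply: contraTN f0 => /eqP ->; rewrite mul0r ltxx.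
rewrite -(pmulr_rle0 _ f00).
have -> : f 0%N ^+ 2 * (f J.+1 * f J.+2) = (f 0%N * f J.+1) * (f 0%N * f J.+2) by ring.
by rewrite pmulr_rle0.
Qed.

(** The boundary of the square with vertices (1, 1), (-1, 1), (-1, -1),
   (1, -1), up to sign: every direction of the plane occurs on it. *)
Definition sqpt (M : nat) (b : bool) (i : nat) : R * R :=
  let s := i%:R / M%:R - 1 in if b then (1, s) else (s, 1).

Lemma sqpt_bounds M (b : bool) i : (i <= 2 * M)%N -> (0 < M)%N ->
  [/\ 1 <= `|(sqpt M b i).1| \/ 1 <= `|(sqpt M b i).2|,
      `|(sqpt M b i).1| <= 1 & `|(sqpt M b i).2| <= 1].
Proof.
move=> iM M0; have MR : (0 : R) < M%:R by rewrite ltr0n.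
have : `|i%:R / M%:R - 1 : R| <= 1.
  rewrite ler_norml; apply/andP; split.
    by rewrite lerBrDl subrr divr_ge0.
  by rewrite lerBlDr ler_pdivrMr// -[1 + 1]/(2%:R) -natrM ler_nat.
by rewrite /sqpt; case: b => /= H; rewrite normr1 lexx; split => //; [left|right].
Qed.

Lemma sqpt_step M (b : bool) i : (0 < M)%N -> n1 (sqpt M b i - sqpt M b i.+1) = M%:R^-1.
Proof.
move=> M0; have H : `|i%:R / M%:R - 1 - (i.+1%:R / M%:R - 1)| = M%:R^-1 :> R.
  rewrite -natr1 (_ : _ - _ = - M%:R^-1) ?normrN ?ger0_norm ?invr_ge0//; ring.
by rewrite /n1 /sqpt; case: b => /=; rewrite subrr normr0 ?add0r ?addr0 H.
Qed.

Lemma sqpt_cover M N : (0 < M)%N -> exists (b : bool) (i : 'I_(2 * M)),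
  app N (sqpt M b i) * app N (sqpt M b i.+1) <= 0.
Proof.
move=> M0; have MR : (M%:R : R) != 0 by rewrite pnatr_eq0 -lt0n.
pose b := `|N.1| <= `|N.2|.
have [||i iM H] := @discrete_ivt (fun i => app N (sqpt M b i)) (2 * M).
- by rewrite muln_gt0.
- have -> : sqpt M b 0 = if b then (1, -1) else (-1, 1).
    by rewrite /sqpt mul0r sub0r.
  have -> : sqpt M b (2 * M) = (1, 1).
    by rewrite /sqpt natrM mulfK// (_ : 2 - 1 = 1 :> R) ?if_same//; ring.
  have [bb|bb] := boolP b; rewrite /app /=.
    move: bb; rewrite /b => bb; have := normr_ge0 N.1.
    have := real_normK (num_real N.1); have := real_normK (num_real N.2); nra.
  move: bb; rewrite /b -ltNge => bb; have := normr_ge0 N.2.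
  have := real_normK (num_real N.1); have := real_normK (num_real N.2); nra.
- by exists b, (Ordinal iM).
Qed.

End Pairs.

Section Elimination.
Variable R : realType.
Variable kap : R[i].
Hypothesis kap1 : normc kap = 1.
Variables (n : vec3 R) (special : Prop).
Hypothesis special_real : special -> complex.Im kap = 0.
Variables (e3 tau Rad : R).
Hypotheses (e3_gt0 : 0 < e3) (tau_gt0 : 0 < tau) (Rad_ge0 : 0 <= Rad).
Variables (Cell : finType) (Gam : Cell -> set R[i]).
Variable killed : Cell -> vec3 R -> Prop.
Hypothesis Gam_bounded : forall q y, Gam q y -> normc y <= Rad.

Variables f1 f2 : vec3 R.
Definition comb (z : R * R) : vec3 R := scale3 z.1 f1 + scale3 z.2 f2.

Hypotheses (nf1 : dot3 n f1 = 0) (nf2 : dot3 n f2 = 0).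
Hypotheses (f1_le : nv f1 <= 2) (f2_le : nv f2 <= 2).
Hypothesis comb_free : forall z, comb z = 0 -> z = 0.

(** The motion along comb z displaces the cell q transversally at a speed of
   about app (N q) z, up to the error sg. *)
Variable N : Cell -> R * R.
Variables (cst sg vs e5 : R) (M : nat).
Hypotheses (cst_gt0 : 0 < cst) (sg_gt0 : 0 < sg) (vs_ge0 : 0 <= vs).
Hypotheses (e5_gt0 : 0 < e5) (e5_le1 : e5 <= 1) (M_large : 8 / e5 <= M%:R).
Hypothesis cross_cost1 : cst * #|Cell|%:R * (2 * sg) <= tau.
Hypothesis cross_cost2 : cst * #|Cell|%:R * (vs + sg) <= tau.

Local Notation repl := (replaceable kap n special e3 tau Rad Gam killed).

Hypothesis cell_crossing : forall q z, n1 z <= 2 ->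
  crossing kap Gam q (comb z) (cst * (`|app (N q) z| + sg)).
Hypothesis cell_killed : forall q z,
  (1 <= `|z.1| \/ 1 <= `|z.2|) -> `|z.1| <= 1 -> `|z.2| <= 1 ->
  vs <= n1 (N q) -> `|app (N q) z| <= n1 (N q) * e5 -> killed q (comb z).

Implicit Types (A : {set Cell}) (z p f x : R * R) (q : Cell).

Lemma combD z p : comb (z + p) = comb z + comb p.
Proof. by rewrite /comb /= !scale3Dl addrACA. Qed.

Lemma comb_scale c z : comb (pscale c z) = scale3 c (comb z).
Proof. by rewrite /comb /= scale3Dr !scale3A. Qed.

Lemma dot3_comb z : dot3 n (comb z) = 0.
Proof. by rewrite /comb dot3Dr !dot3Zr nf1 nf2 !mulr0 addr0. Qed.

Lemma plane_comb z : z != 0 -> plane n (comb z).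
Proof.
by move=> z0; split; [apply: contra z0 => /eqP/comb_free/eqP|exact: dot3_comb].
Qed.

Lemma nv_comb z : nv (comb z) <= 2 * n1 z.
Proof.
apply: le_trans (nvD _ _) _; rewrite !nv_scale /n1 (mulrDr 2).
by apply: lerD; rewrite mulrC ler_wpM2r.
Qed.

Definition bounded_cost A K := forall z, z != 0 -> repl A (comb z) (K * n1 z).

Lemma replaceable_scaled A z c a : 0 < c -> repl A (comb (pscale c^-1 z)) a ->
  repl A (comb z) (c * a).
Proof.
move=> c0 /(replaceable_scale c0); rewrite -comb_scale.
by rewrite /pscale /= !mulrA divff ?gt_eqF// !mul1r -surjective_pairing.
Qed.

Lemma bounded_cost_unit A K :
  (forall z, n1 z = 1 -> repl A (comb z) K) -> bounded_cost A K.
Proof.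
move=> H z; rewrite -n1_gt0 => z0; rewrite mulrC.
apply: replaceable_scaled => //; apply: H.
by rewrite n1_scale gtr0_norm ?invr_gt0// mulVf// gt_eqF.
Qed.

Lemma replaceable_cross_set A (T : {set Cell}) x a c : 0 <= c ->
  (forall q, q \in T -> crossing kap Gam q (comb x) c) ->
  repl (T :|: A) (comb x) a ->
  repl A (comb x) (a + #|T :\: A|%:R * c).
Proof.
move=> c0; move: {2}#|T :\: A| (erefl #|T :\: A|) => m.
elim: m A => [|m IH] A Tm Tc.
  have -> : T :|: A = A.
    by apply/finset.setUidPr; rewrite -finset.setD_eq0 -cards_eq0 Tm.
  by rewrite Tm mul0r addr0.
have [q qTA] : exists q, q \in T :\: A by apply/card_gt0P; rewrite Tm.
have := qTA; rewrite finset.inE => /andP[qA qT] H.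
have TqE : T :\: (q |: A) = (T :\: A) :\ q.
  by apply/finset.setP => p; rewrite !finset.inE negb_or; case: (p == q); rewrite ?andbF.
have Tq : #|T :\: (q |: A)| = m.
  by have := cardsD1 q (T :\: A); rewrite qTA Tm TqE => -[->].
have {}IH := IH (q |: A) Tq Tc.
have TE : T :|: (q |: A) = T :|: A.
  by rewrite finset.setUCA; apply/finset.setUidPr; rewrite finset.sub1set finset.inE qT.
rewrite TE in IH; have {}IH := IH H; rewrite Tq in IH.
have := replaceable_cross Gam_bounded (Tc q qT) IH.
by rewrite Tm -natr1 mulrDl mul1r addrA.
Qed.

Definition between p f : {set Cell} := [set q | app (N q) p * app (N q) f <= 0].

(** A cell whose direction lies between p and f is crossed, at a small
   transversal speed, by one of the small motions into which the passage from
   p to f is divided. What remains is a motion along f, with these cells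
   already crossed, and motions that sum up to p - f. *)
Lemma replaceable_turn A K p f a : 0 <= K -> 0 <= a -> n1 p <= 2 -> n1 f <= 2 ->
  p != f -> bounded_cost A K -> repl (between p f :|: A) (comb f) a ->
  repl A (comb p) (a + K * n1 (p - f) + tau).
Proof.
move=> K0 a0 p2 f2' pf AK Ha.
have pf0 : 0 < n1 (p - f) by rewrite n1_gt0 subr_eq0.
have [J J0 HJ] := exists_nat_gt ((\sum_q n1 (N q)) * n1 (p - f) / sg).
have JR : (0 : R) < J%:R by rewrite ltr0n.
have JR0 : (J%:R : R) != 0 by rewrite gt_eqF.
pose x j := p + pscale (j%:R / J%:R) (f - p).
have x0 : x 0%N = p.
  by rewrite /x mul0r /pscale /= !mul0r; apply/eqP; rewrite -subr_eq0 addrC addKr.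
have xJ : x J = f.
  by rewrite /x divff// /pscale !mul1r -surjective_pairing addrC subrK.
pose D := pscale J%:R^-1 (p - f).
have xS j : x j = D + x j.+1.
  by rewrite /x /D /pscale -natr1 mulrDl; case: (p) (f) => [p1 p2'] [g1 g2'];
     congr pair; rewrite /=; ring.
have xn j : (j <= J)%N -> n1 (x j) <= 2.
  move=> jJ; have t0 : 0 <= j%:R / J%:R :> R by rewrite divr_ge0.
  have t1 : j%:R / J%:R <= 1 :> R by rewrite ler_pdivrMr// mul1r ler_nat.
  have -> : x j = pscale (1 - j%:R / J%:R) p + pscale (j%:R / J%:R) f.
    by rewrite /x /pscale; case: (p) (f) => [p1 p2'] [g1 g2'];
       congr pair; rewrite /=; ring.
  apply: le_trans (n1D _ _) _; rewrite !n1_scale (ger0_norm t0) ger0_norm ?subr_ge0//.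
  move: (j%:R / J%:R) t0 t1 => t t0 t1.
  have : (1 - t) * n1 p <= (1 - t) * 2 by rewrite ler_wpM2l ?subr_ge0.
  have : t * n1 f <= t * 2 by rewrite ler_wpM2l.
  lra.
have appD_le q : `|app (N q) D| <= sg.
  apply: le_trans (ler_app _ _) _; rewrite n1_scale gtr0_norm ?invr_gt0//.
  rewrite mulrCA mulrC ler_pdivrMr//.
  rewrite ltr_pdivrMr// in HJ; rewrite (mulrC sg); apply: le_trans (ltW HJ).
  rewrite ler_pM2r// (bigD1 q)//= lerDl; apply: sumr_ge0 => ? _; exact: n1_ge0.
have D0 : D != 0 by rewrite -n1_gt0 n1_scale mulr_gt0// normr_gt0 invr_eq0.
pose c := cst * (2 * sg).
have c0 : 0 <= c by rewrite !mulr_ge0// ltW.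
pose A' (j : nat) := [set q | [exists i : 'I_j, app (N q) (x i) * app (N q) (x i.+1) <= 0]] :|: A.
suff main k : (k <= J)%N -> repl (A' (J - k)%N) (comb (x (J - k)%N))
    (a + k%:R * (K * n1 D) + #|~: A' (J - k)%N|%:R * c).
  have := main J (leqnn J); rewrite subnn x0.
  have -> : A' 0%N = A.
    apply/finset.setP => q; rewrite !finset.inE; case: existsP => // -[[]] //.
  apply: replaceable_le; rewrite n1_scale gtr0_norm ?invr_gt0//.
  rewrite (_ : J%:R * _ = K * n1 (p - f)); last by field.
  rewrite lerD2l; apply: le_trans cross_cost1.
  have -> : cst * #|Cell|%:R * (2 * sg) = #|Cell|%:R * c by rewrite /c; ring.
  by rewrite ler_wpM2r// ler_nat max_card.
elim: k => [|k IH] kJ.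
  rewrite subn0 xJ mul0r addr0.
  apply: (@replaceable_le _ _ _ _ _ _ _ _ _ _ _ _ a).
    by rewrite lerDl mulr_ge0.
  apply: replaceable_sub Ha; rewrite finset.setSU//.
  apply/fintype.subsetP => q; rewrite !finset.inE -{1}x0 -{1}xJ => H.
  have [i iJ Hi] := @discrete_ivt _ (fun i => app (N q) (x i)) J J0 H.
  by apply/existsP; exists (Ordinal iJ).
have {}IH := IH (ltnW kJ).
set j := (J - k.+1)%N in IH *.
have jS : (J - k)%N = j.+1 by rewrite /j subnSK.
have jJ : (j < J)%N by rewrite -jS leq_subr.
rewrite jS in IH.
have AA' : A \subset A' j.+1 by rewrite finset.subsetUr.
have HD : repl (A' j.+1) (comb D) (K * n1 D) by apply: replaceable_sub AA' (AK _ D0).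
have KD0 : 0 <= K * n1 D by rewrite mulr_ge0 ?n1_ge0.
have base0 : 0 <= a + k%:R * (K * n1 D) + #|~: A' j.+1|%:R * c.
  by rewrite !addr_ge0// mulr_ge0.
have := replaceable_add kap1 special_real tau_gt0 Rad_ge0 KD0 base0
  (dot3_comb D) HD IH.
rewrite -combD -xS => {}IH.
pose T := between (x j) (x j.+1).
have TA : T :|: A' j = A' j.+1.
  apply/finset.setP => q; rewrite !finset.inE orbA; congr (_ || _).
  apply/orP/existsP => [[H|/existsP[i H]]|[i H]].
  - by exists ord_max.
  - by exists (widen_ord (leqnSn j) i).
  - have := ltn_ord i; rewrite ltnS leq_eqVlt => /orP[/eqP ij|ij].
      by left; rewrite -ij.
    by right; apply/existsP; exists (Ordinal ij).
rewrite -TA in IH.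
have Tc q : q \in T -> crossing kap Gam q (comb (x j)) c.
  rewrite finset.inE => qT d d0.
  have [r r0 Hr] := cell_crossing q (xn j (ltnW jJ)) d0.
  exists r => // x' x'r h hr; have [d' d'0 cov] := Hr _ x'r _ hr; exists d' => //.
  apply: covered_le cov => //; case/andP: hr => h0 _; rewrite ler_pM2l// lerD2r.
  rewrite /c ler_pM2l// mulr2n mulrDl mul1r lerD2r.
  apply: le_trans (appD_le q).
  have -> : D = x j - x j.+1 by rewrite xS addrK.
  rewrite appD appN; move: (app (N q) (x j)) (app (N q) (x j.+1)) qT => s t st.
  have [s0|s0] := leP 0 s.
    have [s00|s00] := eqVneq s 0; first by rewrite s00 normr0.
    have : t <= 0 by rewrite -(@pmulr_rle0 _ s)// lt_def s00.
    by move=> t0; rewrite !ger0_norm ?subr_ge0//; lra.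
  have : 0 <= t by rewrite -(@nmulr_rle0 _ s).
  by move=> t0; rewrite !ler0_norm; lra.
have := replaceable_cross_set c0 Tc IH.
apply: replaceable_le.
have card : (#|~: (T :|: A' j)| + #|T :\: A' j| = #|~: A' j|)%N.
  rewrite -(cardsID T (~: A' j)) addnC; congr (_ + _)%N; apply: eq_card => q.
    by rewrite !finset.inE andbC.
  by rewrite !finset.inE negb_or.
by rewrite -card natrD -natr1 !mulrDl mul1r; lra.
Qed.

Lemma betweenN p f : between (- p) (- f) = between p f.
Proof. by apply/finset.setP => q; rewrite !finset.inE !appN mulrNN. Qed.

Lemma bounded_cost_le A K K' : K <= K' -> bounded_cost A K -> bounded_cost A K'.
Proof.
move=> KK H z z0; apply: replaceable_le (H z z0).
by rewrite ler_wpM2r ?n1_ge0.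
Qed.

Lemma bounded_cost_sub (A A' : {set Cell}) K :
  A \subset A' -> bounded_cost A K -> bounded_cost A' K.
Proof. by move=> AA H z z0; apply: replaceable_sub AA (H z z0). Qed.

Lemma bounded_cost_crossed A (T : {set Cell}) K c :
  (forall q z, q \in T -> n1 z = 1 -> crossing kap Gam q (comb z) c) -> 0 <= c ->
  bounded_cost (T :|: A) K -> bounded_cost A (K + #|Cell|%:R * c).
Proof.
move=> Tc c0 H; apply: bounded_cost_unit => z z1.
have z0 : z != 0 by rewrite -n1_gt0 z1.
have := H z z0; rewrite z1 mulr1 => {}H.
have := replaceable_cross_set c0 (fun q qT => Tc q z qT z1) H.
by apply: replaceable_le; rewrite lerD2l ler_wpM2r// ler_nat max_card.
Qed.

(** Sweeping every cell by the direct motion gives some bound. It depends on the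
   cells, but only serves to start the iteration of bounded_cost_halve. *)
Lemma bounded_cost_exists A : exists2 K, 0 <= K & bounded_cost A K.
Proof.
have HT : bounded_cost (finset.setTfor Cell) (2 * tau).
  move=> z z0; apply: (replaceable_le (a := tau * nv (comb z))).
    by rewrite (mulrC 2) -mulrA ler_pM2l// nv_comb.
  by apply: replaceable_terminal (plane_comb z0) (plane_comb z0) _ => // q; rewrite finset.inE.
pose c := cst * (\sum_q n1 (N q) + sg).
have S0 : 0 <= \sum_q n1 (N q) by apply: sumr_ge0 => q _; exact: n1_ge0.
have c0 : 0 <= c by rewrite mulr_ge0 ?(ltW cst_gt0)// addr_ge0// ltW.
exists (2 * tau + #|Cell|%:R * c).
  by rewrite addr_ge0// mulr_ge0// ltW.
apply: (bounded_cost_crossed (T := finset.setTfor Cell)) => //; last by rewrite finset.setTU.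
move=> q z _ z1 d d0; have [|r r0 Hr] := @cell_crossing q z _ _ d0.
  by rewrite z1 ler1n.
exists r => // x' x'r h hr; have [d' d'0 cov] := Hr _ x'r _ hr; exists d' => //.
apply: covered_le cov => //; case/andP: hr => h0 _; rewrite ler_pM2l// lerD2r.
rewrite /c ler_pM2l// lerD2r; apply: le_trans (ler_app _ _) _.
rewrite z1 mulr1 (bigD1 q)//= lerDl; apply: sumr_ge0 => ? _; exact: n1_ge0.
Qed.

Lemma replaceable_signed A p a c :
  repl A (comb p) a -> repl A (comb (- p)) a -> c != 0 ->
  repl A (comb (pscale c p)) (`|c| * a).
Proof.
move=> Hp HNp; rewrite neq_lt => /orP[] c0.
  have -> : pscale c p = pscale (- c) (- p) by rewrite /pscale /= !mulrNN.
  rewrite comb_scale ltr0_norm//; apply: replaceable_scale HNp.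
  by rewrite oppr_gt0.
by rewrite comb_scale gtr0_norm//; exact: replaceable_scale Hp.
Qed.

Lemma M_gt0 : (0 < M)%N.
Proof.
by rewrite -(ltr0n R); apply: lt_le_trans M_large; rewrite divr_gt0.
Qed.

(** Each cell belongs to an arc of directions on which its form changes sign: the
   centers there move the cell almost along itself. *)
Definition arcs := (bool * 'I_(2 * M))%type.
Definition arc_start (i : arcs) := sqpt R M i.1 i.2.
Definition arc_end (i : arcs) := sqpt R M i.1 i.2.+1.
Definition arc_cells (i : arcs) := between (arc_start i) (arc_end i).

Lemma n1_le2 z : `|z.1| <= 1 -> `|z.2| <= 1 -> n1 z <= 2.
Proof. by rewrite /n1; lra. Qed.

Lemma arc_startP i : [/\ 1 <= `|(arc_start i).1| \/ 1 <= `|(arc_start i).2|,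
  `|(arc_start i).1| <= 1 & `|(arc_start i).2| <= 1].
Proof. by apply: sqpt_bounds M_gt0; exact: ltnW. Qed.

Lemma arc_endP i : [/\ 1 <= `|(arc_end i).1| \/ 1 <= `|(arc_end i).2|,
  `|(arc_end i).1| <= 1 & `|(arc_end i).2| <= 1].
Proof. exact: sqpt_bounds M_gt0. Qed.

Lemma arc_length i : n1 (arc_start i - arc_end i) = M%:R^-1.
Proof. exact: sqpt_step M_gt0. Qed.

Lemma arc_turn A K0 K i : 0 <= K0 -> 0 <= K -> bounded_cost A K ->
  bounded_cost (arc_cells i :|: A) K0 ->
  repl A (comb (arc_start i)) (K0 * 2 + K / M%:R + tau) /\
  repl A (comb (- arc_start i)) (K0 * 2 + K / M%:R + tau).
Proof.
move=> K00 Kge0 AK AK0.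
have [_ s1 s2] := arc_startP i; have [e0 e1 e2] := arc_endP i.
have se : arc_start i - arc_end i != 0.
  by rewrite -n1_gt0 arc_length invr_gt0 ltr0n M_gt0.
have en : arc_end i != 0.
  rewrite -n1_gt0 /n1; case: e0 => H.
    by rewrite ltr_pwDl// (lt_le_trans ltr01).
  by rewrite ltr_pwDr// (lt_le_trans ltr01).
have K2 : 0 <= K0 * 2 by rewrite mulr_ge0.
have n1s := n1_le2 s1 s2; have n1e := n1_le2 e1 e2.
split.
  rewrite -(arc_length i); apply: replaceable_turn => //; first by rewrite -subr_eq0.
  by apply: replaceable_le (AK0 _ en); rewrite ler_wpM2l.
have <- : n1 (- arc_start i - - arc_end i) = M%:R^-1 by rewrite -opprD n1N arc_length.
have pf : - arc_start i != - arc_end i by rewrite eqr_opp -subr_eq0.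
apply: replaceable_turn AK _ => //; [by rewrite n1N|by rewrite n1N|].
rewrite betweenN; apply: replaceable_le (AK0 _ _); last by rewrite oppr_eq0.
by rewrite n1N ler_wpM2l.
Qed.

(** If the cells of either of two transversal arcs can be crossed, then motions
   in both directions, hence in all directions, are cheap up to a fraction of
   their original cost: the factor 1 / M is the length of an arc. *)
Lemma bounded_cost_halve A K0 K i j : 0 <= K0 -> 0 <= K ->
  e5 / 2 <= `|det2 (arc_start i) (arc_start j)| -> bounded_cost A K ->
  bounded_cost (arc_cells i :|: A) K0 -> bounded_cost (arc_cells j :|: A) K0 ->
  bounded_cost A (K / 2 + 4 / e5 * (K0 * 2 + tau)).
Proof.
move=> K00 Kge0 dij AK AKi AKj z z0.
have [Hi HNi] := arc_turn K00 Kge0 AK AKi.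
have [Hj HNj] := arc_turn K00 Kge0 AK AKj.
have [_ i1 i2] := arc_startP i; have [_ j1 j2] := arc_startP j.
move: (arc_start i) (arc_start j) dij Hi HNi Hj HNj i1 i2 j1 j2 => p f.
move=> dpf Hp HNp Hf HNf p1 p2 g1 g2.
set D := det2 p f in dpf; set a := K0 * 2 + _ + _ in Hp HNp Hf HNf.
have MR : (0 : R) < M%:R by rewrite ltr0n M_gt0.
have KM : 0 <= K / M%:R by rewrite divr_ge0.
have a0 : 0 <= a by rewrite !addr_ge0 ?mulr_ge0 ?(ltW tau_gt0).
have e0 : 0 < e5 / 2 by rewrite divr_gt0.
have D0 : D != 0 by rewrite -normr_gt0 (lt_le_trans e0).
have D1 : 0 < `|D| by rewrite normr_gt0.
pose s := det2 z f / D; pose t := det2 p z / D.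
have zE : z = pscale s p + pscale t f.
  rewrite [z]surjective_pairing; congr pair => /=;
  rewrite /s /t /D /det2 in D0 *; field; exact: D0.
have det_le (u v : R * R) : `|v.1| <= 1 -> `|v.2| <= 1 -> `|det2 u v| <= n1 u.
  move=> v1 v2; rewrite /det2 /n1; apply: le_trans (ler_normB _ _) _.
  by rewrite !normrM; apply: lerD; rewrite ler_piMr.
have inv_le (r : R) : `|r| <= n1 z -> `|r / D| <= 2 / e5 * n1 z.
  move=> rz; rewrite normrM normfV ler_pdivrMr//; apply: le_trans rz _.
  have -> : 2 / e5 * n1 z * `|D| = n1 z * (2 / e5 * `|D|) by ring.
  rewrite ler_peMr ?n1_ge0// mulrAC ler_pdivlMr// mul1r.
  by move: dpf; rewrite ler_pdivrMr// mulrC.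
have s_le : `|s| <= 2 / e5 * n1 z by apply: inv_le; exact: det_le.
have t_le : `|t| <= 2 / e5 * n1 z.
  apply: inv_le; have -> : det2 p z = - det2 z p by rewrite /det2; ring.
  by rewrite normrN; exact: det_le.
have cost : (`|s| + `|t|) * a <= (K / 2 + 4 / e5 * (K0 * 2 + tau)) * n1 z.
  have H1 : (`|s| + `|t|) * a <= 4 / e5 * n1 z * a.
    by rewrite ler_wpM2r//; lra.
  apply: le_trans H1 _; rewrite mulrAC ler_wpM2r ?n1_ge0//.
  have : 4 / e5 * (K / M%:R) <= K / 2.
    have -> : 4 / e5 * (K / M%:R) = K * (4 / e5 / M%:R) by ring.
    by rewrite ler_wpM2l// ler_pdivrMr//; move: M_large; lra.
  rewrite /a !mulrDr; lra.
apply: (replaceable_le cost); rewrite mulrDl zE combD.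
have [s0|s0] := eqVneq s 0.
  have t0 : t != 0.
    apply: contra z0 => /eqP t0; rewrite zE s0 t0 /pscale !mul0r.
    by apply/eqP; congr pair; rewrite /= addr0.
  rewrite s0 normr0 mul0r add0r -combD /pscale !mul0r.
  by rewrite (_ : (0, 0) = 0 :> R * R)// add0r; exact: replaceable_signed.
have [t0|t0] := eqVneq t 0.
  rewrite t0 normr0 mul0r addr0 -combD {2}/pscale !mul0r.
  by rewrite (_ : (0, 0) = 0 :> R * R)// addr0; exact: replaceable_signed.
apply: (replaceable_add kap1 special_real tau_gt0 Rad_ge0); rewrite ?mulr_ge0//.
- exact: dot3_comb.
- exact: replaceable_signed.
- exact: replaceable_signed.
Qed.

Lemma bounded_cost_limit A K D eta : 0 <= K -> 0 <= D -> 0 < eta ->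
  (forall K, 0 <= K -> bounded_cost A K -> bounded_cost A (K / 2 + D)) ->
  bounded_cost A K -> bounded_cost A (2 * D + eta).
Proof.
move=> K0 D0 eta0 H AK.
have pw m : (0 : R) < 2 ^+ m by rewrite exprn_gt0.
have main m : bounded_cost A (2 * D + K / 2 ^+ m).
  elim: m => [|m IH]; first by apply: bounded_cost_le AK; rewrite expr0 divr1 lerDr mulr_ge0.
  have := H _ _ IH; rewrite addr_ge0 ?mulr_ge0 ?divr_ge0 ?(ltW (pw _))// => /(_ isT).
  apply: bounded_cost_le; rewrite exprS invfM.
  by rewrite le_eqVlt; apply/orP; left; apply/eqP; field; rewrite gt_eqF.
have [m _ mK] := exists_nat_gt (K / eta).
apply: bounded_cost_le (main m); rewrite lerD2l ler_pdivrMr//.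
rewrite ltr_pdivrMr// in mK; apply: le_trans (ltW mK) _.
by rewrite mulrC ler_pM2l// -natrX ler_nat ltnW// ltn_expl.
Qed.

Definition crossed (I : {set arcs}) : {set Cell} :=
  [set q | (n1 (N q) < vs) || [exists i in I, q \in arc_cells i]].

(** The recursion is the limit of K |-> K / 2 + 4 / e5 * (K0 * 2 + tau) for
   K0 = cost_factor k' * tau, in units of tau and with a margin of 1. *)
Fixpoint cost_factor k : R :=
  if k is k'.+1 then 8 / e5 * (cost_factor k' * 2 + 1) + 1 else 2.

Lemma cost_factor_ge0 k : 0 <= cost_factor k.
Proof.
elim: k => //= k IH; have H : 0 <= 8 / e5 by rewrite divr_ge0// ltW.
by rewrite addr_ge0// mulr_ge0// addr_ge0// mulr_ge0.
Qed.

Lemma cost_factor_leS k : cost_factor k <= cost_factor k.+1.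
Proof.
rewrite /=; have c0 := cost_factor_ge0 k.
have H : 1 <= 8 / e5 by rewrite ler_pdivlMr// mul1r; apply: le_trans e5_le1 _; rewrite ler1n.
have : 1 * (cost_factor k * 2 + 1) <= 8 / e5 * (cost_factor k * 2 + 1).
  by rewrite ler_wpM2r// addr_ge0// mulr_ge0.
lra.
Qed.

(** Every remaining cell has a form that changes sign on an arc close to arc i,
   so it is killed by the start of arc i. *)
Lemma bounded_cost_terminal (I : {set arcs}) i : i \notin I ->
  (forall j, j \notin I -> `|det2 (arc_start i) (arc_start j)| < e5 / 2) ->
  bounded_cost (crossed I) (2 * tau).
Proof.
move=> iI close z z0; have [i0 i1 i2] := arc_startP i.
have s0 : arc_start i != 0.
  rewrite -n1_gt0 /n1; case: i0 => H.
    by rewrite ltr_pwDl// (lt_le_trans ltr01).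
  by rewrite ltr_pwDr// (lt_le_trans ltr01).
apply: (replaceable_le (a := tau * nv (comb z))).
  by rewrite (mulrC 2) -mulrA ler_pM2l// nv_comb.
apply: replaceable_terminal (plane_comb z0) (plane_comb s0) _ => // q.
rewrite finset.inE negb_or -leNgt => /andP[qvs qI].
have [b [j0 Hj]] := sqpt_cover (N q) M_gt0.
pose j : arcs := (b, j0).
have qj : q \in arc_cells j by rewrite finset.inE.
have jI : j \notin I.
  by apply: contra qI => jI; apply/existsP; exists j; rewrite jI.
have [j00 j1 j2] := arc_startP j.
apply: cell_killed => //.
apply: (@le_trans _ _ (n1 (N q) * (2 * M%:R^-1 + e5 / 2))); last first.
  rewrite ler_wpM2l ?n1_ge0//.
  have : 2 * M%:R^-1 <= e5 / 4.
    have MR : (0 : R) < M%:R by rewrite ltr0n M_gt0.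
    rewrite ler_pdivrMr// mulrC mulrA ler_pdivlMr//.
    by move: M_large; rewrite ler_pdivrMr//; lra.
  by have := e5_gt0; lra.
apply: (app_near_zero (p := arc_start j)) => //; last first.
  have -> : det2 (arc_start j) (arc_start i) = - det2 (arc_start i) (arc_start j).
    by rewrite /det2; ring.
  by rewrite normrN ltW// close.
rewrite -(arc_length j); apply: le_trans (ler_app _ _).
rewrite appD appN; move: qj; rewrite finset.inE.
move: (app _ (arc_start j)) (app _ (arc_end j)) => s t st.
have [s1|s1] := leP 0 s.
  have [s00|s00] := eqVneq s 0; first by rewrite s00 normr0.
  have : t <= 0 by rewrite -(@pmulr_rle0 _ s)// lt_def s00.
  by move=> t0; rewrite !ger0_norm ?subr_ge0//; lra.
have : 0 <= t by rewrite -(@nmulr_rle0 _ s).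
by move=> t0; rewrite !ler0_norm; lra.
Qed.

(** Induction on the set of arcs that remain to be crossed. Either they are all
   close to one direction, which is then discarded, or two of them are
   transversal. *)
Lemma bounded_cost_crossed_arcs k (I : {set arcs}) : (#|~: I| <= k)%N ->
  bounded_cost (crossed I) (cost_factor k * tau).
Proof.
elim: k I => [|k IH] I Ik.
  have IT : I = finset.setTfor arcs.
    by apply/finset.setP => i; move: Ik; rewrite leqn0 cards_eq0 => /eqP/finset.setP/(_ i);
       rewrite !finset.inE => /negbFE.
  move=> z z0; apply: (replaceable_le (a := tau * nv (comb z))).
    by rewrite (mulrC 2) -mulrA ler_pM2l// nv_comb.
  apply: replaceable_terminal (plane_comb z0) (plane_comb z0) _ => // q.
  rewrite finset.inE negb_or => /andP[_ /negP[]]; apply/existsP.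
  have [b [j0 Hj]] := sqpt_cover (N q) M_gt0.
  by exists (b, j0); rewrite IT !finset.inE.
have [I0 | [i iI]] := finset.set_0Vmem (~: I).
  apply: bounded_cost_le (IH I _); last by rewrite I0 cards0.
  by rewrite ler_wpM2r ?cost_factor_leS// ltW.
rewrite finset.inE in iI.
have [/existsP[j /andP[jI dij]]|far] :=
  boolP [exists j, (j \notin I) &&
    (e5 / 2 <= `|det2 (arc_start i) (arc_start j)|)].
- have IHi l : l \notin I ->
    bounded_cost (arc_cells l :|: crossed I) (cost_factor k * tau).
    move=> lI; apply: (@bounded_cost_sub (crossed (l |: I))).
      apply/fintype.subsetP => q; rewrite !finset.inE => /orP[->|]; first by rewrite orbT.
      move=> /existsP[m /andP[]]; rewrite !finset.inE => /orP[/eqP ->|mI] H.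
        by rewrite H.
      by rewrite orbA orbC; apply/orP; left; apply/existsP; exists m; rewrite mI finset.inE.
    apply: IH; rewrite -ltnS; apply: leq_trans Ik; rewrite finset.setCU.
    rewrite (cardsD1 l (~: I)) finset.inE lI ltnS subset_leq_card//.
    by apply/fintype.subsetP => m; rewrite !finset.inE.
  have Kp : 0 <= cost_factor k * tau by rewrite mulr_ge0 ?cost_factor_ge0// ltW.
  have D0 : 0 <= 4 / e5 * (cost_factor k * tau * 2 + tau).
    apply: mulr_ge0; first by rewrite divr_ge0// ltW.
    by rewrite addr_ge0 ?(ltW tau_gt0)// mulr_ge0.
  have [K0 K00 HK] := bounded_cost_exists (crossed I).
  have := bounded_cost_limit K00 D0 tau_gt0 _ HK.
  rewrite (_ : 2 * _ + tau = cost_factor k.+1 * tau); last by rewrite /=; ring.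
  apply=> K Kge0 AK.
  exact: (bounded_cost_halve Kp Kge0 dij AK (IHi _ iI) (IHi _ jI)).
- apply: bounded_cost_le (bounded_cost_terminal iI _).
    rewrite ler_pM2r//; elim: (k) => [|m IHm]; first exact: (cost_factor_leS 0).
    exact: le_trans IHm (cost_factor_leS _).
  move=> j jI; rewrite ltNge; apply: contra far => dij.
  by apply/existsP; exists j; rewrite jI.
Qed.

(** The cells with small forms move slowly in all directions, so sweeping all of
   them by the direct motion costs at most tau. *)
Lemma bounded_cost_all : bounded_cost finset.set0 ((cost_factor #|{: arcs}| + 1) * tau).
Proof.
have H := @bounded_cost_crossed_arcs #|{: arcs}| finset.set0 (max_card _).
apply: (bounded_cost_le (K := cost_factor #|{: arcs}| * tau + #|Cell|%:R * (cst * (vs + sg)))).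
  by rewrite mulrDl mul1r lerD2l mulrCA mulrA.
apply: (bounded_cost_crossed (T := crossed finset.set0)) => //.
- move=> q z; rewrite finset.inE => /orP[qv z1|/existsP[m]]; last by rewrite !finset.inE.
  move=> d d0; have [|r r0 Hr] := @cell_crossing q z _ _ d0; first by rewrite z1 ler1n.
  exists r => // x' x'r h hr; have [d' d'0 cov] := Hr _ x'r _ hr; exists d' => //.
  apply: covered_le cov => //; case/andP: hr => h0 _; rewrite ler_pM2l// lerD2r.
  rewrite ler_pM2l// lerD2r; apply: le_trans (ler_app _ _) _.
  by rewrite z1 mulr1 ltW.
- by rewrite mulr_ge0 ?addr_ge0// ltW.
- by rewrite finset.setU0.
Qed.

End Elimination.

(** * The area swept by a short arc *)

Section Strip.
Variable R : realType.

Lemma covered_bigcup (S : nat -> set R[i]) m a : 0 <= a ->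
  (forall i, (i < m)%N -> covered (S i) a) ->
  covered [set z | exists2 i, (i < m)%N & S i z] (m%:R * a).
Proof.
move=> a0; elim: m => [|m IH] H.
  by rewrite mul0r; apply: covered_le (lexx 0) (covered0 _) => z [].
rewrite -natr1 mulrDl mul1r.
apply: covered_le (lexx _) (coveredU (IH _) (H m (leqnn _))) => [z [i im iz]|i im].
  move: im; rewrite ltnS leq_eqVlt => /orP[/eqP <-|im]; first by right.
  by left; exists i.
by apply: H; exact: ltnW.
Qed.

Lemma covered_strip (z0 u : R[i]) r L : normc u = 1 -> 0 < r -> 0 <= L ->
  covered [set z | exists2 s, `|s| <= L & normc (z - (z0 + s%:C * u)) <= r]
    (4 * r * (2 * L + r)).
Proof.
move=> u1 r0 L0.
pose m := Num.truncn (2 * L / r).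
exists [seq (z0 + (k%:R * r - L)%:C * u, 2 * r) | k <- iota 0 m.+1].
  move=> z [s sL zs]; move: sL; rewrite ler_norml => /andP[s1 s2].
  pose k := Num.truncn ((s + L) / r).
  have sL0 : 0 <= (s + L) / r by rewrite divr_ge0 ?(ltW r0)//; lra.
  exists (z0 + (k%:R * r - L)%:C * u, 2 * r).
    apply/mapP; exists k => //; rewrite mem_iota add0n ltnS /=.
    by apply: le_truncn; rewrite ler_pM2r ?invr_gt0//; lra.
  have /andP[k1 k2] := truncn_itv sL0.
  rewrite -/k in k1 k2; rewrite ler_pdivlMr// in k1; rewrite ltr_pdivrMr// -natr1 in k2.
  apply: le_trans (ler_normc_dist z (z0 + s%:C * u) _) _ => /=.
  have -> : z0 + s%:C * u - (z0 + (k%:R * r - L)%:C * u) = (s + L - k%:R * r)%:C * u.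
    by rewrite !(rmorphB, rmorphD, rmorphM) /=; ring.
  have : normc ((s + L - k%:R * r)%:C * u) <= r.
    rewrite normc_scale u1 mulr1 ler_norml; apply/andP; split; lra.
  lra.
rewrite big_map -[iota 0 m.+1]/(index_iota 0 m.+1).
rewrite (eq_bigr (fun=> (2 * r) ^+ 2))// sumr_const_nat subn0.
rewrite -[X in X <= _]mulr_natl exprMn.
have : m%:R <= 2 * L / r by rewrite truncn_le divr_ge0 ?mulr_ge0// ltW.
rewrite ler_pdivlMr// => mr.
rewrite -natr1; have : m%:R * r * r <= 2 * L * r by rewrite ler_wpM2r// ltW.
rewrite expr2; lra.
Qed.

End Strip.

Lemma realCM (R : realType) (a b : R) (z : R[i]) :
  (a * b)%:C * z = a%:C * (b%:C * z).
Proof. by rewrite rmorphM mulrA. Qed.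

Section ArcCrossing.
Variable R : realType.
Variable kap : R[i].
Hypothesis kap1 : normc kap = 1.

Definition vfield (x : vec3 R) (y : R[i]) : R[i] := kap * (x.2%:C * y - x.1).

Lemma vfieldD x x' y : vfield (x + x') y = vfield x y + vfield x' y.
Proof. by rewrite /vfield /= rmorphD /=; ring. Qed.

Lemma vfield_scale c x y : vfield (scale3 c x) y = c%:C * vfield x y.
Proof. by rewrite /vfield /= rmorphM /=; ring. Qed.

Lemma vfield_le x y Rad : normc y <= Rad -> normc (vfield x y) <= (1 + Rad) * nv x.
Proof.
move=> yR; rewrite /vfield normcM kap1 mul1r; apply: le_trans (ler_normcB _ _) _.
rewrite normc_scale /nv.
have : `|x.2| * normc y <= `|x.2| * Rad by rewrite ler_wpM2l.
have := mulr_ge0 (normc_ge0 x.1) (le_trans (normc_ge0 y) yR).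
have := normr_ge0 x.2; lra.
Qed.

(** The component of v normal to d. *)
Definition cross2 (d v : R[i]) : R :=
  (complex.Re d * complex.Im v - complex.Im d * complex.Re v) / normc d.

Lemma cross2D d v w : cross2 d (v + w) = cross2 d v + cross2 d w.
Proof. by case: v w => [a b] [a' b']; rewrite /cross2 /=; ring. Qed.

Lemma cross2_scale d c v : cross2 d (c%:C * v) = c * cross2 d v.
Proof. by case: v => [a b]; rewrite /cross2 /=; ring. Qed.

Lemma cross2_decomp d v : d != 0 -> exists a : R,
  normc (v - a%:C * d) = `|cross2 d v| /\ normc (a%:C * d) <= normc v.
Proof.
move=> d0; have nd : 0 < normc d by rewrite normc_gt0.
have nd2 : normc d ^+ 2 != 0 by rewrite sqrf_eq0 gt_eqF.
pose p := complex.Re d * complex.Re v + complex.Im d * complex.Im v.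
pose q := complex.Re d * complex.Im v - complex.Im d * complex.Re v.
exists (p / normc d ^+ 2).
have vE : v - (p / normc d ^+ 2)%:C * d = (q / normc d ^+ 2)%:C * ('i%C * d).
  apply: (mulfI (_ : (normc d ^+ 2)%:C != 0)); first by apply: contra nd2 => /eqP[->].
  rewrite mulrBr !mulrA -!rmorphM /= ![normc d ^+ 2 * _]mulrC !divfK//.
  rewrite sqr_normcE /p /q; case: (d) (v) => [a b] [a' b'] /=.
  by apply/eqP; rewrite eq_complex /=; apply/andP; split; apply/eqP; ring.
split.
  rewrite vE normc_scale normcM (_ : normc 'i%C = 1) ?mul1r; last first.
    by rewrite /= expr0n expr1n add0r sqrtr1.
  rewrite /cross2 -/q !normrM !normfV normrX (ger0_norm (normc_ge0 d)).
  by field; rewrite gt_eqF.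
rewrite normc_scale normrM normfV (ger0_norm (sqr_ge0 (normc d))) mulrAC ler_pdivrMr ?exprn_gt0//.
rewrite expr2 mulrA ler_pM2r//.
rewrite -(@ler_pXn2r _ 2)// ?nnegrE ?mulr_ge0 ?normc_ge0//.
rewrite real_normK ?num_real// exprMn !sqr_normcE /p.
have := sqr_ge0 q; rewrite /q; lra.
Qed.

Variables (Cell : finType) (Gam : Cell -> set R[i]) (Rad : R).
Hypothesis Gam_bounded : forall q y, Gam q y -> normc y <= Rad.

(** Over a time h, the piece of an arc that is traversed in a parameter interval
   of length h is dragged along itself and along the velocity a * d + O(beta),
   so it stays in a strip of length O(h) and width O((beta + sg) h). There are
   about len / h such pieces. *)
Lemma arc_crossing q x (g : R -> R[i]) (s len sg G : R) (d : R[i]) :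
  Gam q = [set g t | t in `[s, s + len]] -> 0 < len -> 0 <= Rad ->
  (forall t t', s <= t <= s + len -> s <= t' <= s + len ->
     normc (g t - g t' - (t - t')%:C * d) <= sg / 4 * `|t - t'|) ->
  d != 0 -> normc d <= G -> 0 < sg -> sg <= 1 -> 16 * (G + 1) * len <= sg ->
  nv x <= 4 ->
  crossing kap Gam q x
    (8 * len * (2 * G + 21 * (1 + Rad)) * (`|cross2 d (vfield x (g s))| + sg)).
Proof.
move=> GamE len0 Rad0 gd d0 dG sg0 sg1 lensg x4 e e0.
have [a [ab ad]] := cross2_decomp (vfield x (g s)) d0.
set beta := `|cross2 d _| in ab *.
have G0 : 0 <= G by apply: le_trans dG; exact: normc_ge0.
have gsR : normc (g s) <= Rad.
  by apply: (@Gam_bounded q); rewrite GamE; exists s => //=; rewrite in_itv/= lexx lerDl ltW.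
have Vx : normc (vfield x (g s)) <= (1 + Rad) * 4.
  by apply: le_trans (vfield_le _ gsR) _; rewrite ler_wpM2l// addr_ge0.
have beta0 : 0 <= beta by exact: normr_ge0.
have nd : 0 < normc d by rewrite normc_gt0.
have betaV : beta <= (1 + Rad) * 4.
  apply: le_trans Vx; rewrite -[X in _ <= X](_ : Num.sqrt (normc (vfield x (g s)) ^+ 2) = _).
    2: by rewrite sqrtr_sqr ger0_norm ?normc_ge0.
  rewrite -(@ler_pXn2r _ 2)// ?nnegrE ?sqrtr_ge0// sqr_sqrtr ?sqr_ge0//.
  rewrite /beta real_normK ?num_real// /cross2 expr_div_n ler_pdivrMr ?exprn_gt0//.
  rewrite !sqr_normcE.
  have := sqr_ge0 (complex.Re d * complex.Re (vfield x (g s)) +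
                   complex.Im d * complex.Im (vfield x (g s))); lra.
pose rho := beta + sg.
have rho0 : 0 < rho by rewrite ltr_wpDl.
pose B := G + (1 + Rad) * 4.
have B0 : 0 <= B by rewrite addr_ge0// mulr_ge0// addr_ge0.
have RR : 0 < 1 + Rad by rewrite ltr_pwDl.
pose P := 4 * (8 * (10 * (1 + Rad))).
have P0 : 0 < P by rewrite /P !mulr_gt0.
pose r := Num.min (Num.min len 1) (Num.min (1 / 10) (sg / P)).
have r0 : 0 < r by rewrite !lt_min len0 ltr01 !divr_gt0.
have r1 : r <= len by rewrite !ge_min lexx.
have r2 : r <= 1 by rewrite !ge_min lexx ?orbT.
have r3 : r <= 1 / 10 by rewrite !ge_min lexx ?orbT.
have r4 : r * P <= sg by rewrite -ler_pdivlMr// !ge_min lexx ?orbT.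
exists r => // x' x'r h /andP[h0 hr].
exists (h * (sg / 4)); first by rewrite mulr_gt0// divr_gt0.
pose u := ((normc d)^-1)%:C * d.
have u1 : normc u = 1.
  by rewrite normc_scale ger0_norm ?invr_ge0 ?normc_ge0// mulVf// gt_eqF.
have dE : d = (normc d)%:C * u.
  by rewrite /u mulrA -rmorphM /= divff ?mul1r// gt_eqF.
pose m := (Num.truncn (len / h)).+1.
pose St (i : nat) := [set z : R[i] | exists2 w : R, `|w| <= h * B
   & normc (z - (g (Num.min (s + i%:R * h) (s + len)) + w%:C * u)) <= h * rho].
have covm : covered [set z | exists2 i, (i < m)%N & St i z]
    (m%:R * (4 * (h * rho) * (2 * (h * B) + h * rho))).
  have hr0 : 0 < h * rho by rewrite mulr_gt0.
  have hB0 : 0 <= h * B by rewrite mulr_ge0// ltW.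
  apply: covered_bigcup => [|i _]; last exact: covered_strip.
  by rewrite mulr_ge0 ?mulr_ge0 ?addr_ge0 ?mulr_ge0// ltW.
apply: covered_le _ _ covm; last first.
  have mh : m%:R * h <= 2 * len.
    rewrite /m -natr1 mulrDl mul1r.
    have : (Num.truncn (len / h))%:R <= len / h.
      by rewrite truncn_le divr_ge0// ltW.
    rewrite ler_pdivlMr// => H.
    by have := le_trans hr r1; lra.
  have -> : m%:R * (4 * (h * rho) * (2 * (h * B) + h * rho)) =
     (m%:R * h) * (4 * (h * rho) * (2 * B + rho)) by ring.
  have Q0 : 0 <= 4 * (h * rho) * (2 * B + rho).
    by rewrite !mulr_ge0 ?addr_ge0 ?mulr_ge0// ltW.
  apply: le_trans (ler_wpM2r Q0 mh) _.
  have rhoB : 2 * B + rho <= 2 * G + 21 * (1 + Rad).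
    have ar (b c k : R) : b <= c * 4 -> k <= 1 -> 0 < c -> 1 <= c ->
      2 * (G + c * 4) + (b + k) <= 2 * G + 21 * c by lra.
    by apply: ar => //; rewrite lerDl.
  have -> : 2 * len * (4 * (h * rho) * (2 * B + rho)) =
    h * (8 * len * (2 * B + rho) * rho) by ring.
  rewrite ler_pM2l//; apply: le_trans (_ : _ <= 8 * len * (2 * G + 21 * (1 + Rad)) * rho) _.
    rewrite ler_pM2r// ler_pM2l ?mulr_gt0//.
  by rewrite lerDl ltW.
move=> z [y [t [qy /andP[t0 t1] zy]]].
move: qy; rewrite GamE => -[v /=]; rewrite in_itv /= => /andP[v0 v1] vy.
have vs0 : 0 <= (v - s) / h by rewrite divr_ge0 ?subr_ge0// ltW.
pose i := Num.truncn ((v - s) / h); pose ti := s + i%:R * h.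
have /andP[i1 i2] := truncn_itv vs0.
rewrite -/i ler_pdivlMr// in i1; rewrite -/i ltr_pdivrMr// -natr1 in i2.
have tiv : ti <= v by rewrite /ti -lerBrDl.
have vti : v - ti <= h by rewrite /ti; lra.
have tih : 0 <= i%:R * h by rewrite mulr_ge0// ltW.
exists i; first by rewrite ltnS; apply: le_truncn; rewrite ler_pM2r ?invr_gt0//; lra.
rewrite /St /= -/ti (min_idPl (le_trans tiv v1)).
have th0 : 0 <= t * h by rewrite mulr_ge0// ltW.
have th : t * h <= h by rewrite ler_piMl// ltW.
have yR : normc y <= Rad by apply: (@Gam_bounded q); rewrite GamE; exists v => //=; rewrite in_itv/= v0.
exists ((v - ti + t * h * a) * normc d).
  rewrite normrM (ger0_norm (normc_ge0 d)).
  apply: (@le_trans _ _ ((h + h * `|a|) * normc d)).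
    rewrite ler_wpM2r ?normc_ge0//; apply: le_trans (ler_normD _ _) _.
    rewrite ger0_norm ?subr_ge0// lerD// normrM (ger0_norm th0) ler_wpM2r//.
  rewrite mulrDl -mulrA /B mulrDr lerD// ler_pM2l//.
  by rewrite -normc_scale; apply: le_trans Vx.
have -> : ((v - ti + t * h * a) * normc d)%:C * u = (v - ti + t * h * a)%:C * d.
  by rewrite realCM -dE.
pose X := scale3 t (scale3 h x').
have x'5 : nv x' <= 5.
  have := nvD (x' - x) x; rewrite subrK => /le_trans; apply.
  have := ltW x'r; lra.
have nvX : nv X <= h * 5.
  rewrite /X scale3A nv_scale ger0_norm//.
  apply: le_trans (_ : _ <= h * nv x') _; first by rewrite ler_wpM2r ?nv_ge0.
  by rewrite ler_pM2l.
have nvX2 : nv X <= 1 / 2 by apply: le_trans nvX _; have := le_trans hr r3; lra.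
have E1 : normc (flow kap X y - y - (t * h)%:C * vfield x' y) <= h * (75 * (1 + Rad) * r).
  have -> : (t * h)%:C * vfield x' y = kap * (X.2%:C * y - X.1).
    by rewrite -vfield_scale /X scale3A.
  apply: le_trans (flow_taylor kap1 y nvX2) _.
  apply: le_trans (_ : _ <= 3 * (1 + Rad) * (h * 5 * (r * 5))) _; last by lra.
  apply: ler_pM; rewrite ?mulr_ge0 ?addr_ge0 ?normc_ge0 ?sqr_ge0//.
    by rewrite ler_pM2l// lerD2l.
  rewrite expr2; apply: ler_pM; rewrite ?nv_ge0//; apply: le_trans nvX _.
  by rewrite ler_pM2r.
have E2 : normc (vfield (x' - x) y) <= (1 + Rad) * r.
  by apply: le_trans (vfield_le _ yR) _; rewrite ler_pM2l// ltW.
have E3 : normc (vfield x y - vfield x (g s)) <= sg / 4.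
  have -> : vfield x y - vfield x (g s) = kap * (x.2%:C * (y - g s)).
    by rewrite /vfield; ring.
  rewrite normcM kap1 mul1r normc_scale.
  have ys : normc (y - g s) <= (G + 1) * len.
    have sI : s <= s <= s + len by rewrite lexx lerDl ltW.
    have vI : s <= v <= s + len by rewrite v0.
    have := gd v s vI sI; rewrite vy => H.
    have := ler_normcD (y - g s - (v - s)%:C * d) ((v - s)%:C * d).
    rewrite subrK normc_scale ger0_norm ?subr_ge0// in H * => /le_trans; apply.
    have vsl : v - s <= len by lra.
    have : (v - s) * normc d <= len * G by apply: ler_pM; rewrite ?subr_ge0 ?normc_ge0.
    have : sg / 4 * (v - s) <= 1 * len.
      by apply: ler_pM; rewrite ?subr_ge0 ?divr_ge0 ?(ltW sg0)//; lra.
    lra.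
  apply: le_trans (_ : _ <= 4 * ((G + 1) * len)) _; last by lra.
  by apply: ler_pM; rewrite ?normc_ge0//; exact: le_trans (nv2_le _) x4.
have E4 : normc (y - g ti - (v - ti)%:C * d) <= h * (sg / 4).
  have tI : s <= ti <= s + len by rewrite lerDl tih; exact: le_trans tiv v1.
  have vI : s <= v <= s + len by rewrite v0.
  have := gd v ti vI tI; rewrite vy => /le_trans; apply.
  by rewrite ger0_norm ?subr_ge0// mulrC ler_wpM2r// divr_ge0// ltW.
have -> : z - (g ti + (v - ti + t * h * a)%:C * d) =
  (z - flow kap X y) + (flow kap X y - y - (t * h)%:C * vfield x' y)
  + (t * h)%:C * (vfield (x' - x) y + (vfield x y - vfield x (g s))
                  + (vfield x (g s) - a%:C * d))
  + (y - g ti - (v - ti)%:C * d).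
  have -> : vfield (x' - x) y = vfield x' y - vfield x y.
    by rewrite /vfield /= rmorphB /=; ring.
  by rewrite rmorphD !rmorphM /=; ring.
apply: le_trans (ler_normcD _ _) _.
apply: le_trans (lerD (ler_normcD _ _) (lexx _)) _.
apply: le_trans (lerD (lerD (ler_normcD _ _) (lexx _)) (lexx _)) _.
have E5 : normc ((t * h)%:C * (vfield (x' - x) y + (vfield x y - vfield x (g s))
                  + (vfield x (g s) - a%:C * d))) <= h * ((1 + Rad) * r + sg / 4 + beta).
  rewrite normc_scale (ger0_norm th0); apply: ler_pM; rewrite ?normc_ge0//.
  apply: le_trans (ler_normcD _ _) _; rewrite -ab lerD//.
  by apply: le_trans (ler_normcD _ _) _; rewrite lerD.
apply: le_trans (lerD (lerD (lerD zy E1) E5) E4) _.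
move: r4; rewrite /P -!mulrDr ler_pM2l// /rho; lra.
Qed.

End ArcCrossing.

(** * The projective plane *)

Section Projective.
Variable R : realType.
Implicit Types (u v w n x : vec3 R).

Lemma val_to_P2 v (d : nzvec3 R) : v != 0 -> val (insubd d v) = v.
Proof. by move=> v0; rewrite insubdK. Qed.

Lemma to_P2_scale c v : c != 0 -> v != 0 -> to_P2 (scale3 c v) = to_P2 v.
Proof.
move=> c0 v0; apply/eqmodP; apply/asboolP; exists c => //.
by rewrite !val_to_P2// scale3_eq0 negb_or c0.
Qed.

Lemma to_P2_eq u v : u != 0 -> v != 0 -> to_P2 u = to_P2 v ->
  exists2 c, c != 0 & u = scale3 c v.
Proof.
move=> u0 v0 /eqmodP/asboolP[c c0]; rewrite !val_to_P2// => ->.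
by exists c.
Qed.

Lemma dot3_ge0 v : 0 <= dot3 v v.
Proof. by rewrite /dot3 -!expr2 !addr_ge0// sqr_ge0. Qed.

Lemma dot3_gt0 v : v != 0 -> 0 < dot3 v v.
Proof.
move=> v0; rewrite lt_def dot3_ge0 andbT; apply: contra v0.
rewrite /dot3 -!expr2 !paddr_eq0 ?addr_ge0 ?sqr_ge0// !sqrf_eq0.
by case: v => [[a b] c] /= /andP[/andP[/eqP -> /eqP ->] /eqP ->].
Qed.

Lemma dot3_CS u v : dot3 u v ^+ 2 <= dot3 u u * dot3 v v.
Proof.
case: u v => [[a b] c] [[a' b'] c']; rewrite /dot3 /=.
have := sqr_ge0 (a * b' - b * a'); have := sqr_ge0 (a * c' - c * a').
have := sqr_ge0 (b * c' - c * b'); lra.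
Qed.

Lemma dot3_CS1 u v : dot3 u u = 1 -> dot3 v v = 1 -> -1 <= dot3 u v <= 1.
Proof.
move=> u1 v1; rewrite -ler_norml -(@ler_pXn2r _ 2)// ?nnegrE//.
by rewrite real_normK ?num_real// expr1n; have := dot3_CS u v; rewrite u1 v1 mulr1.
Qed.

Lemma dist_P2_le u v : dot3 u u = 1 -> dot3 v v = 1 ->
  dist_P2 (to_P2 u) (to_P2 v) <= acos (dot3 u v).
Proof.
move=> u1 v1; apply: ge_inf; last by exists u, v.
by exists 0 => _ [u' [v' [u1' v1' _ _ ->]]]; apply: acos_ge0; exact: dot3_CS1.
Qed.

Definition unit3 v : vec3 R := scale3 (Num.sqrt (dot3 v v))^-1 v.

Lemma sqrt_dot3 v : v != 0 -> (Num.sqrt (dot3 v v))^-1 != 0.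
Proof. by move=> v0; rewrite invr_eq0 gt_eqF// sqrtr_gt0 dot3_gt0. Qed.

Lemma dot3_unit3 v : v != 0 -> dot3 (unit3 v) (unit3 v) = 1.
Proof.
move=> v0; rewrite /unit3 dot3Zr dot3C dot3Zr mulrA -expr2 exprVn sqr_sqrtr ?dot3_ge0//.
by rewrite mulVf// gt_eqF// dot3_gt0.
Qed.

Lemma acos_lt (x t : R) : 0 < t < 1 -> cos t < x -> x <= 1 -> acos x < t.
Proof.
move=> /andP[t0 t1] cx x1.
have tpi : t <= pi.
  by apply: le_trans (ltW t1) _; apply: le_trans (@pi_ge2 R); rewrite ler1n.
have x1' : -1 <= x by rewrite (le_trans _ (ltW cx))// cos_geN1.
have a0 : 0 <= acos x by rewrite acos_ge0// x1'.
have api : acos x <= pi by rewrite acos_lepi// x1'.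
rewrite -ltr_cos ?in_itv/= ?a0 ?(ltW t0)//.
by rewrite acosK// in_itv/= x1'.
Qed.

Lemma cos_gt0_small (t : R) : 0 < t < 1 -> 0 < cos t.
Proof.
move=> /andP[t0 t1]; apply: cos_gt0_pihalf; apply/andP; split.
  by rewrite (lt_trans _ t0)// oppr_lt0 divr_gt0// pi_gt0.
by apply: lt_le_trans t1 _; exact: pihalf_ge1.
Qed.

Lemma sin_gt0_small (t : R) : 0 < t < 1 -> 0 < sin t.
Proof.
move=> /andP[t0 t1]; apply: sin_gt0_pihalf; rewrite t0/=.
by apply: lt_le_trans t1 _; exact: pihalf_ge1.
Qed.

Lemma to_P2N v : v != 0 -> to_P2 (- v) = to_P2 v.
Proof.
move=> v0; rewrite -(to_P2_scale (_ : -1 != 0) v0) ?oppr_eq0 ?oner_eq0//.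
by case: v v0 => a b _; rewrite /scale3 /= rmorphN1 !mulN1r.
Qed.

(** The hypothesis says that the angle between the lines spanned by u and v is
   less than t. *)
Lemma dist_P2_lt u v (t : R) : u != 0 -> v != 0 -> 0 < t < 1 ->
  cos t ^+ 2 * (dot3 u u * dot3 v v) < dot3 u v ^+ 2 ->
  dist_P2 (to_P2 u) (to_P2 v) < t.
Proof.
move=> + + t01; have c0 := cos_gt0_small t01.
wlog uv0 : v / 0 <= dot3 u v => [wlg u0 v0 H|u0 v0 H].
  have [uv0|/ltW uv0] := leP 0 (dot3 u v); first exact: wlg.
  rewrite -(to_P2N v0); apply: wlg; rewrite ?oppr_eq0//.
    by rewrite dot3Nr oppr_ge0.
  by rewrite !dot3Nr (dot3C (- v)) dot3Nr opprK sqrrN.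
rewrite -(to_P2_scale (sqrt_dot3 u0) u0) -(to_P2_scale (sqrt_dot3 v0) v0).
rewrite -/(unit3 u) -/(unit3 v).
have nu := dot3_unit3 u0; have nv := dot3_unit3 v0.
apply: le_lt_trans (dist_P2_le nu nv) _; apply: acos_lt => //; last first.
  by have /andP[] := dot3_CS1 nu nv.
have su : 0 < Num.sqrt (dot3 u u) by rewrite sqrtr_gt0 dot3_gt0.
have sv : 0 < Num.sqrt (dot3 v v) by rewrite sqrtr_gt0 dot3_gt0.
rewrite /unit3 dot3Zr dot3C dot3Zr (dot3C v) mulrA mulrC.
rewrite -invfM ltr_pdivlMr ?mulr_gt0//.
rewrite -(@ltr_pXn2r _ 2)// ?nnegrE// ?mulr_ge0 ?sqrtr_ge0 ?(ltW c0)//.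
by rewrite !exprMn !sqr_sqrtr ?dot3_ge0// (mulrC (dot3 v v)).
Qed.

Lemma line_through_mem (y d : R[i]) v (r : R) : v != 0 -> d != 0 ->
  v.2%:C * y - v.1 = r%:C * d -> line_through y d (to_P2 v).
Proof.
move=> v0 d0 H; have vE : v.1 = v.2%:C * y - r%:C * d by rewrite -H; ring.
have [v20|v20] := eqVneq v.2 0.
  right; rewrite v20 mul0r sub0r in vE.
  have vE' : v = scale3 (- r) (d, 0).
    rewrite [LHS]surjective_pairing vE v20 /scale3 /= mulr0; congr pair.
    by rewrite rmorphN mulNr.
  have r0 : - r != 0 by apply: contra v0 => /eqP r0; rewrite vE' r0 scale3_0.
  by rewrite vE' to_P2_scale// ; apply: contra d0 => /eqP[->].
left; exists (- (r / v.2)) => //.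
have w0 : (y + (- (r / v.2))%:C * d, 1) != 0 :> vec3 R.
  by apply/negP => /eqP[_ /eqP]; rewrite oner_eq0.
rewrite -(to_P2_scale v20 w0); congr to_P2.
rewrite [RHS]surjective_pairing vE /scale3 /= mulr1; congr pair.
by rewrite mulrDr -realCM mulrN mulrCA divff// mulr1 rmorphN mulNr.
Qed.

(** f2 is the vector product of n and f1; a Gram determinant expresses dot3 w w
   through the coordinates of w, so w vanishes if they do. *)
Lemma plane_basis n : dot3 n n = 1 -> exists f1 f2 : vec3 R,
  [/\ dot3 n f1 = 0 /\ dot3 n f2 = 0, dot3 f1 f1 = 1, dot3 f2 f2 = 1, dot3 f1 f2 = 0
    & forall v, dot3 n v = 0 -> v = scale3 (dot3 f1 v) f1 + scale3 (dot3 f2 v) f2].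
Proof.
move=> n1; have [f1 nf1 f11] : exists2 f1, dot3 n f1 = 0 & dot3 f1 f1 = 1.
  have [f nf f0] : exists2 f, dot3 n f = 0 & f != 0.
    have [nz|nz] := eqVneq n.1 0.
      exists (1, 0); first by rewrite /dot3 nz /=; ring.
      by apply/negP => /eqP/(congr1 fst)/eqP; rewrite oner_eq0.
    exists ('i%C * n.1, 0); first by case: (n) => [[a b] c]; rewrite /dot3 /=; ring.
    apply: contra nz => /eqP/(congr1 fst)/eqP; rewrite mulf_eq0 => /orP[|//].
    by move=> /eqP[] /eqP; rewrite oner_eq0.
  exists (unit3 f); last exact: dot3_unit3.
  by rewrite dot3Zr nf mulr0.
pose f2 : vec3 R := ((complex.Im n.1 * f1.2 - n.2 * complex.Im f1.1)
  +i* (n.2 * complex.Re f1.1 - complex.Re n.1 * f1.2),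
  complex.Re n.1 * complex.Im f1.1 - complex.Im n.1 * complex.Re f1.1).
have gram w : dot3 w w * (dot3 n n * dot3 f1 f1 - dot3 n f1 ^+ 2) =
    dot3 f2 w ^+ 2 + dot3 n n * dot3 f1 w ^+ 2
    - 2 * dot3 n f1 * dot3 n w * dot3 f1 w + dot3 f1 f1 * dot3 n w ^+ 2.
  by rewrite /f2; case: (n) (f1) (w) => [[a b] c] [[a' b'] c'] [[x y] z]; rewrite /dot3 /=; ring.
have nf2 : dot3 n f2 = 0.
  by rewrite /f2; case: (n) (f1) => [[a b] c] [[a' b'] c']; rewrite /dot3 /=; ring.
have f12 : dot3 f1 f2 = 0.
  by rewrite /f2; case: (n) (f1) => [[a b] c] [[a' b'] c']; rewrite /dot3 /=; ring.
have f22 : dot3 f2 f2 = 1.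
  transitivity (dot3 n n * dot3 f1 f1 - dot3 n f1 ^+ 2).
    by rewrite /f2; case: (n) (f1) => [[a b] c] [[a' b'] c']; rewrite /dot3 /=; ring.
  by rewrite n1 f11 nf1; ring.
exists f1, f2; split=> // v nv.
apply/eqP; rewrite -subr_eq0; set w := v - _.
apply: contraT => /dot3_gt0; have := gram w.
have -> : dot3 n w = 0 by rewrite dot3Dr dot3Nr dot3Dr !dot3Zr nf1 nf2 nv; ring.
have -> : dot3 f1 w = 0 by rewrite dot3Dr dot3Nr dot3Dr !dot3Zr f11 f12; ring.
have -> : dot3 f2 w = 0 by rewrite dot3Dr dot3Nr dot3Dr !dot3Zr f22 (dot3C f2 f1) f12; ring.
rewrite n1 f11 nf1 => H; rewrite (_ : dot3 w w = 0) ?ltxx//.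
by move: H; rewrite !expr0n /= !mulr0 !mulr1 !addr0 !subr0 mulr1.
Qed.

Lemma nv_sqr_le v : nv v ^+ 2 <= 2 * dot3 v v.
Proof.
have -> : dot3 v v = normc v.1 ^+ 2 + `|v.2| ^+ 2.
  by rewrite sqr_normcE real_normK ?num_real// /dot3 -!expr2.
have := sqr_ge0 (normc v.1 - `|v.2|); rewrite /nv; nra.
Qed.

(** A vector close to the plane orthogonal to n is close, as a point of the
   projective plane, to its orthogonal projection. *)
Lemma near_plane_dist n v (t : R) : dot3 n n = 1 -> 0 < t < 1 -> v != 0 ->
  `|dot3 n v| <= sin t / 2 * nv v ->
  exists q, [/\ q != 0, dot3 n q = 0 & dist_P2 (to_P2 q) (to_P2 v) < t].
Proof.
move=> n1 t01 v0 nvv; set q := v - scale3 (dot3 n v) n.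
have st := sin_gt0_small t01.
have vv : 0 < dot3 v v by exact: dot3_gt0.
have nv2 : dot3 n v ^+ 2 <= sin t ^+ 2 / 2 * dot3 v v.
  rewrite -real_normK ?num_real//.
  apply: (@le_trans _ _ ((sin t / 2 * nv v) ^+ 2)).
    by rewrite lerXn2r ?nnegrE ?mulr_ge0 ?nv_ge0 ?(ltW st).
  rewrite exprMn; apply: le_trans (_ : _ <= (sin t / 2) ^+ 2 * (2 * dot3 v v)) _.
    by rewrite ler_wpM2l ?sqr_ge0// nv_sqr_le.
  rewrite exprMn; lra.
have vq : dot3 q v = dot3 v v - dot3 n v ^+ 2.
  by rewrite dot3C dot3Dr dot3Nr dot3Zr (dot3C v n) expr2.
have nq : dot3 n q = 0 by rewrite dot3Dr dot3Nr dot3Zr n1; ring.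
have qq : dot3 q q = dot3 v v - dot3 n v ^+ 2.
  by rewrite {2}/q dot3Dr dot3Nr dot3Zr vq (dot3C q) nq; ring.
have s1 : sin t ^+ 2 <= 1.
  by have := cos2Dsin2 t; have := sqr_ge0 (cos t); lra.
have s0 : 0 < sin t ^+ 2 by rewrite exprn_gt0.
have sv : sin t ^+ 2 * dot3 v v <= 1 * dot3 v v by rewrite ler_wpM2r// ltW.
have qq0 : 0 < dot3 q q by rewrite qq; lra.
have q0 : q != 0.
  by apply: contraTN qq0 => /eqP ->; rewrite /dot3 /= !mul0r !addr0 ltxx.
exists q; split=> //; apply: dist_P2_lt => //.
rewrite vq -qq [X in _ < X]expr2 mulrCA ltr_pM2l// qq cos2sin2.
have : 0 < sin t ^+ 2 * dot3 v v by rewrite mulr_gt0.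
lra.
Qed.

End Projective.

(** * One-dimensional Hausdorff measure as a metric outer measure *)

(** Outer measures are generated from coverings by measurable sets, whereas
   Hausdorff measure admits coverings by arbitrary sets: here all of them are
   declared measurable. *)
Definition discrete_plane (R : realType) : Type := R[i].

HB.instance Definition _ (R : realType) := Choice.on (discrete_plane R).
HB.instance Definition _ (R : realType) := isPointed.Build (discrete_plane R) (0 : R[i]).
HB.instance Definition _ (R : realType) :=
  @isMeasurable.Build default_measure_display (discrete_plane R)
    (@discrete_measurable (discrete_plane R))
    (@discrete_measurable0 _) (@discrete_measurableC _) (@discrete_measurableU _).

Section Hausdorff.
Local Open Scope ereal_scope.
Variable R : realType.
Implicit Types (A B U X G : set R[i]) (delta : R).

Lemma diam_ge0 U : 0 <= diam U.
Proof. by rewrite /diam le_max lexx. Qed.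

Lemma diam_ub U x y : U x -> U y -> (normc (x - y))%:E <= diam U.
Proof.
move=> Ux Uy; rewrite /diam le_max; apply/orP; right.
by apply: ereal_sup_ubound; exists x, y.
Qed.

Lemma diam_le U (b : \bar R) : 0 <= b ->
  (forall x y, U x -> U y -> (normc (x - y))%:E <= b) -> diam U <= b.
Proof.
move=> b0 H; rewrite /diam ge_max b0/=.
by apply: ge_ereal_sup => _ [x [y [Ux Uy ->]]]; exact: H.
Qed.

Lemma diam0 : diam (@set0 R[i]) = 0.
Proof.
by apply/eqP; rewrite eq_le diam_ge0 andbT; apply: diam_le => // x y [].
Qed.

Lemma diam_sub A B : A `<=` B -> diam A <= diam B.
Proof.
by move=> AB; apply: diam_le (diam_ge0 _) _ => x y /AB Ax /AB Ay; exact: diam_ub.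
Qed.

(** Sets larger than delta are priced out, so that hausdorff1_delta becomes an
   outer measure generated by a set function on all sets. *)
Definition diam_cap delta (U : set (discrete_plane R)) : \bar R :=
  if diam U <= delta%:E then diam U else +oo.

Lemma hausdorff1_deltaE delta A : (0 < delta)%R ->
  hausdorff1_delta delta A = mu_ext (@diam_cap delta) A.
Proof.
move=> d0; have cap0 U : 0 <= diam_cap delta U.
  by rewrite /diam_cap; case: ifP => // _; exact: diam_ge0.
apply/eqP; rewrite eq_le; apply/andP; split.
  apply: le_ereal_inf_tmp => _ [U [mU AU] <-].
  have [[k Uk]|Ud] := pselect (exists k, ~ (diam (U k) <= delta%:E)).
    rewrite (@eseries_pinfty _ _ xpredT k) ?leey//.
      by move=> n _; rewrite gt_eqF// (lt_le_trans _ (cap0 _))// ltNy0.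
    by rewrite /diam_cap; case: ifP Uk.
  have {}Ud k : diam (U k) <= delta%:E.
    by apply: contrapT => H; apply: Ud; exists k.
  apply: ereal_inf_lbound; exists U; split => //.
  by apply: eq_eseriesr => k _; rewrite /diam_cap Ud.
apply: le_ereal_inf_tmp => _ [U [AU Ud ->]].
apply: ereal_inf_lbound; exists U.
  by split.
by apply: eq_eseriesr => k _; rewrite /diam_cap Ud.
Qed.

Lemma hausdorff1_delta_ge0 delta A : 0 <= hausdorff1_delta delta A.
Proof.
apply: le_ereal_inf_tmp => _ [U [_ _ ->]].
by apply: nneseries_ge0 => k _ _; exact: diam_ge0.
Qed.

Lemma hausdorff1_delta_le delta A : (0 < delta)%R ->
  hausdorff1_delta delta A <= hausdorff1 A.
Proof. by move=> d0; apply: ereal_sup_ubound; exists delta. Qed.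

Lemma hausdorff1_ge0 A : 0 <= hausdorff1 A.
Proof.
exact: le_trans (hausdorff1_delta_ge0 1 A) (hausdorff1_delta_le _ ltr01).
Qed.

Lemma hausdorff1_sub A B : A `<=` B -> hausdorff1 A <= hausdorff1 B.
Proof.
move=> AB; apply: ge_ereal_sup => _ [d d0 <-].
apply: le_trans (hausdorff1_delta_le B d0).
by apply: ereal_inf_le_tmp => _ [U [BU Ud ->]]; exists U; split => //; exact: subset_trans BU.
Qed.

Lemma diam_cap0 delta : (0 < delta)%R -> diam_cap delta set0 = 0.
Proof. by move=> d0; rewrite /diam_cap diam0 lee_fin ltW. Qed.

Lemma diam_cap_ge0 delta (U : set (discrete_plane R)) : 0 <= diam_cap delta U.
Proof. by rewrite /diam_cap; case: ifP => // _; exact: diam_ge0. Qed.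

Lemma hausdorff1_set0 : hausdorff1 (@set0 R[i]) = 0.
Proof.
apply/eqP; rewrite eq_le hausdorff1_ge0 andbT.
apply: ge_ereal_sup => _ [d d0 <-]; rewrite hausdorff1_deltaE// mu_ext0//.
- exact: diam_cap0.
- exact: diam_cap_ge0.
Qed.

Lemma hausdorff1_sigma_subadditive : sigma_subadditive (@hausdorff1 R).
Proof.
move=> F; apply: ge_ereal_sup => _ [d d0 <-]; rewrite hausdorff1_deltaE//.
have H := mu_ext_sigma_subadditive (@diam_cap_ge0 d) F.
apply: (le_trans H).
apply: lee_nneseries => [i _ _|i _]; first exact: mu_ext_ge0 (@diam_cap_ge0 d) _.
by rewrite -hausdorff1_deltaE//; exact: hausdorff1_delta_le.
Qed.

HB.instance Definition _ := isOuterMeasure.Build R R[i] (@hausdorff1 R)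
  hausdorff1_set0 hausdorff1_ge0 hausdorff1_sub hausdorff1_sigma_subadditive.

Lemma hausdorff1_separated A B (d0 : R) : (0 < d0)%R ->
  (forall x y, A x -> B y -> d0 <= normc (x - y))%R ->
  hausdorff1 A + hausdorff1 B <= hausdorff1 (A `|` B).
Proof.
move=> d00 sep.
have mono (d d' : R) C : (0 < d <= d')%R ->
    hausdorff1_delta d' C <= hausdorff1_delta d C.
  move=> /andP[_ dd]; apply: ereal_inf_le_tmp => _ [U [CU Ud ->]].
  by exists U; split => // k; apply: le_trans (Ud k) _; rewrite lee_fin.
have key (d : R) : (0 < d)%R -> hausdorff1_delta d A + hausdorff1_delta d B
    <= hausdorff1 (A `|` B).
  move=> dp; pose e := Num.min d (d0 / 2)%R.
  have e0 : (0 < e)%R by rewrite lt_min dp divr_gt0.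
  have ed : (0 < e <= d)%R by rewrite e0 ge_min lexx.
  have ed0 : (e < d0)%R.
    by rewrite gt_min; apply/orP; right; rewrite ltr_pdivrMr// ltr_pMr// ltr1n.
  apply: le_trans (leeD (mono _ _ A ed) (mono _ _ B ed)) _.
  apply: le_trans (hausdorff1_delta_le _ e0).
  apply: le_ereal_inf_tmp => _ [U [ABU Ud ->]].
  have HA : hausdorff1_delta e A <= \sum_(0 <= k <oo) diam (U k `&` A).
    apply: ereal_inf_lbound; exists (fun k => U k `&` A); split => //.
      by move=> x Ax; have [k _ Ukx] := ABU x (or_introl Ax); exists k.
    by move=> k; apply: le_trans (Ud k); apply: diam_sub; exact: subIsetl.
  have HB : hausdorff1_delta e B <= \sum_(0 <= k <oo) diam (U k `&` B).
    apply: ereal_inf_lbound; exists (fun k => U k `&` B); split => //.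
      by move=> x Ax; have [k _ Ukx] := ABU x (or_intror Ax); exists k.
    by move=> k; apply: le_trans (Ud k); apply: diam_sub; exact: subIsetl.
  apply: le_trans (leeD HA HB) _; rewrite -nneseriesD => [|? _ _|? _ _]; try exact: diam_ge0.
  apply: lee_nneseries => [k _ _|k _]; first by rewrite adde_ge0// diam_ge0.
  have [[x [Ux Ax]]|nA] := pselect (exists x, U k x /\ A x).
    rewrite (_ : U k `&` B = set0).
      by rewrite diam0 adde0; apply: diam_sub; exact: subIsetl.
    rewrite -subset0 => y [Uy By] /=.
    have := le_trans (diam_ub Ux Uy) (Ud k); rewrite lee_fin.
    by move=> /le_lt_trans/(_ ed0); rewrite ltNge sep.
  rewrite (_ : U k `&` A = set0).
    by rewrite diam0 add0e; apply: diam_sub; exact: subIsetl.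
  by rewrite -subset0 => y [Uy Ay]; apply: nA; exists y.
have [ABoo|] := eqVneq (hausdorff1 (A `|` B)) +oo; first by rewrite ABoo leey.
rewrite -ltey => ABoo.
have Aoo : hausdorff1 A \is a fin_num.
  by rewrite ge0_fin_numE ?hausdorff1_ge0// (le_lt_trans _ ABoo)// hausdorff1_sub.
rewrite -leeBrDl//; apply: ge_ereal_sup => _ [d dp <-].
have Boo : hausdorff1_delta d B \is a fin_num.
  rewrite ge0_fin_numE ?hausdorff1_delta_ge0// (le_lt_trans _ ABoo)//.
  by rewrite (le_trans (hausdorff1_delta_le _ dp))// hausdorff1_sub.
rewrite leeBrDl// -leeBrDr//; apply: ge_ereal_sup => _ [d' d'p <-].
rewrite leeBrDr//; pose e := Num.min d d'.
have e0 : (0 < e)%R by rewrite lt_min dp.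
apply: le_trans (key e e0); apply: leeD; apply: mono; rewrite e0 ge_min lexx//.
by rewrite orbT.
Qed.

Lemma nneseries_tail_lt (f : nat -> \bar R) (e : R) : (forall k, 0 <= f k) ->
  \sum_(0 <= k <oo) f k < +oo -> (0 < e)%R ->
  exists N, \sum_(N <= k <oo) f k < e%:E.
Proof.
move=> f0 foo e0.
have H := @nneseries_tail_cvg R f xpredT foo (fun k _ => f0 k).
have /H [N _ HN] : nbhs (0 : \bar R) [set y | y < e%:E].
  by apply: open_nbhs_nbhs; split; [exact: open_ereal_lt_ereal|rewrite /= lte_fin].
by exists N; exact: HN (leqnn N).
Qed.

Lemma hausdorff1_le_tail A B (D : nat -> set R[i]) N :
  A `<=` B `|` \bigcup_(k in [set k | (N <= k)%N]) D k ->
  hausdorff1 A <= hausdorff1 B + \sum_(N <= k <oo) hausdorff1 (D k).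
Proof.
move=> AB; pose D' k := if k is k'.+1 then D (k' + N)%N else B.
apply: (@le_trans _ _ (\sum_(0 <= k <oo) hausdorff1 (D' k))).
  apply: le_trans (hausdorff1_sigma_subadditive D'); apply: hausdorff1_sub.
  move=> x /AB[Bx|[k /= Nk Dx]]; first by exists 0%N.
  by exists (k - N).+1 => //=; rewrite subnK.
rewrite nneseries_recl//; last by move=> k _; exact: hausdorff1_ge0.
apply: leeD => //.
rewrite -(nneseries_addn 1) => [|k]; last exact: hausdorff1_ge0.
rewrite -(nneseries_addn N) => [|k]; last exact: hausdorff1_ge0.
by apply: lee_nneseries => [k _ _|k _]; [exact: hausdorff1_ge0|rewrite addn1].
Qed.

Definition closed_plane G := forall x, ~ G x ->
  exists2 r : R, (0 < r)%R & forall y, G y -> (r <= normc (x - y))%R.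

(** The shells at distance between 1 / (k + 2) and 1 / (k + 1) from G are, for k
   of a fixed parity, pairwise at positive distance. So their measures sum up
   to at most twice that of X, and those close to G contribute little. *)
Lemma closed_plane_caratheodory G : closed_plane G ->
  caratheodory_measurable (@hausdorff1 R) G.
Proof.
move=> Gcl; apply: le_caratheodory_measurable => X /=.
have [->|] := eqVneq (hausdorff1 X) +oo; first by rewrite leey.
rewrite -ltey => Xoo.
pose F k := X `&` [set x | forall y, G y -> (k.+1%:R^-1 <= normc (x - y))%R].
pose Sh k := F k.+1 `\` F k.
have inv_lt (i j : nat) : (i < j)%N -> (j.+1%:R^-1 < i.+1%:R^-1 :> R)%R.
  by move=> ij; rewrite ltf_pV2 ?posrE// ltr_nat.
have inv_le (i j : nat) : (i <= j)%N -> (j.+1%:R^-1 <= i.+1%:R^-1 :> R)%R.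
  by move=> ij; rewrite lef_pV2 ?posrE// ler_nat.
have FS i j : (i <= j)%N -> F i `<=` F j.
  by move=> ij x [Xx Fx]; split => // y Gy; exact: le_trans (inv_le _ _ ij) (Fx y Gy).
have ShX k : Sh k `<=` X by move=> x [[]].
have parity b K : hausdorff1 (\big[setU/set0]_(k < K) Sh (k.*2 + b)%N) >=
    \sum_(k < K) hausdorff1 (Sh (k.*2 + b)%N).
  elim: K => [|K IH]; first by rewrite !big_ord0 hausdorff1_ge0.
  rewrite !big_ord_recr /=.
  apply: le_trans (leeD IH (lexx _)) _.
  case: K {IH} => [|K]; first by rewrite big_ord0 hausdorff1_set0 add0e set0U.
  pose j := (K.*2 + b)%N.
  apply: (hausdorff1_separated (d0 := j.+2%:R^-1 - j.+3%:R^-1)%R).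
    by rewrite subr_gt0 inv_lt.
  move=> x y Hx [[Xy _] nFy].
  have [Xx Fx] : F j.+1 x.
    move: Hx; rewrite -(bigcup_mkord _ (fun k => Sh (k.*2 + b)%N)).
    move=> [k /= kK [Fx _]].
    have kj : ((k.*2 + b).+1 <= j.+1)%N by rewrite ltnS leq_add2r leq_double -ltnS.
    exact: (FS _ _ kj _ Fx).
  have [z [Gz yz]] : exists z, G z /\ (normc (y - z) < j.+3%:R^-1)%R.
    apply: contrapT => H; apply: nFy; split => // z Gz.
    rewrite doubleS -/j; apply: contrapT => /negP; rewrite -ltNge => yz.
    by apply: H; exists z.
  have := Fx z Gz => xz.
  have := ler_normc_dist x y z.
  rewrite lerBlDr; move=> /(le_trans xz) => H; apply: le_trans H _.
  by rewrite lerD2l ltW.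
have parityX b K : \sum_(k < K) hausdorff1 (Sh (k.*2 + b)%N) <= hausdorff1 X.
  apply: le_trans (parity b K) _; apply: hausdorff1_sub.
  by move=> x; rewrite -(bigcup_mkord _ (fun k => Sh (k.*2 + b)%N)) => -[k _ /ShX].
have split2 K : \sum_(0 <= k < K.*2) hausdorff1 (Sh k) <= hausdorff1 X + hausdorff1 X.
  apply: le_trans (leeD (parityX 0%N K) (parityX 1%N K)).
  rewrite -big_split /= big_mkord.
  elim: K => [|K IH]; first by rewrite !big_ord0.
  by rewrite doubleS !big_ord_recr /= addn0 addn1 -addeA leeD.
have tail : \sum_(0 <= k <oo) hausdorff1 (Sh k) < +oo.
  apply: (@le_lt_trans _ _ (hausdorff1 X + hausdorff1 X)); last exact: lte_add_pinfty.
  apply: lime_le; first by apply: is_cvg_nneseries => k _ _; exact: hausdorff1_ge0.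
  apply: nearW => K; apply: le_trans (split2 K).
  apply: (@lee_sum_nneg_natr _ (fun k => hausdorff1 (Sh k)) xpredT 0%N).
    by move=> k _ _; exact: hausdorff1_ge0.
  by rewrite -addnn leq_addr.
apply/lee_addgt0Pr => e e0.
have [N HN] := nneseries_tail_lt (fun k => hausdorff1_ge0 (Sh k)) tail e0.
have HG : hausdorff1 (X `&` G) + hausdorff1 (F N) <= hausdorff1 X.
  apply: le_trans (hausdorff1_separated (d0 := N.+1%:R^-1) _ _) _ => //.
    by move=> x y [_ Gx] [_ Fy]; rewrite normcBC; exact: Fy.
  by apply: hausdorff1_sub => x [[]|[]].
have HC : hausdorff1 (X `&` ~` G) <= hausdorff1 (F N) + e%:E.
  apply: le_trans (leeD (lexx _) (ltW HN)).
  apply: hausdorff1_le_tail => x [Xx /Gcl[r r0 Gr]].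
  have [m _ mr] := exists_nat_gt r^-1.
  have Fm : F m x.
    split => // y Gy; apply: le_trans (Gr y Gy).
    rewrite invf_ple ?posrE//; apply: ltW; apply: lt_trans mr _.
    by rewrite ltr_nat.
  have [FN|nFN] := pselect (F N x); first by left.
  have Nm : (N <= m)%N.
    by rewrite leqNgt; apply/negP => mN; apply: nFN; exact: (FS _ _ (ltnW mN) _ Fm).
  right; elim: m Nm Fm {mr} => [|m IH] Nm Fm.
    by move: Nm; rewrite leqn0 => /eqP N0; rewrite N0 in nFN.
  have [Fm'|nFm] := pselect (F m x); last first.
    exists m => //=; rewrite leqNgt; apply/negP => mN; apply: nFN.
    exact: (FS _ _ mN _ Fm).
  apply: IH => //; rewrite leqNgt; apply/negP => mN; apply: nFN.
  exact: (FS _ _ (ltnW mN) _ Fm').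
by apply: le_trans (leeD (lexx _) HC) _; rewrite addeA leeD.
Qed.

(** Closed sets are Caratheodory measurable, so the measures of the disjoint
   pieces of E in the G k sum up to at most that of E, and the tail of this sum
   is small. *)
Lemma hausdorff1_tail E (G : nat -> set R[i]) (t : R) : hausdorff1 E < +oo ->
  (forall k, closed_plane (G k)) -> hausdorff1 (E `\` \bigcup_k G k) = 0 ->
  (0 < t)%R -> exists m, hausdorff1 (E `\` \bigcup_(k in [set k | (k < m)%N]) G k) < t%:E.
Proof.
move=> Eoo Gcl E0 t0.
have Gm k := closed_plane_caratheodory (Gcl k).
have Am k : caratheodory_measurable (@hausdorff1 R) (seqDU G k).
  by apply: caratheodory_measurable_setD => //; exact: caratheodory_measurable_bigsetU.
have := caratheodory_lime_le Am (@trivIset_seqDU _ G) E.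
set S := limn _ => SE.
have Soo : S < +oo.
  by apply: le_lt_trans Eoo; apply: le_trans SE; rewrite leeDl// hausdorff1_ge0.
have [m Hm] := nneseries_tail_lt (fun k => hausdorff1_ge0 (E `&` seqDU G k)) Soo t0.
exists m; apply: le_lt_trans Hm.
have := @hausdorff1_le_tail (E `\` \bigcup_(k in [set k | (k < m)%N]) G k)
  (E `\` \bigcup_k G k) (fun k => E `&` seqDU G k) m.
rewrite E0 add0e; apply => x [Ex nGx].
have [Gx|] := pselect ((\bigcup_k G k) x); last by left.
right; move: Gx; rewrite seqDU_bigcup_eq => -[k _ Gkx]; exists k; rewrite //=.
rewrite leqNgt; apply/negP => km; apply: nGx; exists k => //.
exact: subset_seqDU Gkx.
Qed.

End Hausdorff.

(** * Planar outer measure of swept sets *)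

Section Lebesgue2.
Variable R : realType.
Implicit Types (S T : set R[i]).

Lemma lebesgue2_sub S T : S `<=` T -> (lebesgue2 S <= lebesgue2 T)%E.
Proof. by move=> ST; apply: le_mu_ext => q; exact: ST. Qed.

Lemma lebesgue2_ge0 S : (0 <= lebesgue2 S)%E.
Proof. by apply: mu_ext_ge0 => A; exact: measure_ge0. Qed.

Lemma lebesgue2_bigcup (F : nat -> set R[i]) :
  (lebesgue2 (\bigcup_k F k) <= \sum_(0 <= k <oo) lebesgue2 (F k))%E.
Proof.
pose F' k := [set q : R * R | F k (q.1 +i* q.2)].
apply: le_trans (mu_ext_sigma_subadditive _ F') => //.
Qed.

Lemma lebesgue2_set0 : lebesgue2 (@set0 R[i]) = 0%E.
Proof.
by rewrite /lebesgue2 mu_ext0.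
Qed.

Lemma lebesgue2U S T : (lebesgue2 (S `|` T) <= lebesgue2 S + lebesgue2 T)%E.
Proof.
pose F k := if k is k'.+1 then if k' is 0 then T else set0 else S.
apply: (@le_trans _ _ (lebesgue2 (\bigcup_k F k))).
  by apply: lebesgue2_sub => x [Sx|Tx]; [exists 0%N|exists 1%N].
apply: le_trans (lebesgue2_bigcup F) _.
rewrite nneseries_recl//; last by move=> k _; exact: lebesgue2_ge0.
apply: leeD => //.
rewrite -(nneseries_addn 1) => [|k]; last exact: lebesgue2_ge0.
rewrite nneseries_recl//; last by move=> k _; exact: lebesgue2_ge0.
rewrite /F /= -[leRHS]adde0; apply: leeD => //.
rewrite -(nneseries_addn 1) => [|k]; last by case: k => *; exact: lebesgue2_ge0.
by rewrite eseries0// => k _ _; rewrite addn1 addn1 lebesgue2_set0.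
Qed.

Lemma lebesgue2_ball (z : R[i]) r : 
  (lebesgue2 [set y | normc (y - z) <= r]%R <= (4 * r ^+ 2)%:E)%E.
Proof.
have [r0|r0] := ltP r 0.
  rewrite (_ : [set y | _] = set0) ?lebesgue2_set0.
    by rewrite lee_fin mulr_ge0// sqr_ge0.
  by rewrite -subset0 => y /= /(le_trans (normc_ge0 _)); rewrite leNgt r0.
pose I (a : R) := `[a - r, a + r]%classic.
have mI (a : R) : measurable (I a) by exact: measurable_itv.
have lI (a : R) : lebesgue_measure (I a) = (2 * r)%:E.
  rewrite lebesgue_measure_itv /= lte_fin.
  case: ltP => H; first by rewrite -EFinD; congr EFin; ring.
  by congr EFin; lra.
apply: (@le_trans _ _ ((lebesgue_measure \x lebesgue_measure)%E
    (I (complex.Re z) `*` I (complex.Im z)))); last first.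
  have -> := @product_measure1E _ _ _ _ R lebesgue_measure lebesgue_measure _ _
    (mI (complex.Re z)) (mI (complex.Im z)).
  by rewrite [X in (X * _)%E]lI [X in (_ * X)%E]lI -EFinM lee_fin; lra.
have mII : measurable (I (complex.Re z) `*` I (complex.Im z)) by exact: measurableX.
have <- : mu_ext (@lebesgue_measure R \x @lebesgue_measure R)%E
  (I (complex.Re z) `*` I (complex.Im z)) =
  (lebesgue_measure \x lebesgue_measure)%E (I (complex.Re z) `*` I (complex.Im z)).
  exact: measurable_mu_extE.
apply: le_mu_ext => -[a b] /= H.
have := le_trans (ler_Re_normc _) H; have := le_trans (ler_Im_normc _) H.
case: (z) => a' b' /=; rewrite /I /= !in_itv /= !ler_norml => /andP[? ?] /andP[? ?].
by split; apply/andP; split; lra.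
Qed.

Lemma lebesgue2_covered S a : covered S a -> (lebesgue2 S <= (4 * a)%:E)%E.
Proof.
move=> [B SB Ba]; apply: (@le_trans _ _ (4 * \sum_(b <- B) b.2 ^+ 2)%:E); last first.
  by rewrite lee_fin ler_wpM2l.
elim: B S SB {Ba} => [|b B IH] S SB.
  rewrite (_ : S = set0) ?lebesgue2_set0 ?big_nil ?mulr0//.
  by rewrite -subset0 => z /SB[].
rewrite big_cons mulrDr EFinD.
apply: (@le_trans _ _ (lebesgue2 ([set y | normc (y - b.1) <= b.2]
   `|` (S `\` [set y | normc (y - b.1) <= b.2])))).
  by apply: lebesgue2_sub => y Sy; have [?|?] := pselect (normc (y - b.1) <= b.2);
    [left|right].
apply: le_trans (lebesgue2U _ _) _; apply: leeD; first exact: lebesgue2_ball.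
apply: IH => z [/SB[c]]; rewrite inE => /orP[/eqP ->//|cB zc _].
by exists c.
Qed.

End Lebesgue2.

Section TailSweep.
Variable R : realType.
Variable kap : R[i].
Hypothesis kap1 : normc kap = 1.
Local Notation flow := (flow kap).
Local Notation sweep := (sweep kap).

Lemma flow_lipschitz v t t' y y' Rad d : nv v <= 1 / 2 -> 0 <= t <= 1 ->
  0 <= t' <= 1 -> normc y <= Rad -> `|t - t'| * nv v <= d -> normc (y - y') <= d ->
  normc (flow (scale3 t v) y - flow (scale3 t' v) y') <= 2 * (3 * (1 + Rad) + 1) * d.
Proof.
move=> v1 /andP[t0 t1] /andP[t'0 t'1] yR tt yy.
have -> : flow (scale3 t v) y = flow (scale3 t' v) (flow (scale3 (t - t') v) y).
  by rewrite flow_scaleD// addrC subrK.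
rewrite flow_sub normcM.
have e2 : normc (lin kap (scale3 t' v).2) <= 2.
  apply: le_trans (normc_lin_le kap1 _) _.
  have t'v : `|(scale3 t' v).2| <= 1 / 2.
    rewrite /= normrM ger0_norm//; apply: le_trans v1.
    by apply: le_trans (nv2_le v); rewrite ler_piMl.
  have /expR_le1D2x H : 0 <= `|(scale3 t' v).2| <= 1 / 2 by rewrite normr_ge0.
  by apply: le_trans H _; lra.
have ttv : nv (scale3 (t - t') v) <= 1 / 2.
  rewrite nv_scale; apply: le_trans v1; rewrite ler_piMl ?nv_ge0//.
  by rewrite ler_norml; apply/andP; split; lra.
have d0 : 0 <= d by exact: le_trans (normc_ge0 _) yy.
have R0 : 0 <= 1 + Rad by rewrite addr_ge0//; exact: le_trans (normc_ge0 y) yR.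
have H1 : normc (flow (scale3 (t - t') v) y - y) <= 3 * (1 + Rad) * d.
  apply: le_trans (flow_near_id kap1 y ttv) _.
  apply: ler_pM; rewrite ?nv_ge0 ?mulr_ge0 ?addr_ge0 ?normc_ge0//.
    by rewrite ler_pM2l// lerD2l.
  by rewrite nv_scale.
rewrite -mulrA; apply: ler_pM; rewrite ?normc_ge0//.
by apply: le_trans (ler_normc_dist _ y _) _; lra.
Qed.

(** A set of diameter d moved along a path of length L and n steps is covered by
   about L / d + 2 n balls of radius O(d). *)
Lemma covered_sweep_small (U : set R[i]) Rad d (s : seq (step R)) : 0 < d ->
  (forall y, U y -> normc y <= Rad) -> 0 <= Rad ->
  (forall x y, U x -> U y -> normc (x - y) <= d) ->
  (forall e, e \in s -> nv e.1 <= 1 / 2) ->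
  covered (sweep (fun _ => U) s)
    (expR (slen s) ^+ 2 * ((2 * (3 * (1 + Rad) + 1)) ^+ 2 *
       (slen s * d + 2 * (size s)%:R * d ^+ 2))).
Proof.
move=> d0 UR R0 Ud.
have [[y0 Uy0]|U0] := pselect (exists y, U y); last first.
  move=> _; have -> : U = set0 by rewrite -subset0 => y Uy; apply: U0; exists y.
  rewrite sweep_set0; apply: covered_le _ _ (covered0 R) => //.
  apply: mulr_ge0; first exact: sqr_ge0.
  apply: mulr_ge0; first exact: sqr_ge0.
  apply: addr_ge0; first by rewrite mulr_ge0 ?slen_ge0// ltW.
  by rewrite mulr_ge0 ?sqr_ge0// mulr_ge0.
set B := 2 * (3 * (1 + Rad) + 1).
have B0 : 0 <= B by rewrite /B mulr_ge0// addr_ge0// mulr_ge0// addr_ge0.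
elim: s => [|[v u] s IH] small.
  by rewrite /= /slen big_nil mul0r mulr0 mul0r addr0 !mulr0; exact: covered0.
have v1 : nv v <= 1 / 2 by apply: (small (v, u)); rewrite inE eqxx.
have {}IH := IH (fun e es => small e (mem_behead (s := (v, u) :: s) es)).
pose m := (Num.truncn (nv v / d)).+1.
have mR : (0 : R) < m%:R by rewrite ltr0n.
have mvd : nv v <= m%:R * d.
  by rewrite -ler_pdivrMr//; apply: ltW; exact: truncnS_gt.
have md : m%:R * d <= nv v + d.
  rewrite /m -natr1 mulrDl mul1r lerD2r -ler_pdivlMr//.
  by rewrite truncn_le divr_ge0 ?nv_ge0// ltW.
have piece : covered [set z | exists t y, [/\ 0 <= t <= 1, U y & z = flow (scale3 t v) y]]
    (B ^+ 2 * (nv v * d + 2 * d ^+ 2)).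
  exists [seq (flow (scale3 (j%:R / m%:R) v) y0, B * d) | j <- iota 0 m.+1].
    move=> z [t [y [/andP[t0 t1] Uy ->]]].
    pose j := Num.truncn (t * m%:R).
    have tm0 : 0 <= t * m%:R by rewrite mulr_ge0// ltW.
    have /andP[j1 j2] := truncn_itv tm0.
    have jm : (j <= m)%N.
      by rewrite -(natrK (R := R) m); apply: le_truncn; rewrite ler_piMl// ltW.
    exists (flow (scale3 (j%:R / m%:R) v) y0, B * d).
      by apply/mapP; exists j => //; rewrite mem_iota add0n ltnS.
    rewrite /=; apply: flow_lipschitz => //; rewrite ?t0//; [| exact: UR| |exact: Ud].
      by rewrite divr_ge0//= ler_pdivrMr// mul1r ler_nat.
    have tj : `|t - j%:R / m%:R| <= m%:R^-1.
      rewrite ger0_norm; last by rewrite subr_ge0 ler_pdivrMr.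
      suff : t <= (j%:R + 1) / m%:R by rewrite mulrDl mul1r lerBlDl.
      by rewrite ler_pdivlMr// natr1 ltW.
    apply: le_trans (ler_wpM2r (nv_ge0 v) tj) _.
    by rewrite mulrC ler_pdivrMr// mulrC.
  rewrite big_map -[iota 0 m.+1]/(index_iota 0 m.+1).
  rewrite (eq_bigr (fun=> (B * d) ^+ 2))// sumr_const_nat subn0.
  rewrite (_ : _ *+ m.+1 = B ^+ 2 * ((m%:R + 1) * d ^+ 2)); last first.
    by rewrite -[LHS]mulr_natl exprMn -natr1; ring.
  rewrite ler_wpM2l ?sqr_ge0//.
  have := ler_wpM2r (ltW d0) md; rewrite expr2; lra.
rewrite [sweep _ _]/=; apply: covered_le (lexx _) _ => [z Hz|]; first exact: Hz.
apply: covered_le _ _ (coveredU piece (covered_flow kap v IH)) => //.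
have -> : slen ((v, u) :: s) = nv v + slen s by rewrite /slen big_cons.
have -> : (size ((v, u) :: s))%:R = (size s)%:R + 1 :> R by rewrite natr1.
rewrite expRD.
set L := slen s; set n := (size s)%:R.
have L0 : 0 <= L by exact: slen_ge0.
have n0 : 0 <= n :> R by [].
have lv : normc (lin kap v.2) ^+ 2 <= expR (nv v) ^+ 2.
  rewrite lerXn2r ?nnegrE ?normc_ge0 ?expR_ge0//.
  by apply: le_trans (normc_lin_le kap1 _) _; rewrite ler_expR; exact: nv2_le.
have ev1 : 1 <= expR (nv v) ^+ 2 by rewrite exprn_ege1// -expR0 ler_expR nv_ge0.
have eL1 : 1 <= expR L ^+ 2 by rewrite exprn_ege1// -expR0 ler_expR.
set p := expR (nv v) ^+ 2 in lv ev1 *; set q := expR L ^+ 2 in eL1 *.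
have p0 : 0 <= p by apply: le_trans ev1.
have q0 : 0 <= q by apply: le_trans eL1.
set w := B ^+ 2; have w0 : 0 <= w by exact: sqr_ge0.
rewrite exprMn -/p -/q.
have X0 : 0 <= nv v * d + 2 * d ^+ 2.
  by rewrite addr_ge0 ?mulr_ge0 ?nv_ge0 ?sqr_ge0// ltW.
have Y0 : 0 <= L * d + 2 * n * d ^+ 2.
  by rewrite addr_ge0 ?mulr_ge0 ?sqr_ge0// ltW.
have -> : p * q * (w * ((nv v + L) * d + 2 * (n + 1) * d ^+ 2)) =
  p * q * (w * (nv v * d + 2 * d ^+ 2)) + p * (q * (w * (L * d + 2 * n * d ^+ 2))).
  by ring.
apply: lerD.
  apply: ler_peMl; first exact: mulr_ge0.
  by rewrite (le_trans ev1)// ler_peMr.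
apply: ler_wpM2r => //; apply: mulr_ge0 => //; exact: mulr_ge0.
Qed.

(** The factor of t depends on the path only through a bound for its length. *)
Lemma lebesgue2_sweep_hausdorff (A : set R[i]) Rad L t (s : seq (step R)) :
  (forall y, A y -> normc y <= Rad) -> 0 <= Rad -> 0 < L -> 0 < t ->
  (forall e, e \in s -> nv e.1 <= 1 / 2) -> slen s <= L ->
  (hausdorff1 A < t%:E)%E ->
  (lebesgue2 (sweep (fun _ => A) s) <=
   (4 * (expR L ^+ 2 * ((2 * (3 * (1 + Rad) + 1)) ^+ 2 * (3 * L))) * (2 * t))%:E)%E.
Proof.
move=> AR R0 L0 t0 small sL At.
set c := 4 * _; have c0 : 0 <= c.
  by rewrite /c mulr_ge0// mulr_ge0 ?sqr_ge0// mulr_ge0 ?sqr_ge0// mulr_ge0// ltW.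
(* Sets of diameter 2 dl are so small that the number of steps contributes no
   more to the bound of covered_sweep_small than the length L. *)
pose dl := Num.min t (L / (2 * (size s).+1%:R)) / 2.
have dl0 : 0 < dl by rewrite /dl divr_gt0// lt_min t0 divr_gt0// mulr_gt0.
have dlt : 2 * dl <= t by rewrite /dl mulrC divfK// ge_min lexx.
have dlL : 2 * (size s)%:R * (2 * dl) <= L.
  have : 2 * dl <= L / (2 * (size s).+1%:R).
    by rewrite /dl mulrC divfK// ge_min lexx orbT.
  rewrite ler_pdivlMr ?mulr_gt0// -natr1 => H; apply: le_trans H.
  have := dl0; lra.
have : (hausdorff1_delta dl A < t%:E)%E.
  by apply: le_lt_trans At; exact: hausdorff1_delta_le.
move=> /ereal_inf_lt[_ [U [AU Ud ->]] Ut].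
(* The sets U k may be single points, but are given positive diameters dk k. *)
pose ek (k : nat) : R := dl / (2 ^ k.+1)%:R.
have ek0 k : 0 < ek k by rewrite divr_gt0// ltr0n expn_gt0.
have ekdl k : ek k <= dl.
  by rewrite ler_pdivrMr ?ltr0n ?expn_gt0// ler_peMr ?(ltW dl0)// ler1n expn_gt0.
have diam_fin k : diam (U k) = (fine (diam (U k)))%:E.
  rewrite fineK// ge0_fin_numE ?diam_ge0//.
  by apply: le_lt_trans (Ud k) _; exact: ltry.
pose dk k := fine (diam (U k)) + ek k.
have fd0 k : 0 <= fine (diam (U k)) by rewrite -lee_fin -diam_fin diam_ge0.
have dk0 k : 0 < dk k by rewrite ltr_wpDl.
have dkdl k : dk k <= 2 * dl.
  have : fine (diam (U k)) <= dl by rewrite -lee_fin -diam_fin.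
  by have := ekdl k; rewrite /dk; lra.
have step1 k : (lebesgue2 (sweep (fun _ => U k `&` A) s) <= (c * dk k)%:E)%E.
  have Ukd x y : (U k `&` A) x -> (U k `&` A) y -> normc (x - y) <= dk k.
    move=> [Ux _] [Uy _]; have := diam_ub Ux Uy; rewrite diam_fin lee_fin => /le_trans.
    by apply; rewrite lerDl ltW.
  have UkR y : (U k `&` A) y -> normc y <= Rad by move=> [_ /AR].
  apply: le_trans (lebesgue2_covered (covered_sweep_small (dk0 k) UkR R0 Ukd small)) _.
  set B := (2 * (3 * (1 + Rad) + 1)) ^+ 2.
  have -> : c * dk k = 4 * (expR L ^+ 2 * (B * (3 * L * dk k))) by rewrite /c -/B; ring.
  have B0 : 0 <= B by exact: sqr_ge0.
  rewrite lee_fin ler_pM2l//; apply: ler_pM; rewrite ?sqr_ge0//.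
  - rewrite mulr_ge0// addr_ge0//.
      by rewrite mulr_ge0 ?slen_ge0// ltW.
    by rewrite mulr_ge0 ?sqr_ge0// mulr_ge0.
  - by rewrite lerXn2r ?nnegrE ?expR_ge0// ler_expR.
  - rewrite ler_wpM2l//.
    have H1 : slen s * dk k <= L * dk k by rewrite ler_pM2r.
    have H2 : 2 * (size s)%:R * dk k * dk k <= L * dk k.
      by rewrite ler_pM2r//; apply: le_trans dlL; rewrite ler_wpM2l ?mulr_ge0.
    rewrite -mulrA -expr2 in H2; have := dk0 k; have := mulr_gt0 L0 (dk0 k); lra.
apply: (@le_trans _ _ (lebesgue2 (\bigcup_k sweep (fun _ => U k `&` A) s))).
  apply: lebesgue2_sub => z /sweep_trace[y Ay yz].
  have [k _ Uky] := AU y Ay; exists k => //.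
  by move: yz; apply: sweep_sub => _ _ ->.
apply: le_trans (lebesgue2_bigcup _) _.
apply: (@le_trans _ _ (\sum_(0 <= k <oo) (c%:E * (diam (U k) + (ek k)%:E)))%E).
  apply: lee_nneseries => [k _ _|k _]; first exact: lebesgue2_ge0.
  by apply: le_trans (step1 k) _; rewrite diam_fin -EFinD -EFinM.
rewrite nneseriesZl => [|k _]; last by rewrite adde_ge0 ?diam_ge0// lee_fin ltW.
rewrite [(c * _)%:E]EFinM; apply: lee_wpmul2l; rewrite ?lee_fin//.
apply: le_trans (epsilon_trick _ _ (ltW dl0)) _; first by move=> k; exact: diam_ge0.
have -> : 2 * t = t + t by ring.
rewrite EFinD; apply: leeD; first exact: ltW.
by rewrite lee_fin; lra.
Qed.

End TailSweep.

(** * Regular curves *)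

Section Curves.
Variable R : realType.

Lemma uniform_continuity_segment (f : R -> R) (e : R) : continuous f -> 0 < e ->
  exists2 d, 0 < d & forall s t, 0 <= t <= 1 -> `|s - t| < d -> `|f s - f t| <= e.
Proof.
move=> fc e0.
have /compact_near_coveringP cK := @segment_compact R 0 1.
have := @cK R 0^'+ (fun d t => forall s, `|s - t| < d -> `|f s - f t| <= e) _.
have H (x : R) : `[0, 1]%classic x -> \forall t \near x & d \near 0^'+,
    forall s, `|s - t| < d -> `|f s - f t| <= e.
  move=> _; have e2 : 0 < e / 2 by rewrite divr_gt0.
  have /cvgrPdist_lt/(_ _ e2) := fc x.
  rewrite near_simpl => /nbhs_ballP[d d0 dB].
  have d2 : 0 < d / 2 by rewrite divr_gt0.
  exists (ball x (d / 2), [set z | z < d / 2]) => /=.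
    split; first exact: nbhsx_ballx.
    exact: nbhs_right_lt.
  move=> [t z] [/= xt zd] s st.
  have Bt : `|f x - f t| < e / 2.
    by apply: dB; apply: le_ball xt; rewrite ler_pdivrMr// ler_peMr ?ler1n// ltW.
  have Bs : `|f x - f s| < e / 2.
    apply: dB; rewrite /ball /=; rewrite /ball /= in xt.
    have := ler_normD (x - t) (t - s); rewrite addrA subrK => /le_lt_trans; apply.
    by rewrite (splitr d) ltrD// distrC (lt_trans st).
  have := ler_normD (f s - f x) (f x - f t); rewrite addrA subrK => /le_trans; apply.
  by rewrite distrC (splitr e) lerD// ltW.
have FF : Filter (0^'+ : set_system R) by exact: _.
move=> /(_ FF H) [d /= d0 dH]; exists (d / 2); first by rewrite divr_gt0.
move=> s t t01 st.
have d2 : 0 < d / 2 by rewrite divr_gt0.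
apply: (dH (d / 2) _ d2 t) => //=.
by rewrite sub0r normrN gtr0_norm// ltr_pdivrMr// ltr_pMr// ltr1n.
Qed.

Lemma uniform_continuity_family (f : nat -> R -> R) m (e : R) :
  (forall k, continuous (f k)) -> 0 < e ->
  exists2 d, 0 < d & forall k, (k < m)%N -> forall s t, 0 <= t <= 1 ->
    `|s - t| < d -> `|f k s - f k t| <= e.
Proof.
move=> fc e0; elim: m => [|m [d d0 IH]]; first by exists 1.
have [d' d'0 H] := uniform_continuity_segment (fc m) e0.
exists (Num.min d d'); first by rewrite lt_min d0.
move=> k; rewrite ltnS leq_eqVlt => /orP[/eqP ->|km] s t t01;
  rewrite lt_min => /andP[std std'].
  exact: H.
exact: (IH k km).
Qed.

Lemma bounded_segment (f : R -> R) : continuous f ->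
  exists2 B, 0 <= B & forall t, 0 <= t <= 1 -> `|f t| <= B.
Proof.
move=> fc; have [d d0 H] := uniform_continuity_segment fc ltr01.
have gc : {within `[0, 1], continuous (fun t => `|f t|)}.
  apply: continuous_subspaceT => t.
  by apply: continuous_comp; [exact: fc|exact: norm_continuous].
have [c _ cH] := EVT_max ler01 gc.
by exists `|f c| => // t t01; apply: cH; rewrite in_itv.
Qed.

Section OneCurve.
Variable g : R -> R[i].
Hypothesis gC1 : C1_curve g.

Lemma curve_derive_re (t : R) : is_derive t 1 (fun s => complex.Re (g s)) (complex.Re (velocity g t)).
Proof.
have [H _ _ _] := gC1; have [dre _] := H t.
by rewrite /velocity /= derive1E; apply/derivableP.
Qed.

Lemma curve_derive_im (t : R) : is_derive t 1 (fun s => complex.Im (g s)) (complex.Im (velocity g t)).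
Proof.
have [H _ _ _] := gC1; have [_ dim] := H t.
by rewrite /velocity /= derive1E; apply/derivableP.
Qed.

Lemma curve_continuous_re : continuous (fun s => complex.Re (g s)).
Proof.
move=> t; apply: differentiable_continuous; apply/derivable1_diffP.
by have [] := curve_derive_re t.
Qed.

Lemma curve_continuous_im : continuous (fun s => complex.Im (g s)).
Proof.
move=> t; apply: differentiable_continuous; apply/derivable1_diffP.
by have [] := curve_derive_im t.
Qed.

Lemma velocity_continuous_re : continuous (fun s => complex.Re (velocity g s)).
Proof. by have [] := gC1. Qed.

Lemma velocity_continuous_im : continuous (fun s => complex.Im (velocity g s)).
Proof. by have [] := gC1. Qed.

Lemma velocity_neq0 t : velocity g t != 0.
Proof. by have [_ _ _ H] := gC1; apply/eqP; exact: H. Qed.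

Lemma continuous_normc (f : R -> R[i]) : continuous (fun s => complex.Re (f s)) ->
  continuous (fun s => complex.Im (f s)) -> continuous (fun s => normc (f s)).
Proof.
move=> fr fi t.
have -> : (fun s => normc (f s)) = Num.sqrt \o
    (fun s => complex.Re (f s) ^+ 2 + complex.Im (f s) ^+ 2).
  by apply/funext => s /=; rewrite -sqr_normcE sqrtr_sqr ger0_norm ?normc_ge0.
apply: continuous_comp; last exact: sqrt_continuous.
apply: cvgD; rewrite /= !expr2.
  by under eq_fun do rewrite expr2; apply: cvgM; exact: fr.
by under eq_fun do rewrite expr2; apply: cvgM; exact: fi.
Qed.

(** The mean value theorem, applied to each of the two coordinates. *)
Lemma curve_near_line (d : R[i]) (sg a b t t' : R) :
  (forall s, a <= s <= b -> `|complex.Re (velocity g s) - complex.Re d| <= sg) ->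
  (forall s, a <= s <= b -> `|complex.Im (velocity g s) - complex.Im d| <= sg) ->
  a <= t <= b -> a <= t' <= b ->
  normc (g t - g t' - (t - t')%:C * d) <= 2 * sg * `|t - t'|.
Proof.
move=> vr vi; wlog tt' : t t' / t' <= t => [wlg tab t'ab|/andP[at_ tb] /andP[at' t'b]].
  have [H|/ltW H] := leP t' t; first exact: wlg.
  rewrite distrC -normcN.
  have -> : - (g t - g t' - (t - t')%:C * d) = g t' - g t - (t' - t)%:C * d.
    by rewrite !rmorphB /=; ring.
  exact: wlg.
have sub s : t' <= s <= t -> a <= s <= b.
  by move=> /andP[h1 h2]; rewrite (le_trans at')//= (le_trans h2).
have H1 := mvt_affine_bound curve_derive_re (fun s h => vr s (sub s h)) tt'.
have H2 := mvt_affine_bound curve_derive_im (fun s h => vi s (sub s h)) tt'.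
apply: le_trans (ler_normc_ReIm _) _.
rewrite (ger0_norm (_ : 0 <= t - t')) ?subr_ge0//.
have -> : complex.Re (g t - g t' - (t - t')%:C * d) =
    complex.Re (g t) - complex.Re (g t') - complex.Re d * (t - t').
  by case: (g t) (g t') d {vr vi H1 H2} => [? ?] [? ?] [? ?] /=; ring.
have -> : complex.Im (g t - g t' - (t - t')%:C * d) =
    complex.Im (g t) - complex.Im (g t') - complex.Im d * (t - t').
  by case: (g t) (g t') d {vr vi H1 H2} => [? ?] [? ?] [? ?] /=; ring.
apply: le_trans (lerD H1 H2) _; lra.
Qed.

Lemma curve_image_closed : closed_plane (curve_image g).
Proof.
move=> x xg.
have gc : {within `[0, 1], continuous (fun t => normc (x - g t))}.
  apply: continuous_subspaceT; apply: continuous_normc => t.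
    have -> : (fun s => complex.Re (x - g s)) = (fun s => complex.Re x - complex.Re (g s)).
      by apply/funext => s; case: (x) (g s) => [? ?] [? ?].
    by apply: cvgB; [exact: cvg_cst|exact: curve_continuous_re].
  have -> : (fun s => complex.Im (x - g s)) = (fun s => complex.Im x - complex.Im (g s)).
    by apply/funext => s; case: (x) (g s) => [? ?] [? ?].
  by apply: cvgB; [exact: cvg_cst|exact: curve_continuous_im].
have [c c01 cH] := EVT_min ler01 gc.
exists (normc (x - g c)).
  rewrite normc_gt0 subr_eq0; apply/negP => /eqP xgc; apply: xg.
  by exists c.
by move=> _ [t /= t01 <-]; exact: cH.
Qed.

Lemma curve_bounded : exists2 B, 0 <= B & forall t, 0 <= t <= 1 ->
  normc (g t) <= B /\ normc (velocity g t) <= B.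
Proof.
have [B1 B10 H1] := bounded_segment (continuous_normc curve_continuous_re curve_continuous_im).
have [B2 B20 H2] := bounded_segment (continuous_normc velocity_continuous_re velocity_continuous_im).
exists (B1 + B2); first exact: addr_ge0.
move=> t t01; have := H1 t t01; have := H2 t t01.
by rewrite !ger0_norm ?normc_ge0//; split; lra.
Qed.

Lemma cross2_vfield_continuous kap x :
  continuous (fun t => cross2 (velocity g t) (vfield kap x (g t))).
Proof.
move=> t; rewrite /cross2.
have vr : continuous (fun s => complex.Re (vfield kap x (g s))).
  move=> s.
  have -> : (fun s => complex.Re (vfield kap x (g s))) = (fun s =>
      complex.Re kap * (x.2 * complex.Re (g s) - complex.Re x.1) -
      complex.Im kap * (x.2 * complex.Im (g s) - complex.Im x.1)).
    by apply/funext => u; rewrite /vfield; case: (kap) (x) (g u) => [a b] [[c d] e] [p q] /=; ring.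
  apply: cvgB; apply: cvgM; try exact: cvg_cst;
    (apply: cvgB; last exact: cvg_cst); apply: cvgM; try exact: cvg_cst.
    exact: curve_continuous_re.
  exact: curve_continuous_im.
have vi : continuous (fun s => complex.Im (vfield kap x (g s))).
  move=> s.
  have -> : (fun s => complex.Im (vfield kap x (g s))) = (fun s =>
      complex.Re kap * (x.2 * complex.Im (g s) - complex.Im x.1) +
      complex.Im kap * (x.2 * complex.Re (g s) - complex.Re x.1)).
    by apply/funext => u; rewrite /vfield; case: (kap) (x) (g u) => [a b] [[c d] e] [p q] /=; ring.
  apply: cvgD; apply: cvgM; try exact: cvg_cst;
    (apply: cvgB; last exact: cvg_cst); apply: cvgM; try exact: cvg_cst.
    exact: curve_continuous_im.
  exact: curve_continuous_re.
apply: cvgM.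
  apply: cvgB; apply: cvgM.
  - exact: velocity_continuous_re.
  - exact: vi.
  - exact: velocity_continuous_im.
  - exact: vr.
apply: cvgV; first by rewrite normc_eq0 velocity_neq0.
exact: (continuous_normc velocity_continuous_re velocity_continuous_im).
Qed.

End OneCurve.

End Curves.

(** * Motions along a line of centers, for finitely many curves *)

Section FiniteCurves.
Variable R : realType.
Variable kap : R[i].
Hypothesis kap1 : normc kap = 1.
Variables (n f1 f2 : vec3 R).
Hypotheses (nf1 : dot3 n f1 = 0) (nf2 : dot3 n f2 = 0).
Hypotheses (f11 : dot3 f1 f1 = 1) (f22 : dot3 f2 f2 = 1) (f12 : dot3 f1 f2 = 0).
Variable special : Prop.
Hypothesis special_real : special -> complex.Im kap = 0.
Variable t0 : R.
Hypothesis t01 : 0 < t0 < 1.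
Variable g : nat -> R -> R[i].
Hypothesis gC1 : forall k, C1_curve (g k).

Local Notation cmb := (comb f1 f2).

Lemma dot3_combE (z w : R * R) : dot3 (cmb z) (cmb w) = z.1 * w.1 + z.2 * w.2.
Proof.
rewrite /comb dot3Dr !dot3Zr !(dot3C (_ + _)) !dot3Dr !dot3Zr f11 f22 f12 (dot3C f2) f12.
ring.
Qed.

Lemma comb_eq0 (z : R * R) : cmb z = 0 -> z = 0.
Proof.
move=> z0; have : dot3 (cmb z) (cmb z) = 0 by rewrite z0 /dot3 /=; ring.
rewrite dot3_combE -!expr2 => /eqP; rewrite paddr_eq0 ?sqr_ge0// !sqrf_eq0.
by case: z {z0} => a b /= /andP[/eqP -> /eqP ->].
Qed.

Lemma nv_unit_le2 (v : vec3 R) : dot3 v v = 1 -> nv v <= 2.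
Proof.
move=> v1; have := nv_sqr_le v; rewrite v1 mulr1 => H.
rewrite -(@ler_pXn2r _ 2)// ?nnegrE ?nv_ge0//; apply: le_trans H _.
by rewrite expr2 ler_peMr// ler1n.
Qed.

(** The linear form on the plane of centers that gives the normal component of
   the velocity of the curve. It vanishes at the centers that lie on the rotated
   normal, whose motions displace the curve along itself. *)
Definition normal_form k t : R * R :=
  (cross2 (velocity (g k) t) (vfield kap f1 (g k t)),
   cross2 (velocity (g k) t) (vfield kap f2 (g k t))).

Lemma app_normal_form k (t : R) (z : R * R) : app (normal_form k t) z =
  cross2 (velocity (g k) t) (vfield kap (cmb z) (g k t)).
Proof.
by rewrite /app /normal_form /comb vfieldD !vfield_scale cross2D !cross2_scale /= mulrC (mulrC _ z.2).
Qed.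

Definition cell_arc Q (q : nat * nat) : set R[i] :=
  [set g q.1 t | t in `[q.2%:R / Q%:R, q.2%:R / Q%:R + Q%:R^-1]].

Definition arc_killed Q (q : nat * nat) u :=
  forall t, q.2%:R / Q%:R <= t <= q.2%:R / Q%:R + Q%:R^-1 ->
  exists v, [/\ plane n v, cross2 (velocity (g q.1) t) (vfield kap v (g q.1 t)) = 0
    & dist_P2 (to_P2 u) (to_P2 v) < t0].

(** A form that is nearly zero at z vanishes exactly at the direction w obtained by
   turning the form by a right angle, and the angle between z and w is small. *)
Lemma normal_form_killed k (t : R) (z : R * R) : 1 <= `|z.1| \/ 1 <= `|z.2| ->
  0 < n1 (normal_form k t) ->
  `|app (normal_form k t) z| <= n1 (normal_form k t) * (4 * (sin t0 / 8)) ->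
  exists v, [/\ plane n v, cross2 (velocity (g k) t) (vfield kap v (g k t)) = 0
    & dist_P2 (to_P2 (cmb z)) (to_P2 v) < t0].
Proof.
have [N NE] : exists N, N = normal_form k t by eexists.
rewrite -NE => z1 N0 Nz.
pose w : R * R := (- N.2, N.1).
have w0 : w != 0 by rewrite -n1_gt0 /n1 /= normrN addrC.
have zz : 1 <= z.1 ^+ 2 + z.2 ^+ 2.
  have := sqr_ge0 z.1; have := sqr_ge0 z.2.
  rewrite -[z.1 ^+ 2]real_normK ?num_real// -[z.2 ^+ 2]real_normK ?num_real//.
  by case: z1 => H; nra.
have z0 : z != 0.
  by apply: contraTN zz => /eqP ->; rewrite expr0n addr0 -ltNge ltr01.
have pz (y : R * R) : y != 0 -> plane n (cmb y).
  move=> y0; split; first by apply: contra y0 => /eqP/comb_eq0/eqP.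
  by rewrite /comb dot3Dr !dot3Zr nf1 nf2; ring.
exists (cmb w); split; first exact: pz.
  by rewrite -app_normal_form -NE /app /w /=; ring.
have [zn _] := pz _ z0; have [wn _] := pz _ w0.
apply: dist_P2_lt => //; rewrite !dot3_combE.
set X := (z.1 * z.1 + z.2 * z.2) * (w.1 * w.1 + w.2 * w.2).
have XE : X = (z.1 * w.1 + z.2 * w.2) ^+ 2 + app N z ^+ 2.
  by rewrite /X /w /app /=; ring.
have ww : 0 < w.1 * w.1 + w.2 * w.2.
  by have := dot3_gt0 wn; rewrite dot3_combE.
have X0 : 0 < X by rewrite mulr_gt0// -!expr2; apply: lt_le_trans zz.
have wX : w.1 * w.1 + w.2 * w.2 <= X.
  by rewrite /X ler_peMl ?(ltW ww)// -!expr2.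
have NX : n1 N ^+ 2 <= 2 * X.
  apply: (@le_trans _ _ (2 * (w.1 * w.1 + w.2 * w.2))); last by rewrite ler_pM2l.
  have := sqr_ge0 (`|N.1| - `|N.2|); rewrite /w /n1 /=.
  have := real_normK (num_real N.1); have := real_normK (num_real N.2).
  rewrite !expr2. lra.
have st := sin_gt0_small t01.
have appX : app N z ^+ 2 <= sin t0 ^+ 2 / 2 * X.
  rewrite -[app N z ^+ 2]real_normK ?num_real//.
  apply: (@le_trans _ _ ((n1 N * (4 * (sin t0 / 8))) ^+ 2)).
    rewrite lerXn2r ?nnegrE//; apply: le_trans Nz; exact: normr_ge0.
  rewrite exprMn; apply: (@le_trans _ _ (2 * X * (4 * (sin t0 / 8)) ^+ 2)).
    by rewrite ler_wpM2r// sqr_ge0.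
  by rewrite !expr2; lra.
rewrite cos2sin2; have : 0 < sin t0 ^+ 2 * X by rewrite mulr_gt0// exprn_gt0.
move: XE; lra.
Qed.

(** Small relative errors in a form preserve the bound that kills a cell, up to a
   factor. *)
Lemma app_perturb (N N' z : R * R) (e vs : R) : 0 < e -> e <= 1 -> 0 < vs -> n1 z <= 2 ->
  vs <= n1 N -> n1 (N' - N) <= e * vs / 2 -> `|app N z| <= n1 N * e ->
  0 < n1 N' /\ `|app N' z| <= n1 N' * (4 * e).
Proof.
move=> e0 e1 vs0 z2 vsN NN Nz.
have evs : e * vs <= e * n1 N by rewrite ler_pM2l.
have eN : e * n1 N <= n1 N by rewrite ler_piMl// n1_ge0.
have NE : N = N' - (N' - N) by rewrite subKr.
have N2 : n1 N <= n1 N' + n1 (N' - N).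
  by rewrite {1}NE; apply: le_trans (n1D _ _) _; rewrite n1N.
have H : n1 N <= 2 * n1 N' by move: vs0; lra.
have appE : app N' z = app N z + app (N' - N) z by rewrite /app /=; ring.
split; first by lra.
rewrite appE; apply: le_trans (ler_normD _ _) _.
have := ler_app (N' - N) z.
have : n1 (N' - N) * n1 z <= (e * n1 N / 2) * 2.
  by rewrite ler_pM ?n1_ge0//; lra.
have : e * n1 N <= e * (2 * n1 N') by rewrite ler_pM2l.
move: Nz; lra.
Qed.

Variables (m M : nat) (tau : R).
Hypothesis tau_gt0 : 0 < tau.
Hypothesis M_large : 8 / (sin t0 / 8) <= M%:R.

Lemma curves_bounded : exists2 B, 1 <= B & forall k t, (k < m)%N -> 0 <= t <= 1 ->
  normc (g k t) <= B /\ normc (velocity (g k) t) <= B.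
Proof.
elim: m => [|p [B B1 IH]]; first by exists 1.
have [B' B'0 H] := curve_bounded (gC1 p).
exists (B + B'); first by rewrite ler_wpDr.
have B0 : 0 <= B by apply: le_trans B1.
move=> k t; rewrite ltnS leq_eqVlt => /orP[/eqP ->|kp] t01'.
  by have [h1 h2] := H t t01'; split; lra.
by have [h1 h2] := IH k t kp t01'; split; lra.
Qed.

(** The constant in front of tau does not depend on the curves or their number.
   The curves are divided into so many cells that, over a cell, the velocity
   varies by little compared with sg and the normal forms by little compared with
   vs. *)
Lemma curves_bounded_cost : exists Q Rad, [/\ (0 < Q)%N, 0 <= Rad,
  forall (q : 'I_m * 'I_Q) y, cell_arc Q (val q.1, val q.2) y -> normc y <= Rad
  & bounded_cost kap n special (sin t0 / 2) tau Rad
     (fun q : 'I_m * 'I_Q => cell_arc Q (val q.1, val q.2))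
     (fun q => arc_killed Q (val q.1, val q.2)) f1 f2 finset.set0
     ((cost_factor (sin t0 / 8) #|{: arcs M}| + 1) * tau)].
Proof.
have [B B1 HB] := curves_bounded.
have st := sin_gt0_small t01.
have st1 : sin t0 <= 1 by exact: sin_le1.
pose e5 := sin t0 / 8.
have e50 : 0 < e5 by rewrite divr_gt0.
have e51 : e5 <= 1 by rewrite /e5; lra.
have B0 : 0 <= B by apply: le_trans B1.
pose Cm := 8 * (2 * B + 21 * (1 + B)) * (m%:R + 1).
have m0 : 0 < m%:R + 1 :> R by rewrite ltr_wpDl.
have cB0 : 0 < 2 * B + 21 * (1 + B) by lra.
have C0 : 0 < 8 * (2 * B + 21 * (1 + B)) by rewrite mulr_gt0.
have Cm0 : 0 < Cm by rewrite /Cm mulr_gt0.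
(* Cm bounds the constant of arc_crossing summed over all cells, so that cells
   whose form is less than vs are swept at a total cost of at most tau. *)
pose vs := tau / (2 * Cm).
have vs0 : 0 < vs by rewrite divr_gt0// mulr_gt0.
have vsC : Cm * vs = tau / 2 by rewrite /vs; field; rewrite gt_eqF.
have vsC1 : Cm * vs <= tau by rewrite vsC; have := tau_gt0; lra.
have vsC2 : Cm * (vs * 2) <= tau by rewrite mulrA vsC; have := tau_gt0; lra.
pose sg := Num.min (vs / 2) 1.
have sg0 : 0 < sg by rewrite lt_min divr_gt0//=.
have sg1 : sg <= 1 by rewrite ge_min lexx orbT.
have sgv : sg <= vs / 2 by rewrite ge_min lexx.
have sgv1 : 2 * sg <= vs by lra.
have sgv2 : vs + sg <= vs * 2 by lra.
have e1 : 0 < sg / 8 by rewrite divr_gt0.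
have e2 : 0 < e5 * vs / 4 by rewrite divr_gt0// mulr_gt0.
have [d1 d10 H1] := uniform_continuity_family m (fun k => velocity_continuous_re (gC1 k)) e1.
have [d2 d20 H2] := uniform_continuity_family m (fun k => velocity_continuous_im (gC1 k)) e1.
have [d3 d30 H3] := uniform_continuity_family m
  (fun k => @cross2_vfield_continuous _ _ (gC1 k) kap f1) e2.
have [d4 d40 H4] := uniform_continuity_family m
  (fun k => @cross2_vfield_continuous _ _ (gC1 k) kap f2) e2.
pose D := Num.min (Num.min d1 d2) (Num.min (Num.min d3 d4) (sg / (16 * (B + 1)))).
have B16 : 0 < 16 * (B + 1) by rewrite mulr_gt0// ltr_wpDl.
have D0 : 0 < D by rewrite !lt_min d10 d20 d30 d40 divr_gt0.
have [Q Q0 QD] := exists_nat_gt D^-1.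
have QR : 0 < Q%:R :> R by rewrite ltr0n.
have QiD : Q%:R^-1 < D by rewrite invf_plt ?posrE.
have Qd1 : Q%:R^-1 < d1 by apply: lt_le_trans QiD _; rewrite !ge_min lexx ?orbT.
have Qd2 : Q%:R^-1 < d2 by apply: lt_le_trans QiD _; rewrite !ge_min lexx ?orbT.
have Qd3 : Q%:R^-1 < d3 by apply: lt_le_trans QiD _; rewrite !ge_min lexx ?orbT.
have Qd4 : Q%:R^-1 < d4 by apply: lt_le_trans QiD _; rewrite !ge_min lexx ?orbT.
have Qsg : 16 * (B + 1) * Q%:R^-1 <= sg.
  rewrite mulrC -ler_pdivlMr//; apply/ltW; apply: lt_le_trans QiD _.
  by rewrite !ge_min lexx ?orbT.
have Qi0 : 0 < Q%:R^-1 :> R by rewrite invr_gt0.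
have cell01 (i : 'I_Q) (t : R) : i%:R / Q%:R <= t <= i%:R / Q%:R + Q%:R^-1 -> 0 <= t <= 1.
  move=> /andP[a b]; apply/andP; split; first by rewrite (le_trans _ a) ?divr_ge0.
  apply: le_trans b _.
  have -> : i%:R / Q%:R + Q%:R^-1 = (i%:R + 1) / Q%:R :> R by rewrite mulrDl mul1r.
  by rewrite ler_pdivrMr// mul1r natr1 ler_nat.
have cellS (i : 'I_Q) (t : R) : i%:R / Q%:R <= t <= i%:R / Q%:R + Q%:R^-1 ->
    `|t - i%:R / Q%:R| <= Q%:R^-1.
  by move=> /andP[a b]; rewrite ger0_norm ?subr_ge0// lerBlDl.
have cellB (i : 'I_Q) : i%:R / Q%:R <= i%:R / Q%:R + Q%:R^-1 :> R.
  by rewrite lerDl ltW.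
have cell0 (i : 'I_Q) : 0 <= (i%:R / Q%:R : R) <= 1.
  by apply: (cell01 i); rewrite lexx cellB.
exists Q, B; split => //.
  move=> [k i] y [t /=]; rewrite in_itv /= => ti <-.
  by have [] := HB k t (ltn_ord k) (cell01 i t ti).
pose Nq (q : 'I_m * 'I_Q) := normal_form q.1 (q.2%:R / Q%:R).
have cardE : #|{: 'I_m * 'I_Q}|%:R = m%:R * Q%:R :> R.
  by rewrite card_prod !card_ord natrM.
pose cst := 8 * Q%:R^-1 * (2 * B + 21 * (1 + B)).
have cstE : cst * #|{: 'I_m * 'I_Q}|%:R <= Cm.
  rewrite cardE (_ : cst * _ = 8 * (2 * B + 21 * (1 + B)) * m%:R).
    2: by rewrite /cst; field; rewrite gt_eqF.
  by rewrite /Cm ler_pM2l// lerDl.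
apply: (@bounded_cost_all _ _ kap1 n special special_real (sin t0 / 2) tau B _ _ B0
  _ _ _ _ f1 f2 nf1 nf2 _ _ comb_eq0 Nq cst sg vs e5) => //.
- by rewrite divr_gt0.
- move=> [k i] y [t /=]; rewrite in_itv /= => ti <-.
  by have [] := HB k t (ltn_ord k) (cell01 i t ti).
- exact: nv_unit_le2.
- exact: nv_unit_le2.
- by rewrite /cst mulr_gt0// mulr_gt0.
- exact: ltW.
- apply: le_trans (ler_wpM2r _ cstE) _; first by rewrite mulr_ge0// ltW.
  apply: (@le_trans _ _ (Cm * vs)); last exact: vsC1.
  by rewrite ler_pM2l.
- apply: le_trans (ler_wpM2r _ cstE) _; first by rewrite addr_ge0// ltW.
  apply: (@le_trans _ _ (Cm * (vs * 2))); last exact: vsC2.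
  by rewrite ler_pM2l.
- move=> [k i] z z2.
  rewrite app_normal_form.
  apply: (@arc_crossing _ _ kap1 _ _ B _ (k, i) _ (g k) (i%:R / Q%:R) Q%:R^-1) => //=.
  + move=> [k' i'] y [t /=]; rewrite in_itv /= => ti <-.
    by have [] := HB k' t (ltn_ord k') (cell01 i' t ti).
  + move=> t t' ti t'i.
    have -> : sg / 4 = 2 * (sg / 8) by field.
    apply: (curve_near_line (gC1 k) _ _ ti t'i) => s si.
      by apply: H1 => //; exact: le_lt_trans (cellS i s si) Qd1.
    by apply: H2 => //; exact: le_lt_trans (cellS i s si) Qd2.
  + exact: velocity_neq0 (gC1 k) _.
  + by have [] := HB k _ (ltn_ord k) (cell0 i).
  + apply: le_trans (nv_comb _ _ _) _; try exact: nv_unit_le2.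
    by rewrite (_ : 4 = 2 * 2) ?ler_pM2l// -natrM.
- move=> [k i] z z1 za zb vsN Nz t ti.
  have z2 : n1 z <= 2 by exact: (lerD za zb).
  have st' := cellS i t ti; have t1 := cell0 i.
  have N1 : `|(normal_form k t).1 - (Nq (k, i)).1| <= e5 * vs / 4.
    exact: (H3 k (ltn_ord k) _ _ t1 (le_lt_trans st' Qd3)).
  have N2 : `|(normal_form k t).2 - (Nq (k, i)).2| <= e5 * vs / 4.
    exact: (H4 k (ltn_ord k) _ _ t1 (le_lt_trans st' Qd4)).
  have [] := @app_perturb (Nq (k, i)) (normal_form k t) z e5 vs => //.
  + rewrite /n1 /=; apply: le_trans (lerD N1 N2) _.
    by rewrite le_eqVlt; apply/orP; left; apply/eqP; field.
  + by move=> Nt0 Ntz; exact: (normal_form_killed z1 Nt0 Ntz).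
Qed.

End FiniteCurves.

(** * From cost bounds to the theorem *)

Section CheapPath.
Variable R : realType.
Variable kap : R[i].
Hypothesis kap1 : normc kap = 1.
Variables (n : vec3 R) (special : Prop) (e3 tau Rad : R).
Variables (Cell : finType) (Gam : Cell -> set R[i]) (killed : Cell -> vec3 R -> Prop).
Variables f1 f2 : vec3 R.

(** The motion is divided into N equal parts, where N is so large that each part
   can be replaced, and the replacement of the first part is repeated N times. *)
Lemma bounded_cost_path (Kf : R) (z : R * R) : 0 < tau -> 0 <= Kf ->
  bounded_cost kap n special e3 tau Rad Gam killed f1 f2 finset.set0 (Kf * tau) ->
  z != 0 -> dot3 n (comb f1 f2 z) = 0 ->
  exists s : seq (step R), [/\ s != [::],
    forall y, comp kap s y = flow kap (comb f1 f2 z) y,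
    forall e, e \in s -> [/\ near_plane n special e3 e.1, plane n e.2 & nv e.1 <= 1 / 2],
    slen s <= Kf * n1 z + 1
  & covered (sweep kap (kept Gam killed finset.set0) s)
      (expR `|(comb f1 f2 z).2| ^+ 2 * (tau * (Kf * n1 z + 1)))].
Proof.
move=> tau0 Kf0 bc z0 nz; set X := comb f1 f2 z; set P := Kf * n1 z + 1.
have P0 : 0 < P by rewrite ltr_wpDl// mulr_ge0// n1_ge0.
have [r r0 H] := bc z z0 tau tau0.
have [N N0 Nr] := exists_nat_gt (r^-1 + 2 * P).
have NR : 0 < N%:R :> R by rewrite ltr0n.
have r1 : 0 < r^-1 by rewrite invr_gt0.
have Ni0 : 0 < N%:R^-1 :> R by rewrite invr_gt0.
have Nir : N%:R^-1 <= r.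
  by rewrite ltW// invf_plt ?posrE//; apply: le_lt_trans Nr; rewrite lerDl mulr_ge0// ltW.
have NP : P * N%:R^-1 <= 1 / 2.
  rewrite ler_pdivrMr// mulrC mulrA mulr1 ler_pdivlMr// mulrC; apply/ltW.
  by apply: le_lt_trans Nr; rewrite lerDr ltW.
have XX : nv (X - X) < r by rewrite subrr nv0.
have Nh : 0 < (N%:R^-1 : R) <= r by apply/andP.
have [s [s0 sX se _ [a1 ca1 a1s]]] := H X XX (fun _ => nz) _ Nh 1 ltr01.
have costE : N%:R^-1 * (Kf * tau * n1 z + tau) = tau * (P * N%:R^-1) by rewrite /P; ring.
rewrite costE in a1s.
have a10 := covered_ge0 ca1.
have sl0 : 0 <= slen s by exact: slen_ge0.
have slP : slen s <= P * N%:R^-1.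
  by rewrite -(ler_pM2l tau0); apply: le_trans a1s; rewrite lerDr.
exists (rep N s); split.
- exact: rep_nil.
- move=> y; rewrite (comp_rep kap1 sX) scale3A mulfV ?gt_eqF// scale3_1 //.
- move=> e /mem_rep es; have [h1 h2] := se e es; split => //.
  exact: le_trans (slen_ge es) (le_trans slP NP).
- by rewrite slen_rep mulrC -ler_pdivlMr.
have F : N%:R * `|(scale3 N%:R^-1 X).2| <= `|X.2|.
  by rewrite /= normrM gtr0_norm// mulrA mulfV ?gt_eqF// mul1r.
apply: (covered_le _ _ (covered_rep kap1 sX ca1 F)) => //.
rewrite mulrCA ler_wpM2l ?sqr_ge0// mulrC -ler_pdivlMr//.
apply: le_trans (_ : a1 + tau * slen s <= _); first by rewrite lerDl mulr_ge0// ltW.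
by apply: le_trans a1s _; rewrite mulrA.
Qed.

Lemma sweep_nth (K : vec3 R -> set R[i]) (s : seq (step R)) e0 i y (t : R) : (i < size s)%N ->
  K (nth e0 s i).2 y -> 0 <= t <= 1 ->
  sweep kap K s (comp kap (take i s) (flow kap (scale3 t (nth e0 s i).1) y)).
Proof.
elim: s i => // e s IH [|i] /= si Ky t01.
  by left; exists t, y.
by right; eexists; first exact: (IH i).
Qed.

End CheapPath.

Section Similarities.
Variables (R : realType) (alpha : R).
Local Notation kap := ('i%C * expi alpha).

Lemma kap_inv : - ('i%C * expi (- alpha)) * kap = 1.
Proof.
have := expiNK alpha; set a := expi _; set b := expi _ => ab.
have ii : 'i%C * 'i%C = -1 :> R[i] by rewrite -expr2 sqr_i.
have -> : - ('i%C * a) * ('i%C * b) = - ('i%C * 'i%C) * (a * b) :> R[i] by ring.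
by rewrite ii opprK mul1r.
Qed.

Lemma normc_i : normc 'i%C = 1 :> R.
Proof. by rewrite /normc expr0n /= add0r expr1n sqrtr1. Qed.

Lemma normc_kap : normc kap = 1.
Proof. by rewrite normcM normc_i normc_expi mulr1. Qed.

Lemma similarity_flow (c : R[i]) (f : R) :
  similarity alpha (expi alpha * c, f) = flow kap (c, f).
Proof.
apply/funext => u; rewrite /similarity /flow /flowE /lin /=.
have [->|f0] := eqVneq f 0.
  by rewrite mulr0 expC0; ring.
have fC : f%:C != 0 :> R[i] by rewrite -normc_gt0 normc_real normr_gt0.
have i0 : 'i%C != 0 :> R[i] by rewrite -normc_gt0 normc_i.
have a0 : expi alpha != 0 by exact: expi_neq0.
rewrite -!(mulrA 'i%C); set L := expC _.
by field; apply/and3P; split.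
Qed.

Lemma proj_center_mul (c : R[i]) (f : R) :
  proj_center alpha (expi alpha * c, f) = to_P2 (c, f).
Proof. by rewrite /proj_center /= mulrA expiNK mul1r. Qed.

(** If a motion moves a curve along itself, to first order, then its center lies
   on the rotated normal: division by kap turns the tangent direction into the
   direction of this line. *)
Lemma rotated_normal_mem (d y : R[i]) th (v : vec3 R) : d != 0 ->
  (exists r : R, d = r%:C * expi th) -> v != 0 ->
  cross2 d (vfield kap v y) = 0 -> rotated_normal alpha y th (to_P2 v).
Proof.
move=> d0 [r dE] v0 cr.
have [a []] := cross2_decomp (vfield kap v y) d0.
rewrite cr normr0 => /eqP; rewrite normc_eq0 subr_eq0 => /eqP vE _; rewrite /vfield in vE.
apply: (@line_through_mem _ _ _ _ (- (a * r))) => //.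
  rewrite !mulf_neq0 ?expi_neq0//.
  by rewrite -normc_gt0 normc_i.
rewrite -[LHS]mul1r -kap_inv -[LHS]mulrA vE dE rmorphN rmorphM /=.
ring.
Qed.

Lemma sin_int_pi (k : int) : sin (k%:~R * pi) = 0 :> R.
Proof.
have H (m : nat) : sin (m%:R * pi) = 0 :> R.
  elim: m => [|m IH]; first by rewrite mul0r sin0.
  by rewrite -natr1 mulrDl mul1r sinDpi IH oppr0.
case: k => m; first exact: H.
by rewrite NegzE mulrNz mulNr sinN -pmulrn H oppr0.
Qed.

Lemma kap_real : (exists k : int, alpha = pi / 2 + k%:~R * pi) -> complex.Im kap = 0.
Proof.
move=> [k ->]; rewrite /expi /= mul0r mul1r add0r.
by rewrite cosD cos_pihalf sin_int_pi; ring.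
Qed.

Lemma partial_comp_take (s : seq (step R)) e0 (x : nat -> vec3 R) i : (i <= size s)%N ->
  (forall j, x j = (expi alpha * (nth e0 s j).1.1, (nth e0 s j).1.2)) ->
  partial_comp alpha x i = comp kap (take i s).
Proof.
move=> + xE; elim: i => [|i IH] si; first by rewrite take0.
apply/funext => y; rewrite /= IH ?(ltnW si)// xE similarity_flow.
rewrite (take_nth e0)// -cats1 comp_cat /=; congr comp; congr flow.
Qed.

End Similarities.

Lemma unit_interval_cell (R : realType) Q (t : R) : (0 < Q)%N -> 0 <= t <= 1 ->
  exists i : 'I_Q, i%:R / Q%:R <= t <= i%:R / Q%:R + Q%:R^-1.
Proof.
move=> Q0 /andP[t0 t1]; have QR : 0 < Q%:R :> R by rewrite ltr0n.
have cellP (i : nat) : i%:R <= t * Q%:R <= i.+1%:R ->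
    i%:R / Q%:R <= t <= i%:R / Q%:R + Q%:R^-1.
  move=> /andP[a b]; rewrite ler_pdivrMr// a /= -[X in _ + X]mul1r -mulrDl.
  by rewrite ler_pdivlMr// natr1.
have tQ0 : 0 <= t * Q%:R by rewrite mulr_ge0// ltW.
have /andP[a b] := Num.Theory.truncn_itv tQ0.
have [kQ|kQ] := ltnP (Num.truncn (t * Q%:R)) Q.
  by exists (Ordinal kQ); apply: cellP; rewrite a ltW.
have Q1 : (Q.-1 < Q)%N by rewrite prednK.
exists (Ordinal Q1); apply: cellP; rewrite /= prednK//.
have QtQ : t * Q%:R <= Q%:R by rewrite ler_piMl// ltW.
rewrite QtQ andbT; apply: le_trans a; rewrite ler_nat.
exact: leq_trans (leq_pred _) kQ.
Qed.

(** The part of E not covered by the first m curves has small measure for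
   large m, and the points where one of the countably many curves is not
   tangent to the field form a null set. *)
Lemma exceptional_set (R : realType) (E : set R[i]) theta (g : nat -> R -> R[i]) (t0 : R) :
  (forall k, C1_curve (g k)) -> hausdorff1 (E `\` \bigcup_k curve_image (g k)) = 0%E ->
  (hausdorff1 E < +oo)%E -> tangent_field E theta -> 0 < t0 ->
  exists m A, [/\ A `<=` E, (hausdorff1 A < t0%:E)%E
    & forall y, E y -> ~ A y -> exists k t, [/\ (k < m)%N, 0 <= t <= 1, g k t = y
        & exists r : R, velocity (g k) t = r%:C * expi (theta y)]].
Proof.
move=> gC1 E0 Eoo tan t00.
have [m Hm] := hausdorff1_tail Eoo (fun k => curve_image_closed (gC1 k)) E0 t00.
pose D k := [set x | E x /\ exists t : R, [/\ 0 <= t <= 1, g k t = x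
  & ~ exists r : R, velocity (g k) t = r%:C * expi (theta x)]].
set B := E `\` _ in Hm.
exists m, (B `|` \bigcup_k D k); split.
- by move=> y [[]|[k _ []]].
- apply: le_lt_trans Hm.
  have /hausdorff1_le_tail : B `|` \bigcup_k D k
      `<=` B `|` \bigcup_(k in [set k | (0 <= k)%N]) D k.
    by apply: setUS => y [k _ Dy]; exists k.
  rewrite [X in (_ + X)%E]eseries0 ?adde0// => k _ _.
  exact: tan (gC1 k).
move=> y Ey /not_orP[nB nD].
have [k km [t t01 gt]] : (\bigcup_(k in [set k | (k < m)%N]) curve_image (g k)) y.
  by apply: contrapT => H; apply: nB; split.
rewrite /= in_itv /= in t01; exists k, t; split => //.
apply: contrapT => H; apply: nD; exists k => //; split => //.
by exists t.
Qed.

Section MainPath.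
Variables (R : realType) (alpha t0 eps : R) (n : vec3 R).
Local Notation kap := ('i%C * expi alpha).
Local Notation special := (exists k : int, alpha = pi / 2 + k%:~R * pi).
Hypotheses (nn : dot3 n n = 1) (t01 : 0 < t0 < 1) (eps_gt0 : 0 < eps).
Variables (E : set R[i]) (theta : R[i] -> R).
Hypotheses (Ebd : bounded_plane E) (Erect : rectifiable E).
Hypotheses (Eoo : (hausdorff1 E < +oo)%E) (tan : tangent_field E theta).

(** The set that a step of the path has to move, if u is the point chosen on the
   line. *)
Definition transverse u : set R[i] := [set y | E y /\
  ~ exists v, [/\ plane n v, rotated_normal alpha y (theta y) (to_P2 v)
    & dist_P2 (to_P2 u) (to_P2 v) < t0]].

(** The length of the path is at most P, whatever tau is. So the part of E outside
   finitely many curves, which has measure less than tau, sweeps an area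
   O(tau), like the cells. *)
Lemma transverse_path X : plane n X -> exists s : seq (step R), [/\ s != [::],
    forall y, comp kap s y = flow kap X y,
    forall e, e \in s -> near_plane n special (sin t0 / 2) e.1 /\ plane n e.2
  & (lebesgue2 (sweep kap transverse s) < eps%:E)%E].
Proof.
move=> [X0 nX].
have kap1 := normc_kap alpha.
have [f1 [f2 [[nf1 nf2] f11 f22 f12 span]]] := plane_basis nn.
pose z := (dot3 f1 X, dot3 f2 X).
have zX : comb f1 f2 z = X by rewrite /comb /= -span.
have z0 : z != 0.
  by apply: contra X0 => /eqP zE; rewrite -zX zE /comb /= !scale3_0 addr0.
have [M M0 ML] := exists_nat_gt (8 / (sin t0 / 8)).
pose Kf := cost_factor (sin t0 / 8) #|{: arcs M}| + 1.
have st := sin_gt0_small t01.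
have Kf0 : 0 <= Kf by rewrite addr_ge0// cost_factor_ge0// divr_gt0.
pose P := Kf * n1 z + 1.
have P0 : 0 < P by rewrite ltr_wpDl// mulr_ge0// n1_ge0.
have [Rad Rad0 ER] : exists2 Rad, 0 <= Rad & forall y, E y -> normc y <= Rad.
  have [B EB] := Ebd; exists (`|B|) => // y /EB H; exact: le_trans (ler_norm _).
have [g gC1 E0] := Erect.
pose C := 4 * (expR `|X.2| ^+ 2 * P)
  + 4 * (expR P ^+ 2 * ((2 * (3 * (1 + Rad) + 1)) ^+ 2 * (3 * P))) * 2.
have C0 : 0 <= C by rewrite /C; repeat (rewrite ?addr_ge0 ?mulr_ge0 ?sqr_ge0 ?(ltW P0)//).
(* C tau bounds the area swept by the cells and by the rest of E. *)
pose tau := eps / (C + 1).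
have C1 : 0 < C + 1 by rewrite ltr_wpDl.
have tau0 : 0 < tau by rewrite divr_gt0.
have [m [A [AE At Acur]]] := exceptional_set gC1 E0 Eoo tan tau0.
have [Q [Rad' [Q0 _ _ bc]]] := curves_bounded_cost kap1 nf1 nf2 f11 f22 f12
  (@kap_real _ alpha) t01 gC1 m tau0 (ltW ML).
rewrite -/Kf in bc.
have nz : dot3 n (comb f1 f2 z) = 0 by rewrite zX.
have [s [s0 sX se sl sc]] := bounded_cost_path kap1 tau0 Kf0 bc z0 nz.
rewrite zX -/P in sX sl sc.
exists s; split => // [e /se[]//|].
set Kp := kept _ _ _ in sc.
have sub : sweep kap transverse s `<=` sweep kap Kp s `|` sweep kap (fun _ => A) s.
  move=> q qs; apply: sweepU; move: q qs; apply: sweep_sub => u y [Ey nu].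
  have [Ay|nA] := pselect (A y); [by right|left].
  have [k [t [km t1 gt [r vE]]]] := Acur y Ey nA.
  have [i ti] := unit_interval_cell Q0 t1.
  exists (Ordinal km, i); split; first by rewrite finset.inE.
    move=> /(_ t ti) [v [[v0 nv] cr du]]; apply: nu; exists v; split => //.
    rewrite /= in cr; rewrite -gt; apply: rotated_normal_mem cr => //.
      exact: velocity_neq0.
    by exists r; rewrite gt.
  by exists t => //; rewrite /= in_itv.
apply: le_lt_trans (lebesgue2_sub sub) _; apply: le_lt_trans (lebesgue2U _ _) _.
have H1 := lebesgue2_covered sc.
have H2 := lebesgue2_sweep_hausdorff kap1 (fun y Ay => ER y (AE y Ay)) Rad0 P0 tau0
  (fun e es => let: And3 _ _ h := se e es in h) sl At.
apply: le_lt_trans (leeD H1 H2) _; rewrite -EFinD lte_fin.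
rewrite (_ : _ + _ = C * tau); last by rewrite /C; ring.
by rewrite /tau mulrA ltr_pdivrMr// mulrC ltr_pM2l// ltrDl.
Qed.

End MainPath.

Theorem theorem7p3 (R : realType) (E : set R[i]) (theta : R[i] -> R)
    (eps alpha : R) (w : R[i]) (phi : R) (l : set (P2 R)) :
  bounded_plane E ->
  rectifiable E ->
  (hausdorff1 E < +oo)%E ->
  tangent_field E theta ->
  0 < eps ->
  (w, phi) <> (0, 0) ->
  is_line l ->
  l (proj_center alpha (w, phi)) ->
  exists (n : nat) (x : nat -> vec3 R) (u : nat -> P2 R),
    [/\ (0 < n)%N,
        forall i, (i < n)%N ->
          [/\ x i <> (0, 0),
              nbhd_P2 l eps (proj_center alpha (x i)),
              (exists k : int, alpha = pi / 2 + k%:~R * pi) ->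
                l (proj_center alpha (x i))
            & l (u i)],
        partial_comp alpha x n = similarity alpha (w, phi)
      & (lebesgue2
           (\bigcup_(i in [set j | (j < n)%N])
              \bigcup_(p in path_piece alpha x i)
                [set p y | y in [set y | E y /\
                   rotated_normal alpha y (theta y) `&` l
                     `&` ball_P2 (u i) eps = set0]])
         < eps%:E)%E].
Proof.
move=> Ebd Erect Eoo tan eps0 wphi0 [n0 n00 lE] lc.
pose n := unit3 n0.
have n0z : n0 != 0 by apply/eqP.
have nn : dot3 n n = 1 by exact: dot3_unit3.
have nE v : (dot3 n0 v = 0) <-> (dot3 n v = 0).
  have c0 : (Num.sqrt (dot3 n0 n0))^-1 != 0.
    by rewrite invr_eq0 gt_eqF// sqrtr_gt0 dot3_gt0.
  rewrite /n /unit3 dot3C (dot3C _ v) dot3Zr; split => [->|/eqP]; first by rewrite mulr0.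
  by rewrite mulf_eq0 (negbTE c0) => /eqP.
have lP v : plane n v -> l (to_P2 v).
  by move=> [v0 nv]; rewrite lE; exists v => //; split; [exact/eqP|exact/nE].
(* Angles below 1 make the sine and cosine of t0 positive. *)
pose t0 := Num.min eps (1 / 2).
have t01 : 0 < t0 < 1.
  rewrite lt_min eps0 gt_min; apply/andP; split; first by rewrite divr_gt0.
  by apply/orP; right; lra.
have t0e : t0 <= eps by rewrite ge_min lexx.
pose X := (expi (- alpha) * w, phi).
have X0 : X != 0.
  apply: contra_notN wphi0 => /eqP[/eqP]; rewrite mulf_eq0 (negbTE (expi_neq0 _)) /=.
  by move=> /eqP -> ->.
have XE : (w, phi) = (expi alpha * X.1, X.2).
  by rewrite /X /= mulrA [_ * expi _]mulrC expiNK mul1r.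
have nX : dot3 n X = 0.
  move: lc; rewrite lE /proj_center /= -/X => -[v [/eqP v0 /nE nv] vX].
  have [c c0 ->] := to_P2_eq X0 v0 (esym vX).
  by rewrite dot3Zr nv mulr0.
have [s [s0 sX se smeas]] :=
  @transverse_path R alpha t0 eps n nn t01 eps0 E theta Ebd Erect Eoo tan X (conj X0 nX).
pose e0 : step R := (0, 0); pose e i := nth e0 s i.
pose x i : vec3 R := (expi alpha * (e i).1.1, (e i).1.2).
have es i : (i < size s)%N -> e i \in s by move=> si; exact: mem_nth.
have cx i : proj_center alpha (x i) = to_P2 (e i).1.
  by rewrite proj_center_mul; case: (e i).1.
exists (size s), x, (fun i => to_P2 (e i).2); split.
- by rewrite lt0n size_eq0.
- move=> i si; have [[e10 en spec] e2] := se _ (es i si); split.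
  + case=> /eqP; rewrite mulf_eq0 (negbTE (expi_neq0 _)) /= => /eqP h1 h2.
    by case/eqP: e10; rewrite [LHS]surjective_pairing h1 h2.
  + have [q [q0 nq qd]] := near_plane_dist nn t01 e10 en.
    by rewrite cx; exists (to_P2 q); [exact: lP|exact: lt_le_trans t0e].
  + by move=> /spec ne; rewrite cx; exact: lP.
  + exact: lP.
- rewrite (@partial_comp_take _ alpha s e0 x)// take_size XE similarity_flow.
  by apply/funext => y; rewrite sX.
apply: le_lt_trans smeas; apply: lebesgue2_sub => _ [i si [_ [t t1 <-] [y [Ey yl] <-]]].
rewrite /= in_itv /= in t1; rewrite /= in si.
rewrite /= (@partial_comp_take _ alpha s e0 x) ?(ltnW si)//.
have -> : scale3 t (x i) = (expi alpha * (t%:C * (e i).1.1), t * (e i).1.2).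
  by rewrite /scale3 /= mulrCA.
rewrite similarity_flow. apply: (@sweep_nth _ _ _ s e0 i y t si) => //; split => //.
move=> [v [pv nuv dv]].
have : set0 (to_P2 v); last by [].
by rewrite -yl; split; [split; [exact: nuv|exact: lP]|exact: lt_le_trans t0e].
Qed.
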